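(* Let $G$ be a torsion-free group such that $G$ is hyperbolic relative to a subgroup $H$. Then $G$ has finite cohomological dimension (over $\mathbb{Z}$) if and only if $H$ has finite cohomological dimension (over $\mathbb{Z}$).
   Context: **Relative hyperbolicity (Farb).** Let $G$ be a finitely generated group with finite generating set $S$ and $H<G$. Let $\Gamma(G,S)$ be the Cayley graph with unit-length edges and the path metric. The coned-off Cayley graph $\hat\Gamma(G,S,H)$ is obtained from $\Gamma(G,S)$ by adding, for each left coset $gH$, a vertex $v(gH)$ and an edge of length $\tfrac12$ between $v(gH)$ and each element of $gH$; it carries the path metric $\hat d$. $G$ is weakly relatively hyperbolic with respect to $H$ if $\hat\Gamma(G,S,H)$ is Gromov hyperbolic. For a path $c$ in $\Gamma(G,S)$, its image $\hat c$ is the path in $\hat\Gamma(G,S,H)$ obtained by replacing every maximal subpath $c|_{[a,b]}$ all of whose vertices lie in one coset $gH$ by the path of length $1$ from $c(a)$ to $c(b)$ through $v(gH)$. With $l'$ the length of $\hat c$, $c$ is a $T$-relative quasi-geodesic if $T^{-1}|t-t'|\le\hat d(\hat c(t),\hat c(t'))\le T|t-t'|$ for all $t,t'\in[0,l']$. A path $c$ travels in a coset $\gamma H$ for more than $r$ if there is a subsegment of $c$ with vertices in $\gamma H$ whose endpoints are at distance at least $r$. $(G,H)$ has Bounded Coset Penetration (BCP) if for every $T>0$ there is $r=r_{BCP}(T)$ such that any two $T$-relative quasi-geodesics $c_1,c_2$ in $\Gamma(G,S)$ with the same starting point and the same endpoint satisfy: (1) if $c_1$ travels more than $r$ in a coset,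 then $c_2$ enters that coset; (2) if $c_1$ and $c_2$ enter the same coset, then their entry points (respectively, exit points) are at most $r$ apart. $G$ is hyperbolic relative to $H$ if it is weakly relatively hyperbolic with respect to $H$ and satisfies BCP.
   Formalization: In the definition of relative hyperbolicity the finite generating set S of G is also required to contain a generating set of H (so H is finitely generated), as in Farb's setting; without this the claim fails. *)

(* Defs.v *)
From HB Require Import structures.
From mathcomp Require Import all_boot all_order all_algebra.
From mathcomp Require Import boolp classical_sets reals.

Set Implicit Arguments.
Unset Strict Implicit.
Unset Printing Implicit Defensive.

Import Order.TTheory GRing.Theory Num.Theory.

Local Open Scope classical_set_scope.
Local Open Scope ring_scope.

Definition torsion_free (G : groupType) : Prop :=
  forall (g : G) (n : nat), (0 < n)%N -> (g ^+ n = 1)%g -> g = 1%g.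

(** [A] is contained in the subgroup of [G] generated by [S]. *)
Definition generates (G : groupType) (S : seq G) (A : {pred G}) : Prop :=
  forall K : {pred G}, group_closed K -> {subset S <= K} -> {subset A <= K}.

Definition subgroup_type (G : groupType) (H : groupClosed G) : Type :=
  {x : G | x \in H}.

Section SubgroupType.
Variables (G : groupType) (H : groupClosed G).

HB.instance Definition _ := SubChoice.on (subgroup_type H).

Fact subgroup_closed : group_closed H.
Proof. by split; [exact: gpred1 | exact: gpredF]. Qed.

HB.instance Definition _ :=
  SubChoice_isSubGroup.Build G (fun x => x \in H) (subgroup_type H)
    subgroup_closed.

End SubgroupType.

Record metric_graph (R : realType) := MetricGraph {
  vertex : Type;
  adj : vertex -> vertex -> Prop;
  len : vertex -> vertex -> R }.

Section MetricGraph.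
Variables (R : realType) (X : metric_graph R).

(** Points of the geometric realization are given by their barycentric
    coordinates: [bary u v t] is the point dividing the edge from [u] to [v]
    in the ratio [t : 1 - t]. *)
Definition bary (u v : vertex X) (t : R) : vertex X -> R :=
  fun w => (1 - t) * `[< w = u >]%:R + t * `[< w = v >]%:R.

Definition vpoint (u : vertex X) : vertex X -> R := bary u u 0.

Definition realization : set (vertex X -> R) :=
  [set x | exists u v t, [/\ adj u v, 0 <= t <= 1 & x = bary u v t]].

(** [joined x y l]: some path of length [l], made of finitely many segments
    each contained in an edge, goes from [x] to [y]. *)
Inductive joined : (vertex X -> R) -> (vertex X -> R) -> R -> Prop :=
| joined_refl x : joined x x 0
| joined_step u v (s t : R) y l :
    adj u v -> 0 <= s <= 1 -> 0 <= t <= 1 -> joined (bary u v t) y l ->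
    joined (bary u v s) y (len u v * `|s - t| + l).

Definition path_dist (x y : vertex X -> R) : R := inf [set l | joined x y l].

(** Edge paths are given by their first vertex [u] and the sequence [p] of
    their other vertices. *)
Fixpoint path_length (u : vertex X) (p : seq (vertex X)) : R :=
  if p is v :: p' then len u v + path_length v p' else 0.

Fixpoint arclength_point (u : vertex X) (p : seq (vertex X)) (t : R) :
    vertex X -> R :=
  if p is v :: p' then
    if t <= len u v then bary u v (t / len u v)
    else arclength_point v p' (t - len u v)
  else vpoint u.

End MetricGraph.

Arguments vpoint {R} X u.
Arguments realization {R} X.
Arguments path_dist {R} X x y.
Arguments path_length {R} X u p.
Arguments arclength_point {R} X u p t.

Definition gromov_product (R : realType) (T : Type) (d : T -> T -> R)
  (w x y : T) : R := (d x w + d y w - d x y) / 2.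

Definition gromov_hyperbolic (R : realType) (T : Type) (A : set T)
    (d : T -> T -> R) : Prop :=
  exists delta : R, forall w x y z, A w -> A x -> A y -> A z ->
    Num.min (gromov_product d w x y) (gromov_product d w y z) - delta
      <= gromov_product d w x z.

Section RelativeHyperbolicity.
Variables (R : realType) (G : groupType) (S : seq G) (H : groupClosed G).

Definition cayley_adj : rel G :=
  fun g h => (g != h) && ((g^-1 * h \in S) || (h^-1 * g \in S))%g.

Definition cayley_graph : metric_graph R :=
  MetricGraph (fun g h : G => cayley_adj g h) (fun _ _ => 1).

Definition word_dist (g h : G) : R :=
  path_dist cayley_graph (vpoint cayley_graph g) (vpoint cayley_graph h).

Definition in_coset (g : G) : {pred G} := fun x => (g^-1 * x)%g \in H.

Definition lcoset_set (g : G) : set G := [set x | in_coset g x].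

(** The vertex [inr A] is the cone vertex of [A]; it is isolated, and so
    outside the realization, unless [A] is a left coset of [H]. *)
Definition coned_adj (u v : G + set G) : Prop :=
  match u, v with
  | inl g, inl h => cayley_adj g h
  | inl g, inr A | inr A, inl g => A = lcoset_set g
  | inr _, inr _ => False
  end.

Definition coned_len (u v : G + set G) : R :=
  match u, v with inl _, inl _ => 1 | _, _ => 2^-1 end.

Definition coned_graph : metric_graph R := MetricGraph coned_adj coned_len.

Definition weakly_rel_hyperbolic : Prop :=
  gromov_hyperbolic (realization coned_graph) (path_dist coned_graph).

(** [hat_rec b x p] is the image of the path [x :: p], without its first
    vertex, when [b] tells whether a run (a nondegenerate maximal subpath with
    vertices in one coset) that started before [x] extends at least to [x]. *)
Fixpoint hat_rec (b : bool) (x : G) (p : seq G) : seq (G + set G) :=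
  let close_run := if b then [:: inr (lcoset_set x); inl x] else [::] in
  if p is y :: p' then
    if in_coset x y then hat_rec true y p'
    else close_run ++ inl y :: hat_rec false y p'
  else close_run.

Definition hat_path (x : G) (p : seq G) : seq (G + set G) := hat_rec false x p.

Definition hat_length (x : G) (p : seq G) : R :=
  path_length coned_graph (inl x) (hat_path x p).

Definition hat_point (x : G) (p : seq G) : R -> (G + set G -> R) :=
  arclength_point coned_graph (inl x) (hat_path x p).

Definition rel_quasi_geodesic (T : R) (x : G) (p : seq G) : Prop :=
  forall t t' : R, 0 <= t <= hat_length x p -> 0 <= t' <= hat_length x p ->
    T^-1 * `|t - t'|
      <= path_dist coned_graph (hat_point x p t) (hat_point x p t')
      <= T * `|t - t'|.

Definition travels (r : R) (x : G) (p : seq G) (g : G) : Prop :=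
  exists i j : nat, [/\ (i <= j <= size p)%N,
    forall k : nat, (i <= k <= j)%N -> in_coset g (nth x (x :: p) k) &
    r <= word_dist (nth x (x :: p) i) (nth x (x :: p) j)].

Definition enters (x : G) (p : seq G) (g : G) : bool :=
  has (in_coset g) (x :: p).

Definition entry_point (x : G) (p : seq G) (g : G) : G :=
  head x (filter (in_coset g) (x :: p)).

Definition exit_point (x : G) (p : seq G) (g : G) : G :=
  last x (filter (in_coset g) (x :: p)).

Definition bounded_coset_penetration : Prop :=
  forall T : R, 0 < T -> exists r : R,
  forall (x : G) (p1 p2 : seq G),
    path cayley_adj x p1 -> path cayley_adj x p2 -> last x p1 = last x p2 ->
    rel_quasi_geodesic T x p1 -> rel_quasi_geodesic T x p2 ->
    (forall g : G, travels r x p1 g -> enters x p2 g) /\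
    (forall g : G, enters x p1 g -> enters x p2 g ->
       word_dist (entry_point x p1 g) (entry_point x p2 g) <= r /\
       word_dist (exit_point x p1 g) (exit_point x p2 g) <= r).

End RelativeHyperbolicity.

(** The finite generating set has to contain generators of [H], as in Farb's
    definition: paths of the Cayley graph only follow the edges labelled in
    [S], so they could not travel in the cosets of [H] if for instance [S] did
    not meet [H], and then penetration would say next to nothing. *)
Definition rel_hyperbolic (R : realType) (G : groupType) (H : groupClosed G) :
    Prop :=
  exists S : seq G,
    [/\ generates S predT,
        generates [seq s <- S | s \in H] H,
        weakly_rel_hyperbolic R S H &
        bounded_coset_penetration R S H].

(** A left module over the integral group ring of [G] amounts to an abelian
    group on which [G] acts by additive maps. *)
Record gmodule (G : groupType) := GModule {
  gm_sort :> zmodType;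
  gact : G -> {additive gm_sort -> gm_sort};
  gact1 : forall m, gact 1%g m = m;
  gactM : forall g h m, gact (g * h)%g m = gact g (gact h m) }.

Arguments gact {G M} g : rename.

Record ghom (G : groupType) (M N : gmodule G) := GHom {
  gh_fun :> {additive M -> N};
  ghomJ : forall g m, gh_fun (gact g m) = gact g (gh_fun m) }.

Definition trivial_gmodule (G : groupType) : gmodule G :=
  @GModule G int (fun=> idfun) (fun=> erefl) (fun _ _ _ => erefl).

Definition projective (G : groupType) (P : gmodule G) : Prop :=
  forall (M N : gmodule G) (e : ghom M N) (f : ghom P N),
    (forall y, exists x, e x = y) ->
    exists f' : ghom P M, forall p, e (f' p) = f p.

(** A projective resolution of the trivial module with no term beyond degree
    [n]. *)
Definition cd_le (G : groupType) (n : nat) : Prop :=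
  exists (P : nat -> gmodule G) (d : forall i, ghom (P i.+1) (P i))
         (eps : ghom (P 0%N) (trivial_gmodule G)),
    [/\ forall i, projective (P i),
        forall i, (n < i)%N -> forall x : P i, x = 0,
        forall z, exists x, eps x = z,
        forall x, eps x = 0 <-> exists y, d 0%N y = x &
        forall i x, d i x = 0 <-> exists y, d i.+1 y = x].

Definition finite_cd (G : groupType) : Prop := exists n, cd_le G n.

(* Main.v *)
From HB Require Import structures.
Require Import Defs.
From mathcomp Require Import all_boot all_order all_algebra.
From mathcomp Require Import boolp classical_sets functions fsbigop reals.
From mathcomp Require Import zify ring lra.

(** Finite cohomological dimension passes to subgroups, since restriction of
    projective modules is adjoint to an exact coinduction.

    Conversely, let [K] be the coned-off Cayley graph. Bounded coset penetration
    makes [K] fine: two elements of a coset [A] joined by a short path of [K]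
    that avoids the cone vertex of [A] are close for the word metric. In the
    relative Rips complex, two vertices of [K] are adjacent when they are close
    in [K] and the geodesics between them make only bounded jumps at each cone
    vertex. Its cliques have bounded size, and as [G] is torsion-free a
    nontrivial element of [G] stabilizes no clique with more than one vertex.
    The complex is acyclic by Rips' argument: in a finite set of vertices that
    is not dominated by the base point, some vertex can be replaced by one that
    is closer to the base point and adjacent to at least the same vertices of
    the set; either a cone vertex at which a wide angle is seen, or a point of
    a geodesic starting from a farthest vertex. The alternating chains of the
    complex are thus a finite resolution of [Z] by projective modules, but for
    the summand [Z[G/H]] in degree [0], which has a finite resolution by
    modules induced from [H]; a mapping cone puts both together. *)

Set Implicit Arguments.
Unset Strict Implicit.
Unset Printing Implicit Defensive.

Import Order.TTheory GRing.Theory Num.Theory.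

(** * Modules over a group *)

Local Open Scope ring_scope.

(** In the ordinary Rips complex of the coned-off graph the elements of a coset are pairwise close,
    so that cliques are infinite when [H] is. Bounding angles at the cone vertices restores
    finiteness, but a move towards the base point may then create a wide angle. This is why Rips'
    argument needs a second kind of move, onto the cone vertex itself.

    Chains are alternating rather than ordered: ordered simplices may repeat vertices and exist in
    every degree, which would ruin the bound on the length. In return, the setwise stabilizers of
    simplices have to be trivial, and not only the pointwise ones. A cone vertex alone is stabilized
    by a conjugate of [H], which is why degree 0 is treated apart.

    Penetration speaks of paths of the Cayley graph whose images are quasi-geodesics for arc length.
    It can be applied here because a simple path of bounded length is a quasi-geodesic, with a
    constant that depends on the length alone. *)

Definition additive_of (U V : zmodType) (f : U -> V)
    (fB : forall x y, f (x - y) = f x - f y) : {additive U -> V} :=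
  HB.pack f (GRing.isZmodMorphism.Build U V f fB).

Definition ghom_of (G : groupType) (M N : gmodule G) (f : M -> N)
    (fB : forall x y, f (x - y) = f x - f y)
    (fJ : forall g m, f (gact g m) = gact g (f m)) : ghom M N :=
  @GHom G M N (additive_of fB) fJ.

Definition ghom_comp (G : groupType) (M N L : gmodule G) (f : ghom N L)
    (h : ghom M N) : ghom M L.
Proof.
apply: (@ghom_of G M L (fun x => f (h x))) => [x y|g m]; first by rewrite !raddfB.
by rewrite !ghomJ.
Defined.

(** * Submodules, modules of functions, direct sums *)

Section SubModule.
Variables (G : groupType) (M : gmodule G) (P : M -> Prop).
Hypotheses (P0 : P 0) (PB : forall x y, P x -> P y -> P (x - y)).
Hypothesis PJ : forall g x, P x -> P (gact g x).

Definition submod_pred : {pred M} := fun x => `[< P x >].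

(** The closure proofs are phantom arguments: with them the type determines the subgroup, so that
    the instances below can be inferred from the type alone. *)
Definition submod_sort (_ : P 0) (_ : forall x y, P x -> P y -> P (x - y)) :
  Type := {m : M | submod_pred m}.

HB.instance Definition _ := SubChoice.on (submod_sort P0 PB).

Fact submod_closed : zmod_closed submod_pred.
Proof.
split=> [|x y]; first exact/asboolP.
by move=> /asboolP xP /asboolP yP; apply/asboolP/PB.
Qed.

HB.instance Definition _ :=
  GRing.SubChoice_isSubZmodule.Build M submod_pred (submod_sort P0 PB)
    submod_closed.

Local Notation T := (submod_sort P0 PB).

Definition insub_mod (x : M) (Px : P x) : T := exist _ x (asboolT Px).

Lemma submodP (x : T) : P (val x).
Proof. exact/asboolP/(valP x). Qed.

Definition submod_act g (x : T) : T := insub_mod (PJ g (submodP x)).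

Fact submod_actB g x y : submod_act g (x - y) = submod_act g x - submod_act g y.
Proof. by apply: val_inj; rewrite /= !raddfB. Qed.

Definition submod : gmodule G.
Proof.
apply: (@GModule G T (fun g => additive_of (submod_actB g))) => [m|g h m];
  apply: val_inj => /=; [exact: gact1 | exact: gactM].
Defined.

Definition submod_val : ghom submod M.
Proof. exact: (@ghom_of G submod M (val : T -> M)). Defined.

Lemma submod_val_inj : injective submod_val.
Proof. exact: val_inj. Qed.

Lemma submod_valP x : P (submod_val x).
Proof. exact: submodP. Qed.

Definition submod_corestrict (N : gmodule G) (f : ghom N M)
  (Pf : forall x, P (f x)) : ghom N submod.
Proof.
apply: (@ghom_of G N submod (fun x => insub_mod (Pf x))) => [x y|g x];
  apply: val_inj => /=; [exact: raddfB | exact: ghomJ].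
Defined.

End SubModule.

Arguments submod_val {G M P P0 PB PJ}.
Arguments submod_val_inj {G M P P0 PB PJ} [x1 x2].
Arguments submod_valP {G M P P0 PB PJ} x.
Arguments insub_mod {G M P P0 PB} [x].
Arguments submod_corestrict {G M P P0 PB PJ N f}.

Section FunModule.
Variables (G : groupType) (X : Type) (M : zmodType) (r : G -> X -> X).
Hypotheses (r1 : forall x, r 1%g x = x)
  (rM : forall g h x, r (g * h)%g x = r h (r g x)).

(** Precomposition reverses products, which is why [r] is a right action. *)
Definition fun_act (g : G) (f : X -> M) : X -> M := fun x => f (r g x).

Fact fun_actB g f f' : fun_act g (f - f') = fun_act g f - fun_act g f'.
Proof. by apply/funext. Qed.

Definition funmod : gmodule G.
Proof.
apply: (@GModule G (X -> M) (fun g => additive_of (fun_actB g))) => [f|g h f];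
  apply/funext => x /=; rewrite /fun_act; first by rewrite r1.
by rewrite rM.
Defined.
End FunModule.

Section SumModule.
Variables (G : groupType) (M N : gmodule G).

Definition sum_act g (x : M * N) : M * N := (gact g x.1, gact g x.2).

Fact sum_actB g x y : sum_act g (x - y) = sum_act g x - sum_act g y.
Proof. by rewrite /sum_act /= !raddfB. Qed.

Definition summod : gmodule G.
Proof.
apply: (@GModule G (M * N)%type (fun g => additive_of (sum_actB g))).
- by case=> x y; rewrite /= /sum_act !gact1.
- by move=> g h [x y]; rewrite /= /sum_act !gactM.
Defined.

Lemma projective_summod : projective M -> projective N -> projective summod.
Proof.
move=> pM pN A B e f e_onto.
have inlB (x y : M) : f (x - y, 0) = f (x, 0) - f (y, 0).
  by rewrite -raddfB /=; congr (f (_, _)); rewrite subr0.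
have inrB (x y : N) : f (0, x - y) = f (0, x) - f (0, y).
  by rewrite -raddfB /=; congr (f (_, _)); rewrite subr0.
have inlJ g (x : M) : f (gact g x, 0) = gact g (f (x, 0)).
  by rewrite -ghomJ /= /sum_act /= raddf0.
have inrJ g (x : N) : f (0, gact g x) = gact g (f (0, x)).
  by rewrite -ghomJ /= /sum_act /= raddf0.
have [f1 f1E] := pM A B e (ghom_of inlB inlJ) e_onto.
have [f2 f2E] := pN A B e (ghom_of inrB inrJ) e_onto.
have fB (x y : summod) :
    f1 (x - y).1 + f2 (x - y).2 = (f1 x.1 + f2 x.2) - (f1 y.1 + f2 y.2).
  by rewrite !raddfB opprD addrACA.
have fJ g (x : summod) :
    f1 (gact g x).1 + f2 (gact g x).2 = gact g (f1 x.1 + f2 x.2).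
  by rewrite /= !ghomJ raddfD.
exists (ghom_of fB fJ) => -[x y] /=.
by rewrite raddfD f1E f2E /= -raddfD /=; congr (f (_, _)); rewrite ?addr0 ?add0r.
Qed.

End SumModule.

Section Projective.
Variable G : groupType.

(** Projectivity is stated against surjections, so both maps are corestricted to the image of [e].
    This form suits exact sequences, where [e] maps onto cycles only. *)
Lemma projective_lift (P M N : gmodule G) (e : ghom M N) (f : ghom P N) :
  projective P -> (forall p, exists x, e x = f p) ->
  exists f' : ghom P M, forall p, e (f' p) = f p.
Proof.
move=> pP fe; pose im (y : N) := exists x, e x = y.
have im0 : im 0 by exists 0; rewrite raddf0.
have imB x y : im x -> im y -> im (x - y).
  by move=> [a <-] [b <-]; exists (a - b); rewrite raddfB.
have imJ g x : im x -> im (gact g x).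
  by move=> [a <-]; exists (gact g a); rewrite ghomJ.
have eim x : im (e x) by exists x.
have [|f' f'E] := pP _ _ (submod_corestrict (P0:=im0) (PB:=imB) (PJ:=imJ) eim)
  (submod_corestrict fe).
  move=> y; have [x xy] := submod_valP y.
  by exists x; apply: submod_val_inj.
by exists f' => p; have /(congr1 submod_val) := f'E p.
Qed.

End Projective.

(** * Restriction to a subgroup and coinduction *)

Section Restriction.
Variables (G : groupType) (H : groupClosed G).
Local Notation HT := (subgroup_type H).

Definition res (M : gmodule G) : gmodule HT.
Proof.
apply: (@GModule HT M (fun h => gact (val h))) => [m|g h m].
  exact: gact1.
exact: gactM.
Defined.

Definition res_hom (M N : gmodule G) (f : ghom M N) : ghom (res M) (res N).
Proof. exact: (@GHom HT (res M) (res N) f (fun h => ghomJ f (val h))). Defined.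

Section Coinduction.
Variable N : gmodule HT.

Definition right_act (g x : G) : G := (x * g)%g.
Fact right_act1 x : right_act 1%g x = x. Proof. exact: mulg1. Qed.
Fact right_actM g h x : right_act (g * h)%g x = right_act h (right_act g x).
Proof. exact: mulgA. Qed.

(** These functions form [Hom(Z[G], N)] over [Z[H]], with [G] acting by right translation of the
    argument. *)
Definition coind_pred (F : G -> N) : Prop :=
  forall (h : HT) x, F (val h * x)%g = gact h (F x).

Fact coind0 : coind_pred 0.
Proof. by move=> h x; rewrite /= raddf0. Qed.

Fact coindB F F' : coind_pred F -> coind_pred F' -> coind_pred (F - F').
Proof. by move=> FP F'P h x; rewrite !fctE FP F'P raddfB. Qed.

Fact coindJ g (F : funmod N right_act1 right_actM) :
  coind_pred F -> coind_pred (gact g F).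
Proof. by move=> FP h x /=; rewrite /fun_act /right_act -mulgA FP. Qed.

Definition coind : gmodule G :=
  @submod G (funmod N right_act1 right_actM) coind_pred coind0 coindB coindJ.

Definition mk_coind (F : G -> N) (FP : coind_pred F) : coind :=
  @insub_mod G (funmod N right_act1 right_actM) coind_pred coind0 coindB F FP.

End Coinduction.

Definition rrep (x : G) : G := xget 1%g [set y | (x * y^-1)%g \in H].

Lemma rrepP x : (x * (rrep x)^-1)%g \in H.
Proof.
by rewrite /rrep; case: xgetP => //= /(_ x); rewrite /= mulgV gpred1.
Qed.

Lemma rrepM (h : HT) x : rrep (val h * x)%g = rrep x.
Proof.
rewrite /rrep; congr (xget _ _); apply/seteqP; split=> y /= yP.
  have hV : ((val h)^-1)%g \in H by rewrite gpredV (valP h).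
  have := gpredM _ _ hV yP.
  by rewrite !mulgA mulVg mul1g.
by rewrite -mulgA; apply: gpredM => //; exact: valP.
Qed.

(** Coinduction is exact because [Z[G]] is free over [Z[H]]: preimages are chosen at representatives
    of the right cosets, and equivariance dictates the other values. *)
Lemma coind_onto (M N : gmodule HT) (e : ghom M N) :
  (forall y, exists x, e x = y) ->
  exists e' : ghom (coind M) (coind N),
    (forall y, exists x, e' x = y) /\
    (forall x g, submod_val (e' x) g = e (submod_val x g)).
Proof.
move=> e_onto; pose e1 (F : coind M) : G -> N := fun g => e (submod_val F g).
have e1P (F : coind M) : coind_pred (e1 F).
  move=> h x; rewrite /e1.
  have FP : coind_pred (submod_val F) := submod_valP F.
  by rewrite FP ghomJ.
have e1B (F F' : coind M) : mk_coind (e1P (F - F')) =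
    mk_coind (e1P F) -
    mk_coind (e1P F').
  by apply: val_inj; apply/funext => x /=; rewrite /e1 !fctE /= raddfB.
have e1J g (F : coind M) :
    mk_coind (e1P (gact g F)) =
    gact g (mk_coind (e1P F)).
  by apply: val_inj; apply/funext.
exists (@ghom_of G (coind M) (coind N) _ e1B e1J); split=> // F.
have /choice[s sP] := e_onto.
pose c (x : G) : HT := exist (fun y => y \in H) _ (rrepP x).
pose F1 (x : G) : M := gact (c x) (s (submod_val F (rrep x))).
have F1P : coind_pred F1.
  move=> h x; rewrite /F1 rrepM -gactM; congr (gact _ _).
  by apply: val_inj; rewrite /= rrepM mulgA.
exists (mk_coind F1P).
apply: val_inj; apply/funext => x; rewrite /= /e1 /= /F1 ghomJ sP.
have FP : coind_pred (submod_val F) := submod_valP F.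
by rewrite -FP /= -mulgA mulVg mulg1.
Qed.

(** By adjunction, [f] amounts to the map from [P] to [coind N] that sends [p] to the function
    [x |-> f (gact x p)]. That map is lifted to [coind M], and evaluation at [1] goes back. *)
Lemma projective_res (P : gmodule G) : projective P -> projective (res P).
Proof.
move=> pP M N e f e_onto.
have [e' [e'_onto e'E]] := coind_onto e_onto.
pose f1 (p : P) : G -> N := fun x => f (gact x p).
have f1P p : coind_pred (f1 p).
  by move=> h x; rewrite /f1 gactM -ghomJ.
have f1B p q : mk_coind (f1P (p - q)) =
    mk_coind (f1P p) -
    mk_coind (f1P q).
  by apply: val_inj; apply/funext => x /=; rewrite /f1 !fctE /= !raddfB.
have f1J g p :
    mk_coind (f1P (gact g p)) =
    gact g (mk_coind (f1P p)).
  by apply: val_inj; apply/funext => x; rewrite /= /f1 /fun_act /right_act /= gactM.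
have [f2 f2E] := pP _ _ e' (@ghom_of G P (coind N) _ f1B f1J) e'_onto.
have f3B p q : submod_val (f2 (p - q)) 1%g =
    submod_val (f2 p) 1%g - submod_val (f2 q) 1%g.
  by rewrite !raddfB.
have f3J (h : HT) p : submod_val (f2 (gact (val h) p)) 1%g =
    gact h (submod_val (f2 p) 1%g).
  have FP : coind_pred (submod_val (f2 p)) := submod_valP (f2 p).
  by rewrite !ghomJ /= /fun_act /right_act mul1g -FP mulg1.
exists (@ghom_of HT (res P) M (fun p => submod_val (f2 p) 1%g) f3B f3J) => p.
by rewrite /= -e'E f2E /= /f1 gact1.
Qed.

Lemma cd_le_sub n : cd_le G n -> cd_le HT n.
Proof.
move=> [P [d [eps [pP P0 eps_onto ex0 ex]]]].
exists (fun i => res (P i)), (fun i => res_hom (d i)).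
exists (@GHom HT (res (P 0%N)) (trivial_gmodule HT) eps
  (fun h => ghomJ eps (val h))).
split=> // i; exact: projective_res.
Qed.

End Restriction.

(** * Sums with finite support *)

Definition fsupp (T : eqType) (M : zmodType) (F : T -> M) : Prop :=
  exists s : seq T, forall x, F x != 0 -> x \in s.

(** The sum is 0 by convention when the support is infinite, hence the hypotheses [fsupp] below. *)
Definition fsum (T : choiceType) (M : zmodType) (F : T -> M) : M :=
  \sum_(x \in [set: T]) F x.

Section FiniteSums.
Variables (T : choiceType) (M : zmodType).
Implicit Types F : T -> M.

Lemma fsumE (s : seq T) F : uniq s -> (forall x, F x != 0 -> x \in s) ->
  fsum F = \sum_(x <- s) F x.
Proof.
move=> us sF; rewrite /fsum (fsbigE s) //; first by apply: eq_bigl => x; rewrite in_setT.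
by move=> x _ xs; apply/eqP/negPn; apply: contra xs => /sF.
Qed.

Lemma fsupp_uniq F : fsupp F ->
  exists2 s, uniq s & forall x, F x != 0 -> x \in s.
Proof.
by move=> [s sF]; exists (undup s); rewrite ?undup_uniq // => x /sF; rewrite mem_undup.
Qed.

Lemma fsupp0 : fsupp (0 : T -> M).
Proof. by exists [::] => x; rewrite [X in X != _](_ : _ = 0) ?eqxx. Qed.

Lemma fsuppB F F' : fsupp F -> fsupp F' -> fsupp (F - F').
Proof.
move=> [s sF] [s' sF']; exists (s ++ s') => x; rewrite mem_cat !fctE.
case: (eqVneq (F x) 0) => [->|/sF-> //]; case: (eqVneq (F' x) 0) => [->|/sF'-> //].
  by rewrite subrr eqxx.
by rewrite orbT.
Qed.

Lemma fsumB F F' : fsupp F -> fsupp F' -> fsum (fun x => F x - F' x) = fsum F - fsum F'.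
Proof.
move=> [s sF] [s' sF']; pose r := undup (s ++ s').
have ur : uniq r by apply: undup_uniq.
have rF x : F x != 0 -> x \in r by rewrite mem_undup mem_cat => /sF->.
have rF' x : F' x != 0 -> x \in r by rewrite mem_undup mem_cat => /sF'->; rewrite orbT.
rewrite (fsumE ur rF) (fsumE ur rF') (fsumE ur) ?sumrB //.
move=> x; case: (eqVneq (F x) 0) => [->|/rF //].
by case: (eqVneq (F' x) 0) => [->|/rF' //]; rewrite subrr eqxx.
Qed.

Lemma fsum1 F a : (forall x, x != a -> F x = 0) -> fsum F = F a.
Proof.
move=> F0; rewrite (@fsumE [:: a]) ?big_seq1 // => x.
by rewrite inE; apply: contraR => /F0->.
Qed.

Lemma fsum0 F : (forall x, F x = 0) -> fsum F = 0.
Proof. by move=> F0; rewrite (@fsumE [::]) ?big_nil // => x; rewrite F0 eqxx. Qed.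

Lemma eq_fsum F F' : F =1 F' -> fsum F = fsum F'.
Proof. by move=> /funext->. Qed.

Lemma fsum_bij F (g g' : T -> T) : cancel g g' -> cancel g' g ->
  fsum (F \o g) = fsum F.
Proof. by move=> gK g'K; rewrite /fsum [RHS](reindex_fsbigT g) //; exact: (Bijective gK g'K). Qed.

End FiniteSums.

Lemma raddf_fsum (T : choiceType) (M N : zmodType) (f : {additive M -> N})
  (F : T -> M) : fsupp F ->
  f (fsum F) = fsum (f \o F).
Proof.
move=> /fsupp_uniq[s us sF]; rewrite (fsumE us sF) (fsumE us) ?raddf_sum // => x /=.
by case: (eqVneq (F x) 0) => [->|/sF //]; rewrite raddf0 eqxx.
Qed.

(** * Induced modules *)

Section Induction.
Variables (G : groupType) (H : groupClosed G).
Local Notation HT := (subgroup_type H).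

Definition left_act (g x : G) : G := (g^-1 * x)%g.
Fact left_act1 x : left_act 1%g x = x.
Proof. by rewrite /left_act invg1 mul1g. Qed.
Fact left_actM g h x : left_act (g * h)%g x = left_act h (left_act g x).
Proof. by rewrite /left_act invgM mulgA. Qed.

Section IndModule.
Variable P : gmodule HT.

(** A model of the tensor product of [Z[G]] and [P] over [Z[H]]: [f] stands for the sum of the
    tensors of [x] and [f x] over representatives [x] of the left cosets. The first condition makes
    each term independent of the representative. *)
Definition ind_pred (f : G -> P) : Prop :=
  (forall (h : HT) x, f (x * val h)%g = gact h^-1%g (f x)) /\
  exists s : seq G, forall x, f x != 0 -> has (fun y => (y^-1 * x)%g \in H) s.

Fact ind0 : ind_pred 0.
Proof.
split=> [h x|]; first by rewrite /= raddf0.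
by exists [::] => x; rewrite [X in X != _](_ : _ = 0) ?eqxx.
Qed.

Fact indB f f' : ind_pred f -> ind_pred f' -> ind_pred (f - f').
Proof.
move=> [fP [s sf]] [f'P [s' sf']]; split=> [h x|].
  by rewrite !fctE fP f'P raddfB.
exists (s ++ s') => x; rewrite has_cat !fctE.
case: (eqVneq (f x) 0) => [->|/sf-> //]; case: (eqVneq (f' x) 0) => [->|/sf'->].
  by rewrite subrr eqxx.
by rewrite orbT.
Qed.

Fact indJ g (f : funmod P left_act1 left_actM) : ind_pred f -> ind_pred (gact g f).
Proof.
move=> [fP [s sf]]; split=> [h x|]; first by rewrite /= /fun_act /left_act mulgA fP.
exists [seq (g * y)%g | y <- s] => x /sf; rewrite has_map.
by apply: sub_has => y; rewrite /left_act /= invgM mulgA.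
Qed.

Definition ind : gmodule G :=
  @submod G (funmod P left_act1 left_actM) ind_pred ind0 indB indJ.

Definition mk_ind (f : G -> P) (fP : ind_pred f) : ind :=
  @insub_mod G (funmod P left_act1 left_actM) ind_pred ind0 indB f fP.

Definition ind_fun (f : ind) : G -> P := submod_val f.

Lemma ind_funP f : ind_pred (ind_fun f).
Proof. exact: (submod_valP f). Qed.

Lemma ind_funM f (h : HT) x : ind_fun f (x * val h)%g = gact h^-1%g (ind_fun f x).
Proof. exact: (ind_funP f).1. Qed.

Lemma ind_ext f f' : ind_fun f =1 ind_fun f' -> f = f'.
Proof. by move=> ff'; apply: val_inj; apply/funext. Qed.

Lemma ind_funB f f' x : ind_fun (f - f') x = ind_fun f x - ind_fun f' x.
Proof. by []. Qed.

Lemma ind_funJ g f x : ind_fun (gact g f) x = ind_fun f (g^-1 * x)%g.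
Proof. by []. Qed.

End IndModule.

Lemma ind_hom_pred (M N : gmodule HT) (f : ghom M N) (F : ind M) :
  ind_pred (fun x => f (ind_fun F x)).
Proof.
have [FP [s sF]] := ind_funP F; split=> [h x|]; first by rewrite FP ghomJ.
by exists s => x fx; apply: sF; apply: contra fx => /eqP->; rewrite raddf0.
Qed.

Definition ind_hom (M N : gmodule HT) (f : ghom M N) : ghom (ind M) (ind N).
Proof.
apply: (@ghom_of G (ind M) (ind N) (fun F => mk_ind (ind_hom_pred f F))) => [x y|g x].
  by apply: ind_ext => z; rewrite ind_funB /ind_fun /= -raddfB.
by apply: ind_ext.
Defined.

Lemma ind_homE (M N : gmodule HT) (f : ghom M N) F x :
  ind_fun (ind_hom f F) x = f (ind_fun F x).
Proof. by []. Qed.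

Definition lrep (x : G) : G := xget 1%g [set y | (y^-1 * x)%g \in H].

Lemma lrepP x : ((lrep x)^-1 * x)%g \in H.
Proof.
by rewrite /lrep; case: xgetP => //= /(_ x); rewrite /= mulVg gpred1.
Qed.

Lemma lrepM (h : HT) x : lrep (x * val h)%g = lrep x.
Proof.
rewrite /lrep; congr (xget _ _); apply/seteqP; split=> y /= yP.
  have hV : ((val h)^-1)%g \in H by rewrite gpredV (valP h).
  by have := gpredM _ _ yP hV; rewrite -!mulgA mulgV mulg1.
by rewrite mulgA; apply: gpredM => //; exact: valP.
Qed.

(** Exactness of induction, in a form that also applies when [f] is not onto: preimages are chosen
    at representatives of the left cosets and spread by equivariance. *)
Lemma ind_lift (M N : gmodule HT) (f : ghom M N) (F : ind N) :
  (forall x, exists m, f m = ind_fun F x) -> exists F', ind_hom f F' = F.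
Proof.
(* The choice of preimages sends 0 to 0, so that the lift lives on the finitely many cosets that
   support [F]. *)
move=> Ff; pose s (n : N) : M := if n == 0 then 0 else xget 0 [set m | f m = n].
have sP x : f (s (ind_fun F x)) = ind_fun F x.
  rewrite /s; case: eqP => [->|_]; first exact: raddf0.
  by case: xgetP => [m -> //|]; have [m mP] := Ff x => /(_ m).
pose c (x : G) : HT := exist (fun y => y \in H) _ (lrepP x).
have xc x : x = (lrep x * val (c x))%g by rewrite /= mulgA mulgV mul1g.
pose F1 (x : G) : M := gact (c x)^-1%g (s (ind_fun F (lrep x))).
have F1P : ind_pred F1.
  split=> [h x|].
    rewrite /F1 lrepM -gactM; congr (gact _ _).
    by apply: val_inj; rewrite /= lrepM -invgM -mulgA.
  have [_ [r rF]] := ind_funP F; exists r => x; rewrite /F1 => Fx; apply: rF.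
  apply: contra Fx => /eqP Fx; have := ind_funM F (c x) (lrep x); rewrite -xc Fx.
  move=> /(congr1 (gact (c x))); rewrite -gactM mulgV gact1 raddf0 => <-.
  by rewrite /s eqxx raddf0.
exists (mk_ind F1P); apply: ind_ext => x; rewrite ind_homE /ind_fun /= /F1 ghomJ sP.
by rewrite -ind_funM -xc.
Qed.

Lemma lcoset_setP x y : (lcoset_set H x = lcoset_set H y) <-> (x^-1 * y)%g \in H.
Proof.
split=> [/seteqP[_ /(_ y)]|xyH].
  by apply; rewrite /lcoset_set /= /in_coset mulVg gpred1.
have yxH : (y^-1 * x)%g \in H by rewrite -[X in X \in _]invgK gpredV invgM invgK.
rewrite /lcoset_set; apply/seteqP; split=> z /= zH; rewrite /in_coset in zH *.
  by have := gpredM _ _ yxH zH; rewrite -!mulgA mulVKg.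
by have := gpredM _ _ xyH zH; rewrite -!mulgA mulVKg.
Qed.

Section IndProjective.
Variables (P : gmodule HT) (N : gmodule G) (psi : ghom P (res H N)).

(* The summand of the coset [A] in the extension of [psi] to the induced
   module; it does not depend on the chosen element of [A]. *)
Definition ind_term (F : ind P) (A : set G) : N :=
  let a := xget 1%g A in
  if `[< A = lcoset_set H a >] then gact a (psi (ind_fun F a)) else 0.

Lemma ind_termE F x : ind_term F (lcoset_set H x) = gact x (psi (ind_fun F x)).
Proof.
rewrite /ind_term; case: xgetP => [a aE|/(_ x)]; last first.
  by rewrite /lcoset_set /= /in_coset mulVg gpred1.
rewrite /lcoset_set /= /in_coset => xaH.
rewrite asboolT; last exact/lcoset_setP.
pose h : HT := exist (fun y => y \in H) _ xaH.
have -> : a = (x * val h)%g by rewrite /= mulgA mulgV mul1g.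
rewrite ind_funM ghomJ [gact h^-1%g _]/= -gactM; congr (gact _ _).
by rewrite -mulgA /= mulgV mulg1.
Qed.

Lemma ind_term0 F A : (forall x, A <> lcoset_set H x) -> ind_term F A = 0.
Proof. by move=> An; rewrite /ind_term asboolF. Qed.

Lemma ind_term_fsupp F : fsupp (ind_term F).
Proof.
have [_ [s sF]] := ind_funP F; exists [seq lcoset_set H x | x <- s] => A.
case: (pselect (exists x, A = lcoset_set H x)) => [[x ->]|An]; last first.
  by rewrite ind_term0 ?eqxx // => x Ax; apply: An; exists x.
rewrite ind_termE => Fx; have /sF/hasP[y ys yx] : ind_fun F x != 0.
  by apply: contra Fx => /eqP->; rewrite !raddf0.
by apply/mapP; exists y => //; apply/esym/lcoset_setP.
Qed.

(** The map adjoint to [psi]: it sends the tensor of [x] and [p] to [gact x (psi p)]. *)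
Definition ind_ext_fun (F : ind P) : N := fsum (ind_term F).

Lemma ind_ext_funB F F' : ind_ext_fun (F - F') = ind_ext_fun F - ind_ext_fun F'.
Proof.
rewrite /ind_ext_fun -fsumB; try exact: ind_term_fsupp.
apply: eq_fsum => A; rewrite /ind_term; case: ifP => _; last by rewrite subr0.
by rewrite ind_funB !raddfB.
Qed.

Definition ltrans (g : G) (A : set G) : set G := [set x | A (g^-1 * x)%g].

Lemma ltransK g : cancel (ltrans g) (ltrans g^-1%g).
Proof. by move=> A; apply/funext => x; rewrite /ltrans /= invgK mulKg. Qed.

Lemma ltransVK g : cancel (ltrans g^-1%g) (ltrans g).
Proof. by move=> A; apply/funext => x; rewrite /ltrans /= invgK mulVKg. Qed.

Lemma ltrans_lcoset g x : ltrans g (lcoset_set H x) = lcoset_set H (g * x)%g.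
Proof.
by apply/funext => y; rewrite /ltrans /lcoset_set /= /in_coset invgM mulgA.
Qed.

Lemma ind_ext_funJ g F : ind_ext_fun (gact g F) = gact g (ind_ext_fun F).
Proof.
rewrite /ind_ext_fun raddf_fsum; last exact: ind_term_fsupp.
rewrite -(fsum_bij _ (ltransK g) (ltransVK g)); apply: eq_fsum => A /=.
case: (pselect (exists x, A = lcoset_set H x)) => [[x ->]|An].
  by rewrite ltrans_lcoset !ind_termE ind_funJ mulKg gactM.
rewrite !ind_term0 ?raddf0 // => x Ax; apply: An; first by exists x.
by exists (g^-1 * x)%g; rewrite -ltrans_lcoset -Ax ltransK.
Qed.

End IndProjective.

Lemma ind_delta_pred (P : gmodule HT) (p : P) :
  ind_pred (fun x => if insub x is Some h then gact (h : HT)^-1%g p else 0).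
Proof.
split=> [h x|]; last first.
  exists [:: 1%g] => x; case: insubP => [h xH _ _|]; last by rewrite eqxx.
  by rewrite /= invg1 mul1g xH.
case: (insubP HT x) => [k xH xk|xH].
  rewrite insubT -?xk; first exact: gpredM (valP k) (valP h).
  move=> khH; rewrite -gactM -invgM; congr (gact _^-1%g _).
  exact: val_inj.
rewrite insubF ?raddf0 //; apply: contraNF xH => xhH.
have hV : ((val h)^-1)%g \in H by rewrite gpredV (valP h).
by have := gpredM _ _ xhH hV; rewrite -mulgA mulgV mulg1.
Qed.

(** The tensor of [1] and [p]: the unit of the adjunction between induction and restriction. *)
Definition ind_delta (P : gmodule HT) (p : P) : ind P := mk_ind (ind_delta_pred p).

Lemma ind_deltaE (P : gmodule HT) (p : P) (h : HT) :
  ind_fun (ind_delta p) (val h) = gact h^-1%g p.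
Proof. by rewrite /ind_fun /= valK. Qed.

Lemma ind_delta_out (P : gmodule HT) (p : P) x : x \notin H ->
  ind_fun (ind_delta p) x = 0.
Proof. by move=> xH; rewrite /ind_fun /= insubF //; apply/negbTE. Qed.

(** A map out of [ind P] is determined by its composite [psi] with the unit, so a lift of [psi]
    extends by adjunction to a lift of [f]. *)
Lemma projective_ind (P : gmodule HT) : projective P -> projective (ind P).
Proof.
move=> pP M N e f e_onto.
have dB (p q : P) : f (ind_delta (p - q)) = f (ind_delta p) - f (ind_delta q).
  rewrite -raddfB; congr (f _); apply: ind_ext => x; rewrite ind_funB.
  case: (boolP (x \in H)) => [xH|xH]; last by rewrite !ind_delta_out ?subr0.
  by rewrite -[x]/(val (exist (fun y => y \in H) x xH : HT)) !ind_deltaE raddfB.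
have dJ (h : HT) (p : P) : f (ind_delta (gact h p)) = gact (val h) (f (ind_delta p)).
  rewrite -ghomJ; congr (f _); apply: ind_ext => x; rewrite ind_funJ.
  case: (boolP (x \in H)) => [xH|xH].
    pose k : HT := exist (fun y => y \in H) x xH.
    rewrite -[x]/(val k) -[((val h)^-1 * val k)%g]/(val (h^-1 * k)%g) !ind_deltaE.
    by rewrite -gactM invgM invgK.
  rewrite !ind_delta_out //; apply: contra xH => hxH.
  by have := gpredM _ _ (valP h) hxH; rewrite mulgA mulgV mul1g.
pose psi : ghom P (res H N) := @ghom_of HT P (res H N) _ dB dJ.
have psiE p : psi p = f (ind_delta p) by [].
have [psi' psi'E] := pP (res H M) (res H N) (res_hom H e) psi e_onto.
exists (@ghom_of G (ind P) M _ (ind_ext_funB psi') (ind_ext_funJ psi')) => F /=.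
rewrite raddf_fsum; last exact: ind_term_fsupp.
transitivity (fsum (ind_term psi F)).
  apply: eq_fsum => A /=.
  case: (pselect (exists x, A = lcoset_set H x)) => [[x ->]|An].
    by rewrite !ind_termE ghomJ -psi'E.
  by rewrite !ind_term0 ?raddf0 // => x Ax; apply: An; exists x.
(* [t A] is the part of [F] on the coset [A]. These parts add up to [F]: at a point [x], only the
   coset of [x] contributes. *)
pose t (A : set G) : ind P := let a := xget 1%g A in
  if `[< A = lcoset_set H a >] then gact a (ind_delta (ind_fun F a)) else 0.
have tE A : ind_term psi F A = f (t A).
  rewrite /ind_term /t; case: ifP => _; last by rewrite raddf0.
  by rewrite psiE ghomJ.
have t_supp : fsupp t.
  have [_ [s sF]] := ind_funP F; exists [seq lcoset_set H x | x <- s] => A.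
  rewrite /t; case: ifP => [/asboolP AE tn|_]; last by rewrite eqxx.
  have /sF/hasP[y ys yx] : ind_fun F (xget 1%g A) != 0.
    apply: contra tn => /eqP->; apply/eqP; apply: ind_ext => x; rewrite ind_funJ.
    case: (boolP ((xget 1%g A)^-1 * x \in H)%g) => [xH|xH]; last by rewrite ind_delta_out.
    rewrite -[(_^-1 * x)%g]/(val (exist (fun y => y \in H) _ xH : HT)) ind_deltaE.
    by rewrite raddf0.
  by apply/mapP; exists y => //; rewrite AE; apply/esym/lcoset_setP.
rewrite (funext tE) -[RHS](_ : f (fsum t) = _); first by rewrite raddf_fsum.
congr (f _); apply: ind_ext => x; rewrite /ind_fun raddf_fsum //.
pose ev : {additive (G -> P) -> P} := @additive_of (G -> P) P (fun F => F x) (fun _ _ => erefl).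
rewrite -[LHS]/(ev _) raddf_fsum; last first.
  case: t_supp => s ts; exists s => A /= tn; apply: ts.
  by apply: contra tn => /eqP->.
rewrite (@fsum1 _ _ _ (lcoset_set H x)) /=.
  rewrite /t; case: xgetP => [a aE|/(_ x)]; last first.
    by rewrite /lcoset_set /= /in_coset mulVg gpred1.
  rewrite /lcoset_set /= /in_coset => xaH.
  rewrite asboolT; last exact/lcoset_setP.
  have axH : (a^-1 * x)%g \in H by rewrite -[X in X \in _]invgK gpredV invgM invgK.
  rewrite -[LHS]/(ind_fun (ind_delta (ind_fun F a)) (a^-1 * x)%g).
  rewrite -[(a^-1 * x)%g]/(val (exist (fun y => y \in H) _ axH : HT)) ind_deltaE.
  by rewrite -ind_funM /= mulgA mulgV mul1g.
move=> A Ax; rewrite /t; case: asboolP => [AE|//].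
rewrite -[LHS]/(ind_fun (ind_delta _) ((xget 1%g A)^-1 * x)%g) ind_delta_out //.
by apply: contra Ax => AxH; rewrite AE; apply/eqP/lcoset_setP.
Qed.

End Induction.

(** * Replacing a summand in degree 0 by its resolution *)

Section MappingCone.
Variables (G : groupType) (n : nat).
Variables (B J : nat -> gmodule G) (I : gmodule G).
Local Notation Z := (trivial_gmodule G).
Variables (bd : forall i, ghom (B i.+1) (B i)) (theta : ghom (B 1%N) I).
Variables (alpha : ghom (B 0%N) Z) (beta : ghom I Z).
Variables (dJ : forall i, ghom (J i.+1) (J i)) (pi : ghom (J 0%N) I).
Hypotheses (B_proj : forall i, projective (B i)) (J_proj : forall i, projective (J i)).
Hypotheses (B_bound : forall i, (n < i)%N -> forall x : B i, x = 0)
  (J_bound : forall i, (n < i)%N -> forall x : J i, x = 0).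
Hypotheses (aug_onto : forall z, exists b x, alpha b + beta x = z)
  (aug_bd : forall c, alpha (bd 0%N c) + beta (theta c) = 0)
  (theta_bd : forall c, theta (bd 1%N c) = 0)
  (bd_bd : forall i c, bd i (bd i.+1 c) = 0).
Hypotheses
  (exact0 : forall b x, alpha b + beta x = 0 ->
     exists c, bd 0%N c = b /\ theta c = x)
  (exact1 : forall c, bd 0%N c = 0 -> theta c = 0 -> exists c', bd 1%N c' = c)
  (exact2 : forall i c, bd i.+1 c = 0 -> exists c', bd i.+2 c' = c).
Hypotheses (pi_onto : forall x, exists q, pi q = x)
  (exactJ0 : forall q, pi q = 0 <-> exists q', dJ 0%N q' = q)
  (exactJ : forall i q, dJ i q = 0 <-> exists q', dJ i.+1 q' = q).

(** Cycles of the resolution [J] of [I], where [pi] serves as the differential out of degree 0. *)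
Definition next_cycle (i : nat) : J i -> Prop :=
  match i with 0%N => fun q => pi q = 0 | j.+1 => fun q => dJ j q = 0 end.

Lemma next_cycleP i (q : J i) : next_cycle q <-> exists q', dJ i q' = q.
Proof. by case: i q => [|i] q; [exact: exactJ0 | exact: exactJ]. Qed.

Definition liftable i (phi : ghom (B i.+1) (J i)) : Prop :=
  forall c, next_cycle (phi (bd i.+1 c)).

Lemma lift_exists i (phi : ghom (B i.+1) (J i)) : liftable phi ->
  exists psi : ghom (B i.+2) (J i.+1),
    (forall c, dJ i (psi c) = phi (bd i.+1 c)) /\ liftable psi.
Proof.
move=> phiP.
have [c|psi psiE] := projective_lift (e := dJ i) (f := ghom_comp phi (bd i.+1)) (@B_proj i.+2).
  exact/next_cycleP/phiP.
by exists psi; split=> // c; rewrite /= psiE /= bd_bd raddf0.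
Qed.

Lemma lift0_exists : exists phi : ghom (B 1%N) (J 0%N),
  (forall c, pi (phi c) = theta c) /\ liftable phi.
Proof.
have [//|phi phiE] := projective_lift (e := pi) (f := theta) (@B_proj 1%N).
by exists phi; split=> // c; rewrite /= phiE theta_bd.
Qed.

(** A chain map to [J] from the positive degrees of [B], shifted down by one, that lifts [theta].
    The recursion carries [liftable] along as the condition for the next lift to exist. *)
Fixpoint lift_seq (i : nat) : {phi : ghom (B i.+1) (J i) | liftable phi} :=
  match i with
  | 0%N => let: exist phi phiP := cid lift0_exists in exist _ phi phiP.2
  | j.+1 => let: exist phi phiP := lift_seq j in
            let: exist psi psiP := cid (lift_exists phiP) in exist _ psi psiP.2
  end.

Definition cone_lift i := sval (lift_seq i).

Lemma cone_lift0 c : pi (cone_lift 0 c) = theta c.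
Proof. by rewrite /cone_lift /=; case: cid => phi [phiE phiP] /=. Qed.

Lemma cone_liftS i c : dJ i (cone_lift i.+1 c) = cone_lift i (bd i.+1 c).
Proof.
rewrite /cone_lift /=; case: (lift_seq i) => phi phiP /=.
by case: cid => psi [psiE psiP].
Qed.

Local Notation R i := (summod (B i) (J i)).

(** The minus sign makes the two mixed terms of the square of the differential cancel, by
    [cone_liftS]. *)
Definition cone_d_fun i (x : R i.+1) : R i :=
  (bd i x.1, cone_lift i x.1 - dJ i x.2).

Fact cone_dB i x y : @cone_d_fun i (x - y) = cone_d_fun x - cone_d_fun y.
Proof. rewrite /cone_d_fun !raddfB /=; congr (_, _) => //=; by rewrite [in RHS]opprD addrACA. Qed.

Fact cone_dJ i g x : @cone_d_fun i (gact g x) = gact g (cone_d_fun x).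
Proof. by rewrite /cone_d_fun /= /sum_act /= raddfB !ghomJ. Qed.

Definition cone_d i : ghom (R i.+1) (R i) := ghom_of (@cone_dB i) (@cone_dJ i).

Definition cone_eps_fun (x : R 0%N) : Z := alpha x.1 + beta (pi x.2).

Fact cone_epsB x y : cone_eps_fun (x - y) = cone_eps_fun x - cone_eps_fun y.
Proof. by rewrite /cone_eps_fun !raddfB /= opprD addrACA. Qed.

Fact cone_epsJ g x : cone_eps_fun (gact g x) = gact g (cone_eps_fun x).
Proof. by rewrite /cone_eps_fun /= !ghomJ. Qed.

Lemma dJ_dJ i q : dJ i (dJ i.+1 q) = 0.
Proof. by apply/exactJ; exists q. Qed.

Lemma pi_dJ q : pi (dJ 0%N q) = 0.
Proof. by apply/exactJ0; exists q. Qed.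

Lemma cd_le_cone : cd_le G n.
Proof.
exists (fun i => R i), cone_d, (ghom_of cone_epsB cone_epsJ); split.
- by move=> i; apply: projective_summod.
- by move=> i ni [b q]; congr (_, _); [apply: B_bound | apply: J_bound].
- move=> z; have [b [x <-]] := aug_onto z; have [q <-] := pi_onto x.
  by exists (b, q).
- move=> [b q]; split=> [/exact0[c [cb cq]]|[[c q'] [<- <-]]].
    have : pi (cone_lift 0 c - q) = 0 by rewrite raddfB cone_lift0 cq subrr.
    move=> /exactJ0[q' q'E]; exists (c, q').
    by rewrite /= /cone_d_fun /= q'E cb subKr.
  by rewrite /= /cone_eps_fun /= raddfB cone_lift0 pi_dJ subr0 aug_bd.
- move=> i [c q]; split=> [[cb cq]|[[c' q'] [<- <-]]]; last first.
    rewrite /= /cone_d_fun /= bd_bd raddfB cone_liftS dJ_dJ subr0 subrr.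
    by [].
  have [c' c'E] : exists c', bd i.+1 c' = c.
    case: i c q cb cq => [|i] c q cb cq; last exact: exact2.
    (* [theta c] vanishes because [pi] kills the image of [dJ] in the second component of the
       cycle. *)
    apply: exact1 => //; rewrite -cone_lift0.
    by move/(congr1 pi)/eqP: cq; rewrite raddfB pi_dJ subr0 raddf0 => /eqP.
  have : dJ i (cone_lift i.+1 c' - q) = 0.
    by rewrite raddfB cone_liftS c'E.
  move=> /exactJ[q' q'E]; exists (c', q').
  by rewrite /= /cone_d_fun /= q'E c'E subKr.
Qed.

End MappingCone.

(** * Alternating chains *)

Section AlternatingChains.
Variable W : choiceType.
Implicit Types (f a z : seq W -> int) (s t : seq W) (w x y : W).

Definition alternating f : Prop :=
  forall s1 x y s2, f (s1 ++ x :: y :: s2) = - f (s1 ++ y :: x :: s2).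

Definition contract x f : seq W -> int := fun s => f (x :: s).

(** A chain is encoded by its coefficients on ordered simplices. As these alternate, the usual signs
    are absorbed by putting the removed vertex in front. *)
Definition bd f : seq W -> int := fun s => fsum (fun v => f (v :: s)).

(** The exterior product of the vertex [w] with [f], expanded along the first vertex of the
    argument. *)
Fixpoint wedge w f s : int :=
  if s is x :: s' then (if x == w then f s' else 0) - wedge w (contract x f) s'
  else 0.

Lemma alternating_contract x f : alternating f -> alternating (contract x f).
Proof. by move=> fA s1 u v s2; exact: (fA (x :: s1)). Qed.

Lemma alternating_front f s1 x s2 : alternating f ->
  f (s1 ++ x :: s2) = (-1) ^+ size s1 * f (x :: s1 ++ s2).
Proof.
elim: s1 f => [|y s1 IH] f fA /=; first by rewrite mul1r.
rewrite -[f _]/(contract y f _) IH; last exact: alternating_contract.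
by rewrite /contract (fA [::]) exprS mulN1r mulrN mulNr.
Qed.

Lemma alternating_dup f x s : alternating f -> f (x :: x :: s) = 0.
Proof. by move=> fA; have := fA [::] x x s => /= h; lia. Qed.

Lemma alternating_uniq f s : alternating f -> f s != 0 -> uniq s.
Proof.
elim: s f => [//|x s IH] f fA fs; rewrite cons_uniq.
rewrite (IH (contract x f)) //; last exact: alternating_contract.
rewrite andbT; apply: contra fs => /splitPr[s1 s2].
rewrite -[f _]/(contract x f _) alternating_front; last exact: alternating_contract.
by rewrite /contract alternating_dup // mulr0.
Qed.

Lemma wedgeB w f f' s :
  wedge w (fun t => f t - f' t) s = wedge w f s - wedge w f' s.
Proof.
elim: s f f' => [|x s IH] f f' /=; first by rewrite subr0.
by rewrite IH; case: ifP => _; ring.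
Qed.

Lemma wedge0 w s : wedge w (fun=> 0) s = 0.
Proof. by elim: s => [//|x s IH] /=; rewrite IH if_same subr0. Qed.

Lemma eq_wedge w f f' : f =1 f' -> wedge w f =1 wedge w f'.
Proof. by move=> /funext->. Qed.

Lemma wedge_sum w (X : seq W) (F : W -> seq W -> int) s :
  wedge w (fun t => \sum_(x <- X) F x t) s = \sum_(x <- X) wedge w (F x) s.
Proof.
elim: s F => [|y s IH] F /=; first by rewrite big1_seq.
rewrite sumrB IH; congr (_ - _); case: ifP => // _.
by rewrite big1_seq.
Qed.

Lemma wedge_supp w f s : wedge w f s != 0 -> exists2 t, perm_eq s (w :: t) & f t != 0.
Proof.
elim: s f => [//|x s IH] f /=; case: (eqVneq x w) => [->|xw].
  case: (eqVneq (f s) 0) => [->|fs _]; last by exists s.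
  rewrite sub0r oppr_eq0 => /IH[t st ft]; exists (w :: t) => //.
  by rewrite perm_cons.
rewrite sub0r oppr_eq0 => /IH[t st ft]; exists (x :: t) => //.
rewrite -[x :: s]/([:: x] ++ s) -[[:: w, x & t]]/([:: w] ++ [:: x] ++ t).
by rewrite perm_sym perm_catCA perm_cat2l perm_sym.
Qed.

Lemma wedgeN w f s : wedge w (fun t => - f t) s = - wedge w f s.
Proof.
transitivity (wedge w (fun t => 0 - f t) s); last by rewrite wedgeB wedge0 sub0r.
by apply: eq_wedge => t; rewrite sub0r.
Qed.

Lemma alternating_wedge w f : alternating f -> alternating (wedge w f).
Proof.
move=> fA s1; elim: s1 f fA => [|u s1 IH] f fA x y s2.
  rewrite /= (@eq_wedge w (contract x (contract y f))
    (fun t => - contract y (contract x f) t)); last by move=> t; exact: (fA [::]).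
  by rewrite wedgeN /contract; ring.
rewrite /= (IH (contract u f)); last exact: alternating_contract.
by case: ifP => _; [rewrite (fA s1)|]; ring.
Qed.

(** [bd] is the antiderivation of the exterior algebra that takes the value 1 at each vertex; [X]
    makes the sums finite. *)
Lemma bd_wedge (X : seq W) w f s : uniq X -> w \in X ->
  (forall t x, f t != 0 -> x \in t -> x \in X) ->
  bd (wedge w f) s = f s - wedge w (bd f) s.
Proof.
move=> uX wX fX; rewrite /bd (fsumE uX); last first.
  move=> x /wedge_supp[t st ft]; have := mem_head x s.
  by rewrite (perm_mem st) inE => /predU1P[->//|]; exact: fX.
rewrite (@eq_wedge w (bd f) (fun t => \sum_(x <- X) contract x f t)); last first.
  by move=> t; apply: fsumE => // x /fX; apply; exact: mem_head.
rewrite wedge_sum /= sumrB; congr (_ - _).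
rewrite (bigD1_seq w) //= eqxx big1 ?addr0 // => x /negbTE->.
by [].
Qed.

Definition vsupp f : Prop := exists X : seq W, forall t x, f t != 0 -> x \in t -> x \in X.

Lemma fsupp_vsupp f : fsupp f -> vsupp f.
Proof.
by move=> [r rf]; exists (flatten r) => t x /rf tr xt; apply/flattenP; exists t.
Qed.

Lemma bdE (X : seq W) f s : uniq X -> (forall t x, f t != 0 -> x \in t -> x \in X) ->
  bd f s = \sum_(x <- X) f (x :: s).
Proof. by move=> uX fX; apply: fsumE => // x /fX; apply; exact: mem_head. Qed.

Lemma bd_neq0 f s : vsupp f -> bd f s != 0 -> exists x, f (x :: s) != 0.
Proof.
move=> [X fX]; rewrite (@bdE (undup X)) ?undup_uniq //; last first.
  by move=> t x /fX/[apply]; rewrite mem_undup.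
move=> nz; apply: contrapT => h; move: nz; rewrite big1 // => x _.
by apply: contrapT => /eqP fx; apply: h; exists x.
Qed.

Lemma bd_bd f s : alternating f -> vsupp f -> bd (bd f) s = 0.
Proof.
move=> fA [X fX0]; pose Y := undup X.
have uY : uniq Y by apply: undup_uniq.
have fY t x : f t != 0 -> x \in t -> x \in Y by rewrite mem_undup; exact: fX0.
have bY t x : bd f t != 0 -> x \in t -> x \in Y.
  move=> /(bd_neq0 _)[|y fy xt]; first by exists X.
  by apply: (fY _ x fy); rewrite inE xt orbT.
rewrite (bdE _ uY bY).
under eq_bigr => x _ do rewrite (bdE _ uY fY).
(* Exchanging the two sums transposes the two vertices in front of [s]. *)
set S := \sum_(x <- Y) _; suff : S = - S by lia.
rewrite {1}/S exchange_big /= /S -sumrN; apply: eq_bigr => x _.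
by rewrite -sumrN; apply: eq_bigr => y _; exact: (fA [::]).
Qed.

Section Chain.
Variable K : seq W -> Prop.

Definition chain f : Prop := [/\ fsupp f, forall s, f s != 0 -> K s & alternating f].

Lemma chain0 : chain 0.
Proof. by split=> [|s|s1 x y s2]; [exact: fsupp0 | rewrite eqxx | rewrite oppr0]. Qed.

Lemma chainB f f' : chain f -> chain f' -> chain (f - f').
Proof.
move=> [fs fK fA] [f's f'K f'A]; split; first exact: fsuppB.
  move=> s; rewrite !fctE; case: (eqVneq (f s) 0) => [->|/fK//].
  by case: (eqVneq (f' s) 0) => [->|/f'K//]; rewrite subrr eqxx.
by move=> s1 x y s2; rewrite !fctE fA f'A; ring.
Qed.

Lemma chain_vsupp f : chain f -> vsupp f.
Proof. by move=> [fs _ _]; exact: fsupp_vsupp. Qed.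

Lemma chain_fsupp_cons f s : chain f -> fsupp (fun v => f (v :: s)).
Proof.
move=> [[r rf] _ _]; exists (flatten r) => v /rf vr.
by apply/flattenP; exists (v :: s) => //; exact: mem_head.
Qed.

End Chain.

Lemma bdB (K K' : seq W -> Prop) f f' : chain K f -> chain K' f' ->
  bd (f - f') = bd f - bd f'.
Proof.
by move=> fK f'K; apply/funext => s; rewrite !fctE /bd -fsumB //;
  [exact: chain_fsupp_cons fK | exact: chain_fsupp_cons f'K].
Qed.

Lemma chain_bd (K K' : seq W -> Prop) f : (forall x s, K (x :: s) -> K' s) ->
  chain K f -> chain K' (bd f).
Proof.
move=> KK' fK; have fv := chain_vsupp fK; case: fK => -[r rf] fK fA; split.
- exists (map behead r) => s /(bd_neq0 fv)[x fx].
  by apply/mapP; exists (x :: s) => //; exact: rf.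
- by move=> s /(bd_neq0 fv)[x /fK]; exact: KK'.
- move=> s1 x y s2; case: fv => X fX.
  have uX := undup_uniq X.
  have fY t v : f t != 0 -> v \in t -> v \in undup X by rewrite mem_undup; exact: fX.
  by rewrite !(bdE _ uX fY) -sumrN; apply: eq_bigr => v _; exact: (fA (v :: s1)).
Qed.

Lemma chain_wedge (K K' : seq W -> Prop) w f :
  (forall s t, perm_eq s t -> K' t -> K' s) ->
  (forall t, f t != 0 -> K' (w :: t)) -> chain K f -> chain K' (wedge w f).
Proof.
move=> K'p K'w [[r rf] fK fA]; split; last exact: alternating_wedge.
  exists (flatten [seq permutations (w :: t) | t <- r]) => s /wedge_supp[t st ft].
  apply/flattenP; exists (permutations (w :: t)); last by rewrite mem_permutations.
  by apply/mapP; exists t => //; exact: rf.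
by move=> s /wedge_supp[t st ft]; apply: K'p st (K'w _ ft).
Qed.

End AlternatingChains.

(** * Acyclicity of clique complexes that can be dismantled *)

Section Acyclic.
Variables (W : choiceType) (adj : W -> W -> Prop) (wt : W -> nat).
Hypothesis adjC : forall x y, adj x y -> adj y x.

Definition clique (k : nat) (s : seq W) : Prop :=
  size s = k /\ forall x y, x \in s -> y \in s -> adj x y.

Hypothesis dismantle : forall F : seq W, (forall x, x \in F -> adj x x) ->
  (exists2 o, adj o o & forall x, x \in F -> adj x o) \/
  (exists w w', [/\ w \in F, (wt w' < wt w)%N, adj w' w' &
     forall y, y \in F -> adj y w -> adj y w']).

Lemma clique_perm k s t : perm_eq s t -> clique k t -> clique k s.
Proof.
move=> st [tk tc]; split; first by rewrite (perm_size st).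
by move=> x y; rewrite !(perm_mem st); exact: tc.
Qed.

Lemma clique_behead k x s : clique k.+1 (x :: s) -> clique k s.
Proof.
move=> [[sk] sc]; split=> // y z ys zs.
by apply: sc; rewrite inE ?ys ?zs orbT.
Qed.

Lemma clique_cons k x s : clique k s -> adj x x -> (forall y, y \in s -> adj y x) ->
  clique k.+1 (x :: s).
Proof.
move=> [sk sc] xx sx; split=> [|y z]; first by rewrite /= sk.
rewrite !inE => /predU1P[->|ys] /predU1P[->|zs] //; [exact/adjC/sx|exact: sx|exact: sc].
Qed.

(** Induction on the total weight of [F]. A vertex adjacent to all of [F] gives a cone over [z];
    otherwise [z] is homologous to a cycle in which [w'] has taken the place of [w]. *)
Lemma acyclic_on k (F : seq W) (z : seq W -> int) : (forall x, x \in F -> adj x x) ->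
  chain (clique k) z -> (forall s x, z s != 0 -> x \in s -> x \in F) -> bd z =1 0 ->
  exists2 h, chain (clique k.+1) h & bd h = z.
Proof.
have [n] := ubnP (\sum_(x <- F) wt x); elim: n F z => // n IH F z Fn Fv zK zF z0.
have uX o := undup_uniq (o :: F).
have [[o oo Fo]|[w [w' [wF ww' w'w' Fw]]]] := dismantle Fv.
  exists (wedge o z).
    apply: (chain_wedge _ _ zK); first exact: clique_perm.
    move=> t zt; apply: clique_cons => //; first by case: zK => _ /(_ t zt).
    by move=> y /(zF _ _ zt); exact: Fo.
  apply/funext => s; rewrite (bd_wedge _ (uX o)) ?mem_undup ?mem_head //.
    by rewrite (eq_wedge _ z0) wedge0 subr0.
  by move=> t x zt xt; rewrite mem_undup inE (zF t) ?orbT.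
case: k zK IH => [|k] zK IH.
  (* The degree of the augmentation: the only simplex is empty and any vertex cones it off. The
     empty family provides one. *)
  case: (dismantle (F := [::])) => // [[o oo _]|[? [? []]]//].
  have z0' s : z s != 0 -> s = [::] by case: zK => _ zK _ /zK[/size0nil].
  exists (wedge o z).
    apply: (chain_wedge _ _ zK); first exact: clique_perm.
    move=> t zt; apply: clique_cons => //; first by case: zK => _ /(_ t zt).
    by rewrite (z0' _ zt).
  apply/funext => s; rewrite (bd_wedge _ (uX o)) ?mem_undup ?mem_head //.
    by rewrite (eq_wedge _ z0) wedge0 subr0.
  by move=> t x zt xt; rewrite mem_undup inE (zF t) ?orbT.
(* [z] is [wedge w a] plus a chain without [w]. As [a] is a cycle, [wedge w' (wedge w a)] has
   boundary [wedge w a - wedge w' a]; subtracting it from [z] puts [w'] in place of [w]. *)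
pose a := contract w z.
have aK : chain (clique k) a.
  case: zK => -[r rz] zK zA; split; last exact: alternating_contract.
    by exists (map behead r) => s zs; apply/mapP; exists (w :: s) => //; exact: rz.
  by move=> s /zK/clique_behead.
have aF t x : a t != 0 -> x \in t -> x \in F.
  by move=> /zF h xt; apply: h; rewrite inE xt orbT.
have Fww x : x \in F -> x \in undup [:: w' & F] by rewrite mem_undup inE => ->; rewrite orbT.
have w'ww : w' \in undup [:: w' & F] by rewrite mem_undup mem_head.
have a0 : bd a =1 (fun=> 0).
  move=> s; have [X zX] := chain_vsupp zK; have uXX := undup_uniq X.
  have zY t x : z t != 0 -> x \in t -> x \in undup X by rewrite mem_undup; exact: zX.
  rewrite (bdE _ uXX); last by move=> t x /zY h xt; apply: h; rewrite inE xt orbT.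
  have := z0 (w :: s); rewrite (bdE _ uXX zY) => /eqP; rewrite -oppr_eq0 -sumrN => /eqP z0'.
  rewrite -[RHS]z0'; apply: eq_bigr => x _; case: zK => _ _ zA; exact: (zA [::]).
have az t : a t != 0 -> clique k.+1 (w :: t) by case: zK => _ zK _ /zK.
have waK : chain (clique k.+1) (wedge w a).
  by apply: (chain_wedge _ _ aK) => //; exact: clique_perm.
(* Cliques are reflexive, so domination applies to [w] itself: [w'] is adjacent to [w] as well. *)
have wa_w' s : wedge w a s != 0 -> clique k.+2 (w' :: s).
  move=> wa; case: waK => _ /(_ s wa) sK _; apply: clique_cons => // y ys.
  have /wedge_supp[t st at0] := wa; move: ys; rewrite (perm_mem st) => ys.
  apply: Fw; first exact: (zF _ _ at0).
  by have [_] := az t at0; apply; rewrite ?mem_head.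
have w'waK : chain (clique k.+2) (wedge w' (wedge w a)).
  by apply: (chain_wedge _ _ waK) => //; exact: clique_perm.
have wa_bd s : bd (wedge w a) s = a s.
  rewrite (bd_wedge _ (uX w') (Fww _ wF)) //; last by move=> t x at0 /(aF _ _ at0)/Fww.
  by rewrite (eq_wedge _ a0) wedge0 subr0.
have w'wa_bd s : bd (wedge w' (wedge w a)) s = wedge w a s - wedge w' a s.
  rewrite (bd_wedge _ (uX w') w'ww); first by rewrite (eq_wedge _ wa_bd).
  move=> t x /wedge_supp[u tu au]; rewrite (perm_mem tu) inE => /predU1P[->|].
    exact: (Fww _ wF).
  by move=> /(aF _ _ au)/Fww.
pose z' := z - bd (wedge w' (wedge w a)).
have z'E s : z' s = z s - (wedge w a s - wedge w' a s) by rewrite /z' !fctE w'wa_bd.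
have z'K : chain (clique k.+1) z'.
  apply: chainB => //; apply: (chain_bd _ w'waK) => x s; exact: clique_behead.
have ww'n : w != w' by apply: contraTneq ww' => ->; rewrite ltnn.
have z'w s : w \in s -> z' s = 0.
  move=> /splitPr[s1 s2]; have z'A : alternating z' by case: z'K.
  rewrite alternating_front // z'E /= eqxx (negbTE ww'n) sub0r.
  have aw t : contract w a t = 0 by apply: alternating_dup; case: zK.
  by rewrite !(eq_wedge _ aw) !wedge0 /a /contract; ring.
pose tau x := if x == w then w' else x.
have [|||||h hK hE] := IH (map tau F) z'.
- rewrite big_map -ltnS; apply: leq_trans Fn; rewrite ltnS.
  rewrite (big_rem w) //= [X in (_ < X)%N](big_rem w) //= /tau eqxx -addSn leq_add //.
  by apply: leq_sum => x _; case: eqP => // ->; exact: ltnW.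
- by move=> _ /mapP[x xF ->]; rewrite /tau; case: ifP => // _; exact: Fv.
- exact: z'K.
- move=> s x z's xs; have ws : w \notin s by apply: contra z's => /z'w->.
  have : x \in F \/ x = w'.
    move: z's; rewrite z'E.
    have -> : wedge w a s = 0.
      apply: contraNeq ws => /wedge_supp[t st _].
      by rewrite (perm_mem st) mem_head.
    case: (eqVneq (z s) 0) => [->|zs _]; last by left; exact: (zF _ _ zs).
    case: (eqVneq (wedge w' a s) 0) => [->|/wedge_supp[t st at0] _]; first by rewrite !subr0 eqxx.
    by move: xs; rewrite (perm_mem st) inE => /predU1P[->|/(aF _ _ at0)]; [right|left].
  move=> [xF|->].
    by apply/mapP; exists x => //; rewrite /tau; case: eqP xs => // ->; rewrite (negbTE ws).
  by apply/mapP; exists w => //; rewrite /tau eqxx.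
- move=> s; rewrite /z' (bdB zK (chain_bd (@clique_behead k.+1) w'waK)).
  transitivity (bd z s - bd (bd (wedge w' (wedge w a))) s) => //.
  rewrite z0 bd_bd //; [by case: w'waK | exact: chain_vsupp w'waK].
exists (h - (0 - wedge w' (wedge w a))).
  by apply: chainB => //; apply: chainB => //; exact: chain0.
have c0 := chain0 (clique k.+2).
rewrite (bdB hK (chainB c0 w'waK)) (bdB c0 w'waK) hE /z'.
apply/funext => s; set b := bd (wedge _ _).
transitivity (z s - b s - (bd 0 s - b s)) => //.
by rewrite [bd 0 s]fsum0 //; ring.
Qed.

Lemma acyclic k (z : seq W -> int) : chain (clique k) z -> bd z =1 0 ->
  exists2 h, chain (clique k.+1) h & bd h = z.
Proof.
move=> zK; have [X zX] := chain_vsupp zK.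
apply: (@acyclic_on k [seq x <- X | `[< adj x x >]]) => //.
  by move=> x; rewrite mem_filter => /andP[/asboolP].
move=> s x zs xs; rewrite mem_filter (zX _ _ zs xs) andbT; apply/asboolP.
by case: zK => _ /(_ s zs)[_ sc] _; exact: sc.
Qed.

End Acyclic.

(** * Alternating chains as projective modules *)

Section ChainModule.
Variables (G : groupType) (W : choiceType) (act : G -> W -> W).
Hypotheses (act1 : forall x, act 1%g x = x)
  (actM : forall g h x, act (g * h)%g x = act g (act h x)).

Lemma actK g : cancel (act g) (act g^-1%g).
Proof. by move=> x; rewrite -actM mulVg act1. Qed.

Lemma actVK g : cancel (act g^-1%g) (act g).
Proof. by move=> x; rewrite -actM mulgV act1. Qed.

Definition seq_act (g : G) (s : seq W) : seq W := [seq act g^-1%g x | x <- s].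

Fact seq_act1 s : seq_act 1%g s = s.
Proof. by rewrite /seq_act invg1 -[RHS]map_id; apply: eq_map. Qed.

Fact seq_actM g h s : seq_act (g * h)%g s = seq_act h (seq_act g s).
Proof. by rewrite /seq_act -map_comp; apply: eq_map => x /=; rewrite invgM actM. Qed.

Local Notation chain_fun := (funmod int seq_act1 seq_actM).

Lemma bdJ g (f : seq W -> int) s : bd (fun t => f (seq_act g t)) s = bd f (seq_act g s).
Proof.
rewrite /bd /= -[RHS](fsum_bij _ (actVK g) (actK g)).
by apply: eq_fsum.
Qed.

Lemma wedgeJ g w (f : seq W -> int) s :
  wedge w f (seq_act g s) = wedge (act g w) (fun t => f (seq_act g t)) s.
Proof.
elim: s f => [//|x s IH] f /=; rewrite (can2_eq (actVK g) (actK g)).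
by rewrite IH.
Qed.

Variable K : seq W -> Prop.
Hypothesis KJ : forall g s, K s -> K [seq act g x | x <- s].

Fact chainJ g (f : chain_fun) : chain K f -> chain K (gact g f).
Proof.
move=> [[r rf] fK fA]; split.
- exists [seq [seq act g x | x <- s] | s <- r] => s fs.
  apply/mapP; exists (seq_act g s); first exact: rf.
  by rewrite -map_comp -[LHS]map_id; apply: eq_map => x /=; rewrite actVK.
- move=> s /fK/(KJ g); congr K.
  by rewrite -map_comp -[RHS]map_id; apply: eq_map => x /=; rewrite actVK.
- by move=> s1 x y s2; rewrite /= /fun_act /seq_act !map_cat /= fA.
Qed.

Definition chains : gmodule G :=
  @submod G chain_fun (chain K) (chain0 K) (@chainB W K) chainJ.

Definition mk_chain (f : seq W -> int) (fK : chain K f) : chains :=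
  @insub_mod G chain_fun (chain K) (chain0 K) (@chainB W K) f fK.

Definition chain_val (c : chains) : seq W -> int := submod_val c.

Lemma chain_valP c : chain K (chain_val c).
Proof. exact: (submod_valP c). Qed.

Lemma chain_ext c c' : chain_val c =1 chain_val c' -> c = c'.
Proof. by move=> cc'; apply: val_inj; apply/funext. Qed.

Lemma chain_valB c c' s : chain_val (c - c') s = chain_val c s - chain_val c' s.
Proof. by []. Qed.

Lemma chain_val0 s : chain_val 0 s = 0.
Proof. by []. Qed.

Lemma chain_valJ g c s : chain_val (gact g c) s = chain_val c (seq_act g s).
Proof. by []. Qed.

Definition chain_ev s : {additive chains -> int} :=
  @additive_of chains int (fun c => chain_val c s) (fun c c' => chain_valB c c' s).

Section Projective.
Hypothesis Kp : forall s t, perm_eq s t -> K t -> K s.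
Hypothesis K_free : forall g s, K s -> uniq s ->
  perm_eq [seq act g x | x <- s] s -> g = 1%g.

(** The oriented simplex [t], as the exterior product of its vertices. *)
Definition simplex_chain (t : seq W) : seq W -> int :=
  foldr (@wedge W) (fun s => (s == [::])%:R) t.

Lemma simplex_chain_supp t s : simplex_chain t s != 0 -> perm_eq s t.
Proof.
elim: t s => [|x t IH] s /=; first by case: (eqVneq s [::]) => [->|//].
move=> /wedge_supp[u su /IH ut]; apply: perm_trans su _.
by rewrite perm_cons.
Qed.

Lemma simplex_chain_alt t : alternating (simplex_chain t).
Proof.
elim: t => [|x t IH] /=; last exact: alternating_wedge.
by move=> [|? ?] ? ? ? /=; rewrite oppr0.
Qed.

Lemma simplex_chainP t : K t -> chain K (simplex_chain t).
Proof.
move=> Kt; split; last exact: simplex_chain_alt.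
  by exists (permutations t) => s /simplex_chain_supp; rewrite mem_permutations.
by move=> s /simplex_chain_supp/Kp; apply.
Qed.

Lemma simplex_chainJ g t s :
  simplex_chain t (seq_act g s) = simplex_chain [seq act g x | x <- t] s.
Proof.
elim: t s => [|x t IH] s /=; first by case: s.
by rewrite wedgeJ; apply: eq_wedge => u; rewrite IH.
Qed.

Lemma alternating_simplex (z : seq W -> int) t s : alternating z -> uniq t ->
  perm_eq s t -> z s = z t * simplex_chain t s.
Proof.
elim: t s z => [|x t IH] s z zA.
  by move=> _ /perm_nilP->; rewrite /= mulr1.
rewrite cons_uniq => /andP[xt ut] st.
have xs : x \in s by rewrite (perm_mem st) mem_head.
case/splitPr: xs st => s1 s2 st0.
have st : perm_eq (s1 ++ s2) t.
  by move: st0; rewrite -(cat1s x s2) perm_catCA /= perm_cons.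
rewrite (alternating_front _ _ _ zA) [in RHS](alternating_front _ _ _ (simplex_chain_alt (x :: t))).
rewrite /= eqxx (_ : wedge x _ _ = 0); last first.
  rewrite (@eq_wedge _ _ _ (fun=> 0)) ?wedge0 // => u; rewrite /contract.
  apply: contraNeq xt => /simplex_chain_supp/perm_mem <-.
  exact: mem_head.
rewrite subr0 -/(simplex_chain t) -[z (x :: _)]/(contract x z _).
rewrite (IH (s1 ++ s2)) //; last exact: alternating_contract.
by rewrite /contract; ring.
Qed.

Definition same_orbit (s t : seq W) : Prop :=
  exists g, perm_eq t [seq act g x | x <- s].

Definition orbit_rep (s : seq W) : seq W := xget [::] [set t | same_orbit s t].

Lemma map_act_act g h s : [seq act g x | x <- [seq act h x | x <- s]] =
  [seq act (g * h)%g x | x <- s].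
Proof. by rewrite -map_comp; apply: eq_map => x /=; rewrite actM. Qed.

Lemma map_act1 s : [seq act 1%g x | x <- s] = s.
Proof. by rewrite -[RHS]map_id; apply: eq_map. Qed.

Lemma same_orbit_refl s : same_orbit s s.
Proof. by exists 1%g; rewrite map_act1. Qed.

Lemma same_orbit_sym s t : same_orbit s t -> same_orbit t s.
Proof.
move=> [g st]; exists g^-1%g; rewrite perm_sym.
have := perm_map (act g^-1%g) st; rewrite map_act_act mulVg map_act1.
by [].
Qed.

Lemma same_orbit_trans s t u : same_orbit s t -> same_orbit t u -> same_orbit s u.
Proof.
move=> [g st] [h tu]; exists (h * g)%g; apply: perm_trans tu _.
by rewrite -map_act_act; apply: perm_map.
Qed.

Lemma orbit_repP s : same_orbit s (orbit_rep s).
Proof.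
by rewrite /orbit_rep; case: xgetP => [//|/(_ s)]; case; exact: same_orbit_refl.
Qed.

Lemma orbit_rep_eq s t : same_orbit s t -> orbit_rep s = orbit_rep t.
Proof.
move=> st; rewrite /orbit_rep; congr (xget _ _); apply/seteqP; split=> u /=.
  by apply: same_orbit_trans; exact: same_orbit_sym.
exact: same_orbit_trans.
Qed.

(* Exactly one ordering of each simplex is distinguished, in an equivariant
   way. *)
Definition distinguished (t : seq W) : Prop :=
  [/\ K t, uniq t & exists g, t = [seq act g x | x <- orbit_rep t]].

Lemma distinguishedJ g t : distinguished t -> distinguished [seq act g x | x <- t].
Proof.
move=> [Kt ut [h th]]; split; first exact: KJ.
  by rewrite map_inj_uniq //; exact: can_inj (actK g).
exists (g * h)%g; rewrite -(@orbit_rep_eq t); last by exists g.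
by rewrite -map_act_act -th.
Qed.

Lemma distinguished_exists s : K s -> uniq s -> exists2 t, distinguished t & perm_eq s t.
Proof.
move=> Ks us; have [g sg] := same_orbit_sym (orbit_repP s).
exists [seq act g x | x <- orbit_rep s] => //; split.
- by apply: Kp Ks; rewrite perm_sym.
- by rewrite -(perm_uniq sg).
- exists g; congr (map _ _); apply: orbit_rep_eq; exists 1%g.
  by rewrite map_act1 perm_sym.
Qed.

(** Both orderings are translates of the representative of their common orbit, so they differ by an
    element that stabilizes the simplex; such an element is trivial by [K_free]. *)
Lemma distinguished_unique s t : distinguished s -> distinguished t ->
  perm_eq s t -> s = t.
Proof.
move=> [Ks us [g sg]] [Kt ut [h th]] st.
have rst : orbit_rep s = orbit_rep t.
  by apply: orbit_rep_eq; exists 1%g; rewrite map_act1 perm_sym.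
have tE : t = [seq act (h * g^-1)%g x | x <- s].
  by rewrite [in RHS]sg map_act_act -mulgA mulVg mulg1 rst -th.
have /K_free : perm_eq [seq act (h * g^-1)%g x | x <- s] s by rewrite -tE perm_sym.
by move=> /(_ Ks us) hg; rewrite tE hg map_act1.
Qed.

(** For a distinguished [t] this element is unique by freeness, hence equivariant in [t]; see
    [moverJ]. *)
Definition mover (t : seq W) : G := xget 1%g [set g | t = [seq act g x | x <- orbit_rep t]].

Lemma moverP t : distinguished t -> t = [seq act (mover t) x | x <- orbit_rep t].
Proof.
by move=> [_ _ [g tg]]; rewrite /mover; case: xgetP => [//|/(_ g)].
Qed.

Lemma moverJ g t : distinguished t ->
  mover [seq act g x | x <- t] = (g * mover t)%g.
Proof.
move=> td; have [Kt ut _] := td; have gtd := distinguishedJ g td.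
have re : orbit_rep t = orbit_rep [seq act g x | x <- t].
  by apply: orbit_rep_eq; exists g.
set m := mover _.
have e : [seq act (g * mover t)%g x | x <- orbit_rep t] = [seq act m x | x <- orbit_rep t].
  by rewrite -map_act_act -(moverP td) {1}(moverP gtd) -re.
have tE : [seq act ((g * mover t)^-1 * m)%g x | x <- orbit_rep t] = orbit_rep t.
  by rewrite -map_act_act -e map_act_act mulVg map_act1.
have rK : K (orbit_rep t) /\ uniq (orbit_rep t).
  have [h rh] := orbit_repP t; split.
    by apply: Kp rh _; exact: KJ.
  by rewrite (perm_uniq rh) map_inj_uniq //; exact: can_inj (actK h).
have /K_free : perm_eq [seq act ((g * mover t)^-1 * m)%g x | x <- orbit_rep t]
  (orbit_rep t) by rewrite tE.
by move=> /(_ rK.1 rK.2) /(congr1 (fun y => g * mover t * y)%g); rewrite mulVKg mulg1.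
Qed.

Definition simplex (t : seq W) : chains :=
  if pselect (K t) is left Kt then mk_chain (simplex_chainP Kt) else 0.

Lemma simplexE t : K t -> chain_val (simplex t) =1 simplex_chain t.
Proof. by rewrite /simplex; case: pselect. Qed.

Lemma simplexJ g t : K t -> gact g (simplex t) = simplex [seq act g x | x <- t].
Proof.
move=> Kt; apply: chain_ext => s; rewrite chain_valJ !simplexE //; last exact: KJ.
exact: simplex_chainJ.
Qed.

Section Extension.
Variables (M : gmodule G) (m : seq W -> M).

Definition basis_image (t : seq W) : M :=
  if `[< distinguished t >] then gact (mover t) (m (orbit_rep t)) else 0.

Lemma basis_imageJ g t : basis_image [seq act g x | x <- t] = gact g (basis_image t).
Proof.
rewrite /basis_image; case: (asboolP (distinguished t)) => td.
  rewrite asboolT; last exact: distinguishedJ.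
  by rewrite moverJ // gactM -(@orbit_rep_eq t) //; exists g.
rewrite asboolF ?raddf0 // => /(distinguishedJ g^-1%g).
by rewrite map_act_act mulVg map_act1.
Qed.

Definition basis_ext (c : chains) : M := fsum (fun t => basis_image t *~ chain_val c t).

Lemma basis_ext_fsupp (c : chains) : fsupp (fun t => basis_image t *~ chain_val c t).
Proof.
have [[r rc] _ _] := chain_valP c; exists r => t ct; apply: rc.
by apply: contra ct => /eqP->; rewrite mulr0z.
Qed.

Lemma basis_extB c c' : basis_ext (c - c') = basis_ext c - basis_ext c'.
Proof.
rewrite /basis_ext -fsumB; try exact: basis_ext_fsupp.
by apply: eq_fsum => t; rewrite chain_valB mulrzBr.
Qed.

Lemma basis_extJ g c : basis_ext (gact g c) = gact g (basis_ext c).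
Proof.
rewrite /basis_ext raddf_fsum; last exact: basis_ext_fsupp.
have K1 : cancel (map (act g)) (map (act g^-1%g)).
  by move=> s; rewrite map_act_act mulVg map_act1.
have K2 : cancel (map (act g^-1%g)) (map (act g)).
  by move=> s; rewrite map_act_act mulgV map_act1.
rewrite -(fsum_bij _ K1 K2); apply: eq_fsum => t /=.
by rewrite basis_imageJ chain_valJ /seq_act K1 -raddfMz.
Qed.

End Extension.

(** The module is free on the representatives of the orbits of duplicate-free simplices: a lift is
    chosen at each of them and extended equivariantly. *)
Lemma projective_chains : projective chains.
Proof.
move=> M N e f e_onto; have /choice[m mP] := fun t => e_onto (f (simplex t)).
exists (@ghom_of G chains M _ (basis_extB m) (basis_extJ m)) => c.
rewrite -[LHS]/(e (basis_ext m c)) /basis_ext raddf_fsum; last exact: basis_ext_fsupp.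
(* The chain [c] is the sum of these terms. With all orderings instead of the distinguished one,
   each simplex would be counted several times. *)
pose F (t : seq W) : chains :=
  if `[< distinguished t >] then simplex t *~ chain_val c t else 0.
have [[r rc] cK cA] := chain_valP c.
have Fs : fsupp F.
  exists r => t; rewrite /F; case: ifP => _; last by rewrite eqxx.
  by move=> ct; apply: rc; apply: contra ct => /eqP->; rewrite mulr0z.
transitivity (f (fsum F)).
  rewrite raddf_fsum //; apply: eq_fsum => t /=; rewrite /basis_image /F.
  case: asboolP => [td|_]; last by rewrite mul0rz !raddf0.
  rewrite !raddfMz ghomJ mP -ghomJ simplexJ -?moverP //.
  have [Kt _ _] := td; have [h rh] := orbit_repP t.
  by apply: Kp rh _; exact: KJ.
congr (f _); apply: chain_ext => s.
rewrite -[LHS]/(chain_ev s (fsum F)) raddf_fsum //; set ev := _ \o F.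
have evF t : ev t = if `[< distinguished t >] then simplex_chain t s * chain_val c t else 0.
  rewrite /ev /F [LHS]/comp; case: asboolP => [[Kt _ _]|_]; last by rewrite raddf0.
  by rewrite raddfMz mulrzz /= simplexE.
case: (pselect (K s /\ uniq s)) => [[Ks us]|ns].
  have [t td st] := distinguished_exists Ks us.
  rewrite (@fsum1 _ _ _ t) => [|u ut]; rewrite evF.
    have [_ ut _] := td.
    by rewrite asboolT // (alternating_simplex cA ut st) mulrC.
  case: asboolP => // ud; rewrite [X in X * _](_ : _ = 0) ?mul0r //.
  apply: contraNeq ut => /simplex_chain_supp su; apply/eqP.
  by apply: distinguished_unique => //; apply: perm_trans st; rewrite perm_sym.
have -> : chain_val c s = 0.
  apply: contra_notP ns => /eqP cs; split; first exact: cK.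
  exact: alternating_uniq cs.
apply: fsum0 => t; rewrite evF; case: asboolP => // -[Kt ut _].
rewrite [X in X * _](_ : _ = 0) ?mul0r //.
apply: contra_notP ns => /eqP/simplex_chain_supp st; split; first exact: Kp Kt.
by rewrite (perm_uniq st).
Qed.

End Projective.
End ChainModule.

Lemma fsum_inj (T U : choiceType) (M : zmodType) (h : T -> U) (F : U -> M) :
  injective h -> (forall y, F y != 0 -> exists x, y = h x) -> fsupp F ->
  fsum F = fsum (F \o h).
Proof.
move=> h_inj Fh [s sF].
have [r rP] : exists r : seq T, forall x, h x \in s -> x \in r.
  elim: s {sF} => [|y s [r rP]]; first by exists [::].
  case: (pselect (exists x, y = h x)) => [[x ->]|yh].
    exists (x :: r) => z; rewrite inE => /predU1P[/h_inj->|/rP zr]; first exact: mem_head.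
    by rewrite inE zr orbT.
  by exists r => z; rewrite inE => /predU1P[hz|/rP//]; case: yh; exists z.
rewrite (@fsumE _ _ (undup r) (F \o h)) ?undup_uniq //; last first.
  by move=> x /= /sF/rP; rewrite mem_undup.
rewrite (@fsumE _ _ (map h (undup r)) F) ?big_map ?map_inj_uniq ?undup_uniq //.
move=> y Fy; have [x xy] := Fh y Fy; apply/mapP; exists x => //.
by rewrite mem_undup; apply: rP; rewrite -xy; exact: sF.
Qed.

(** * From the clique complex to a resolution over the group *)

Section Assembly.
Variables (G : groupType) (H : groupClosed G).
Local Notation HT := (subgroup_type H).
Local Notation W := (G + set G)%type.

Definition vact (g : G) (w : W) : W :=
  match w with inl x => inl (g * x)%g | inr A => inr (ltrans g A) end.

Fact vact1 w : vact 1%g w = w.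
Proof.
case: w => [x|A] /=; first by rewrite mul1g.
by congr inr; apply/funext => x; rewrite /ltrans /= invg1 mul1g.
Qed.

Fact vactM g h w : vact (g * h)%g w = vact g (vact h w).
Proof.
case: w => [x|A] /=; first by rewrite mulgA.
by congr inr; apply/funext => x; rewrite /ltrans /= invgM mulgA.
Qed.

Variable adj : W -> W -> Prop.
Hypotheses (adjC : forall x y, adj x y -> adj y x)
  (adjJ : forall g x y, adj x y -> adj (vact g x) (vact g y))
  (adj_refl : forall w, adj w w <->
     (exists g, w = inl g) \/ (exists g, w = inr (lcoset_set H g))).
Variable wt : W -> nat.
Hypothesis dismantle : forall F : seq W, (forall x, x \in F -> adj x x) ->
  (exists2 o, adj o o & forall x, x \in F -> adj x o) \/
  (exists w w', [/\ w \in F, (wt w' < wt w)%N, adj w' w' &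
     forall y, y \in F -> adj y w -> adj y w']).
Variable N : nat.
Hypothesis clique_bound : forall k s, clique adj k s -> uniq s -> (k <= N)%N.
Hypothesis clique_free : forall g k s, clique adj k.+2 s -> uniq s ->
  perm_eq [seq vact g x | x <- s] s -> g = 1%g.

Definition group_vertex (s : seq W) : Prop := exists g : G, s = [:: inl g].

Lemma group_vertex_perm s t : perm_eq s t -> group_vertex t -> group_vertex s.
Proof. by move=> + [g tg]; rewrite tg => st; exists g; exact: perm_small_eq st. Qed.

Lemma group_vertexJ g s : group_vertex s -> group_vertex [seq vact g x | x <- s].
Proof. by move=> [x ->]; exists (g * x)%g. Qed.

Lemma group_vertex_free g s : group_vertex s -> uniq s ->
  perm_eq [seq vact g x | x <- s] s -> g = 1%g.
Proof.
move=> [x ->] _ /= /perm_mem/(_ (inl (g * x)%g)); rewrite !inE eqxx => /esym/eqP[gx].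
by rewrite -[g](mulgK x) gx mulgV.
Qed.

Lemma cliqueJ k g s : clique adj k s -> clique adj k [seq vact g x | x <- s].
Proof.
move=> [sk sc]; split; first by rewrite size_map.
by move=> _ _ /mapP[x xs ->] /mapP[y ys ->]; apply: adjJ; exact: sc.
Qed.

Local Notation C k := (@chains G W vact vact1 vactM (clique adj k) (@cliqueJ k)).
Local Notation C0 := (@chains G W vact vact1 vactM group_vertex group_vertexJ).
Local Notation Z := (trivial_gmodule HT).

(** Simplices of degree [i] have [i + 1] vertices. Cone vertices are left out in degree 0, where
    they are stabilized by conjugates of [H]; [ind Z] accounts for them. *)
Definition cpx (i : nat) : gmodule G := if i is j.+1 then C j.+2 else C0.

Lemma cpx_projective i : projective (cpx i).
Proof.
case: i => [|i] /=.
  by apply: projective_chains group_vertex_perm _; exact: group_vertex_free.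
by apply: projective_chains (@clique_perm _ adj _) _ => g s; exact: clique_free.
Qed.

(** Alternating chains vanish on sequences with a repetition, so only duplicate-free cliques
    count. *)
Lemma chains_bound k (c : C k) : (N < k)%N -> c = 0.
Proof.
move=> Nk; apply: chain_ext => s; have [_ cK cA] := chain_valP c.
rewrite [RHS]chain_val0; apply/eqP; apply: contraTT Nk => cs.
by rewrite -leqNgt; apply: clique_bound (cK s cs) _; exact: alternating_uniq cs.
Qed.

Lemma cpx_bound i : (N < i)%N -> forall c : cpx i, c = 0.
Proof.
case: i => [|i] Ni c; first by rewrite ltn0 in Ni.
exact: (@chains_bound i.+2 c (leqW Ni)).
Qed.

Lemma bdJ_val g (K : seq W -> Prop) (KJ : forall g s, K s -> K [seq vact g x | x <- s])
  (c : @chains G W vact vact1 vactM K KJ) s :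
  bd (chain_val (gact g c)) s = bd (chain_val c) (seq_act vact g s).
Proof. exact: (bdJ vact1 vactM). Qed.

Lemma bdB_val (K : seq W -> Prop) (KJ : forall g s, K s -> K [seq vact g x | x <- s])
  (c c' : @chains G W vact vact1 vactM K KJ) s :
  bd (chain_val (c - c')) s = bd (chain_val c) s - bd (chain_val c') s.
Proof.
have := bdB (chain_valP c) (chain_valP c').
by move=> /(congr1 (fun f => f s)).
Qed.

Definition boundary_fun k (c : C k.+1) : C k :=
  mk_chain vact1 vactM (@cliqueJ k) (chain_bd (@clique_behead _ adj k) (chain_valP c)).

Fact boundaryB k c c' : @boundary_fun k (c - c') = boundary_fun c - boundary_fun c'.
Proof. by apply: chain_ext => s; rewrite chain_valB; exact: bdB_val. Qed.

Fact boundaryJ k g c : @boundary_fun k (gact g c) = gact g (boundary_fun c).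
Proof. by apply: chain_ext => s; rewrite chain_valJ; exact: bdJ_val. Qed.

Definition boundary k : ghom (C k.+1) (C k) := ghom_of (@boundaryB k) (@boundaryJ k).

Definition group_part (f : seq W -> int) : seq W -> int :=
  fun s => if s is [:: inl _] then f s else 0.

Lemma group_part_chain f : chain (clique adj 1) f -> chain group_vertex (group_part f).
Proof.
move=> [[r rf] fK fA]; split.
- by exists r => -[|[g|A] [|? ?]] //=; exact: rf.
- by move=> [|[g|A] [|? ?]] //= _; exists g.
- by move=> [|[g|A] [|? ?]] [x|x] [y|y] s2 /=; rewrite ?oppr0.
Qed.

Definition boundary0_fun (c : C 2) : C0 :=
  mk_chain vact1 vactM group_vertexJ (group_part_chain (chain_valP (boundary 1 c))).

Fact boundary0B c c' : boundary0_fun (c - c') = boundary0_fun c - boundary0_fun c'.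
Proof.
apply: chain_ext => s; rewrite chain_valB.
case: s => [|[g|A] [|? ?]]; rewrite ?subr0 //; exact: bdB_val.
Qed.

Fact boundary0J g c : boundary0_fun (gact g c) = gact g (boundary0_fun c).
Proof.
apply: chain_ext => s; rewrite chain_valJ.
by case: s => [|[x|A] [|? ?]] //; exact: bdJ_val.
Qed.

Definition cpx_bd (i : nat) : ghom (cpx i.+1) (cpx i) :=
  match i with 0%N => ghom_of boundary0B boundary0J | j.+1 => boundary j.+2 end.

Definition coset_vertex (x : G) : W := inr (lcoset_set H x).

Lemma coset_vertexM (h : HT) x : coset_vertex (x * val h)%g = coset_vertex x.
Proof.
congr inr; apply/lcoset_setP; rewrite invgM -mulgA mulVg mulg1 gpredV.
exact: valP.
Qed.

(** The part of the boundary on cone vertices, read as a function on [G] that is constant on left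
    cosets: [ind Z] is the permutation module [Z[G/H]]. *)
Lemma theta_pred (c : C 2) :
  ind_pred (P := Z) (fun x => bd (chain_val c) [:: coset_vertex x]).
Proof.
split=> [h x|]; first by rewrite coset_vertexM.
have [[r rb] _ _] := chain_valP (boundary 1 c).
exists (pmap (fun s : seq W => if s is [:: inr A] then Some (xget 1%g A) else None) r) => x.
move=> /rb xr; apply/hasP; exists (xget 1%g (lcoset_set H x)).
  by rewrite mem_pmap; apply/mapP; exists [:: coset_vertex x].
case: xgetP => [y yE xy|/(_ x)]; last by rewrite /lcoset_set /= /in_coset mulVg gpred1.
by rewrite -[X in X \in _]invgK gpredV invgM invgK.
Qed.

Definition theta_fun (c : C 2) : ind Z := mk_ind (theta_pred c).

Fact thetaB c c' : theta_fun (c - c') = theta_fun c - theta_fun c'.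
Proof. by apply: ind_ext => x; rewrite ind_funB; exact: bdB_val. Qed.

Fact thetaJ g c : theta_fun (gact g c) = gact g (theta_fun c).
Proof.
apply: ind_ext => x; rewrite ind_funJ /theta_fun.
rewrite -[LHS]/(bd (chain_val (gact g c)) [:: coset_vertex x]) bdJ_val.
by congr (bd _ [:: inr _]); rewrite ltrans_lcoset.
Qed.

Definition theta : ghom (C 2) (ind Z) := ghom_of thetaB thetaJ.

Lemma thetaE c x : ind_fun (theta c) x = bd (chain_val c) [:: coset_vertex x].
Proof. by []. Qed.

Definition alpha_fun (c : C0) : trivial_gmodule G := bd (chain_val c) [::].
Fact alphaB c c' : alpha_fun (c - c') = alpha_fun c - alpha_fun c'.
Proof. exact: bdB_val. Qed.
Fact alphaJ g c : alpha_fun (gact g c) = gact g (alpha_fun c).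
Proof. exact: bdJ_val. Qed.
Definition alpha : ghom C0 (trivial_gmodule G) := ghom_of alphaB alphaJ.

Definition triv_res : ghom Z (res H (trivial_gmodule G)) :=
  @ghom_of HT Z (res H (trivial_gmodule G)) id (fun _ _ => erefl) (fun _ _ => erefl).

Definition beta : ghom (ind Z) (trivial_gmodule G) :=
  ghom_of (ind_ext_funB triv_res) (ind_ext_funJ triv_res).

(** Embeds [Z[G/H]] into the chains on single vertices, so that acyclicity can be applied to both
    summands of degree 0 at once. *)
Definition coset_part (x : ind Z) (s : seq W) : int :=
  if s is [:: inr A] then ind_term triv_res x A else 0.

Lemma ind_term_coset x g : ind_term triv_res x (lcoset_set H g) = ind_fun x g.
Proof. by rewrite ind_termE. Qed.

Lemma coset_part_chain x : chain (clique adj 1) (coset_part x).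
Proof.
have [r rx] := ind_term_fsupp triv_res x; split.
- exists [seq [:: inr A] | A <- r] => -[|[g|A] [|? ?]] //= /rx Ar.
  by apply/mapP; exists A.
- move=> [|[g|A] [|? ?]] //= xA; split=> // u v; rewrite !inE => /eqP-> /eqP->.
  apply/adj_refl; right; apply: contrapT => Ax; move: xA; rewrite ind_term0 // => g Ag.
  by apply: Ax; exists g; rewrite Ag.
- by move=> [|[?|?] [|? ?]] [?|?] [?|?] s2 /=; rewrite ?oppr0.
Qed.

Lemma beta_coset_part x : beta x = bd (coset_part x) [::].
Proof.
rewrite /bd (fsum_inj (h := @inr G (set G))) //; first by move=> A B [].
  by move=> [g|A] //=; rewrite ?eqxx //; exists A.
exact: chain_fsupp_cons (coset_part_chain x).
Qed.

Lemma group_chain_clique f : chain group_vertex f -> chain (clique adj 1) f.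
Proof.
move=> [fs fK fA]; split=> // s /fK[g ->]; split=> // x y; rewrite !inE => /eqP-> /eqP->.
by apply/adj_refl; left; exists g.
Qed.

Lemma chain1_ext f f' : chain (clique adj 1) f -> chain (clique adj 1) f' ->
  (forall g, f [:: inl g] = f' [:: inl g]) ->
  (forall g, f [:: coset_vertex g] = f' [:: coset_vertex g]) -> f = f'.
Proof.
move=> fK f'K fG fH; apply/funext => s.
case: (pselect (clique adj 1 s)) => [[s1 sK]|ns].
  case: s s1 sK => [//|v [|//]] _ /(_ v v); rewrite mem_head.
  by move=> /(_ isT isT)/adj_refl[[g ->]|[g ->]]; [exact: fG | exact: fH].
have [_ K1 _] := fK; have [_ K2 _] := f'K.
have -> : f s = 0 by apply: contra_notP ns => /eqP/K1.
by apply/esym; apply: contra_notP ns => /eqP/K2.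
Qed.

Lemma chain1_bd f s : chain (clique adj 1) f -> bd f [::] = 0 -> bd f s = 0.
Proof.
case: s => [//|x s] fK _; apply/eqP; apply: contraT.
by move=> /(bd_neq0 (chain_vsupp fK))[y]; have [_ K1 _] := fK; move=> /K1[].
Qed.

Lemma cpx_aug_bd c : alpha (cpx_bd 0 c) + beta (theta c) = 0.
Proof.
have uK := chain_valP (boundary 1 c); set u := chain_val (boundary 1 c) in uK.
have uE s : u s = bd (chain_val c) s by [].
have gK : chain (clique adj 1) (group_part u) by apply/group_chain_clique/group_part_chain.
have tK := coset_part_chain (theta c).
rewrite beta_coset_part.
have u0 : bd u [::] = 0.
  have [_ _ cA] := chain_valP c.
  exact: (bd_bd _ cA (chain_vsupp (chain_valP c))).
have uD : u = group_part u - (0 - coset_part (theta c)).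
  have c0 := chain0 (clique adj 1).
  apply: chain1_ext => // [|g|g]; first by apply: chainB => //; exact: chainB.
    transitivity (u [:: inl g] - (0 - 0)) => //; by rewrite !subr0.
  transitivity (0 - (0 - coset_part (theta c) [:: coset_vertex g])) => //.
  by rewrite sub0r opprB subr0 /= ind_term_coset thetaE.
have c0 := chain0 (clique adj 1).
move: u0; rewrite uD (bdB gK (chainB c0 tK)) (bdB c0 tK).
move=> <-; transitivity (bd (group_part u) [::] - (0 - bd (coset_part (theta c)) [::])).
  by rewrite sub0r opprK.
by rewrite -[X in X - bd _ _](@fsum0 _ _ (fun v : W => 0 : int)).
Qed.

Lemma cpx_exact k (c : C k.+1) : bd (chain_val c) =1 0 ->
  exists c' : C k.+2, boundary k.+1 c' = c.
Proof.
move=> c0; have [h hK hE] := acyclic adjC dismantle (chain_valP c) c0.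
exists (mk_chain vact1 vactM (@cliqueJ k.+2) hK).
by apply: chain_ext => s; rewrite -hE.
Qed.

(** [b] and [x] are glued to one chain [u] on all vertices; its coefficients add up to 0, so it is a
    boundary by acyclicity. *)
Lemma cpx_exact0 b x : alpha b + beta x = 0 ->
  exists c, cpx_bd 0 c = b /\ theta c = x.
Proof.
move=> bx; have bK := group_chain_clique (chain_valP b).
have xK := coset_part_chain x; have c0 := chain0 (clique adj 1).
have x'K := chainB c0 xK; have uK := chainB bK x'K.
pose u : C 1 := mk_chain vact1 vactM (@cliqueJ 1) uK.
have [|c cE] := @cpx_exact 0 u.
  move=> s; apply: chain1_bd; first exact: uK.
  rewrite -[chain_val u]/(chain_val b - (0 - coset_part x)) (bdB bK x'K) (bdB c0 xK).
  transitivity (bd (chain_val b) [::] -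
    (bd (0 : seq W -> int) [::] - bd (coset_part x) [::])) => //.
  by rewrite [bd 0 _]fsum0 // sub0r opprK -beta_coset_part.
have cs s : bd (chain_val c) s = chain_val b s + coset_part x s.
  have -> : bd (chain_val c) s = chain_val u s by rewrite -cE.
  transitivity (chain_val b s - (0 - coset_part x s)) => //.
  by rewrite sub0r opprK.
have bG s : ~ group_vertex s -> chain_val b s = 0.
  by have [_ K1 _] := chain_valP b; apply: contra_notP => /eqP/K1.
exists c; split.
  apply: chain_ext => s; rewrite -[LHS]/(group_part (bd (chain_val c)) s).
  case: s => [|[g|A] [|? ?]] /=; try by rewrite bG // => -[].
  by rewrite cs addr0.
by apply: ind_ext => g; rewrite thetaE cs bG ?add0r /= ?ind_term_coset // => -[].
Qed.

Lemma cpx_exact1 c : cpx_bd 0 c = 0 -> theta c = 0 -> exists c', cpx_bd 1 c' = c.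
Proof.
move=> c0 c1; apply: (@cpx_exact 1 c) => s.
have uK := chain_valP (boundary 1 c).
have -> : bd (chain_val c) = (0 : seq W -> int); last by [].
apply: chain1_ext uK (chain0 _) _ _ => g.
  by have := congr1 (fun b : C0 => chain_val b [:: inl g]) c0.
by rewrite -[LHS]thetaE c1.
Qed.

Lemma cpx_exact2 i c : cpx_bd i.+1 c = 0 -> exists c', cpx_bd i.+2 c' = c.
Proof.
move=> c0; apply: (@cpx_exact i.+2 c) => s.
by have := congr1 (fun b : C i.+2 => chain_val b s) c0.
Qed.

Lemma bd_bd_val k (c : C k) s : bd (bd (chain_val c)) s = 0.
Proof.
by have cK := chain_valP c; apply: bd_bd (chain_vsupp cK); case: cK.
Qed.

Lemma cpx_bd_bd i c : cpx_bd i (cpx_bd i.+1 c) = 0.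
Proof.
case: i c => [|i] c.
  apply: (@chain_ext _ _ _ vact1 vactM _ group_vertexJ) => s.
  case: s => [|[g|A] [|? ?]] //; exact: bd_bd_val.
apply: (@chain_ext _ _ _ vact1 vactM _ (@cliqueJ i.+2)) => s; exact: bd_bd_val.
Qed.

Lemma theta_bd c : theta (cpx_bd 1 c) = 0.
Proof. by apply: ind_ext => g; rewrite thetaE; exact: bd_bd_val. Qed.

Lemma aug_onto z : exists b x, alpha b + beta x = z.
Proof.
pose f (s : seq W) : int := if s == [:: inl 1%g] then z else 0.
have fK : chain group_vertex f.
  split.
  - exists [:: [:: inl 1%g]] => s; rewrite /f inE.
    by case: (s == _) => //; rewrite eqxx.
  - move=> s; rewrite /f; case: (eqVneq s [:: inl 1%g]) => [-> _|_].
      by exists 1%g.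
    by rewrite eqxx.
  - by move=> [|a [|b s1]] x y s2; rewrite /f /= !eqseq_cons ?andbF ?oppr0.
exists (mk_chain vact1 vactM group_vertexJ fK), 0; rewrite raddf0 addr0.
rewrite -[LHS]/(fsum (fun v => f [:: v])) (@fsum1 _ _ _ (inl 1%g)) /f ?eqxx //.
by move=> v /negbTE; rewrite eqseq_cons andbT => ->.
Qed.

Lemma finite_cd_of_complex : finite_cd HT -> finite_cd G.
Proof.
move=> [n [P [d [eps [P_proj P0 eps_onto ex0 ex]]]]]; exists (maxn N n).
have lift_iff (M1 M2 M3 : gmodule HT) (f : ghom M1 M2) (g : ghom M2 M3) :
    (forall y, g y = 0 <-> exists x, f x = y) ->
    forall F, ind_hom g F = 0 <-> exists F', ind_hom f F' = F.
  move=> fg F; split=> [gF|[F' <-]].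
    apply: ind_lift => x; apply/fg; rewrite -ind_homE gF.
    by [].
  by apply: ind_ext => x; rewrite !ind_homE; apply/fg; exists (ind_fun F' x).
apply: (@cd_le_cone G _ cpx (fun i => ind (P i)) (ind Z) cpx_bd theta alpha beta
  (fun i => ind_hom (d i)) (ind_hom eps)).
- exact: cpx_projective.
- by move=> i; apply: projective_ind.
- by move=> i; rewrite gtn_max => /andP[Ni _]; exact: cpx_bound.
- move=> i; rewrite gtn_max => /andP[_ ni] F; apply: ind_ext => x.
  exact: (P0 i ni).
- exact: aug_onto.
- exact: cpx_aug_bd.
- exact: theta_bd.
- exact: cpx_bd_bd.
- exact: cpx_exact0.
- exact: cpx_exact1.
- exact: cpx_exact2.
- by move=> F; apply: ind_lift => x; exact: eps_onto.
- exact: lift_iff.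
- by move=> i; exact: lift_iff.
Qed.

End Assembly.

(** * Graphs and the relative Rips complex *)

Local Open Scope nat_scope.

Section Walks.
Variables (T : Type) (e : T -> T -> Prop) (w : T -> T -> nat).

Inductive walk : nat -> T -> T -> Prop :=
| walk0 x : walk 0 x x
| walkS x y z n : e x y -> walk n y z -> walk (w x y + n) x z.

Lemma walk1 x y : e x y -> walk (w x y) x y.
Proof. by move=> xy; rewrite -[w x y]addn0; apply: walkS xy (walk0 y). Qed.

Lemma walk_cat n m x y z : walk n x y -> walk m y z -> walk (n + m) x z.
Proof.
by elim=> // x' y' z' k xy _ IH /IH; rewrite -addnA; exact: walkS.
Qed.

Lemma walk_rev n x y : (forall x y, e x y -> e y x) -> (forall x y, w x y = w y x) ->
  walk n x y -> walk n y x.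
Proof.
move=> eC wC; elim=> [x'|x' y' z' k xy _ IH]; first exact: walk0.
by rewrite addnC wC; apply: walk_cat IH _; apply/walk1/eC.
Qed.

(** With edges of weight at most 2, a prescribed length is overshot by at most 1. *)
Lemma walk_split n m x z : (forall x y, w x y <= 2) -> walk n x z -> m <= n ->
  exists y a b, [/\ walk a x y, walk b y z, a + b = n & m <= a <= m.+1].
Proof.
move=> w2 xz; elim: xz m => [y|x' y z' k xy yz IH] m mn.
  by exists y, 0, 0; split; [exact: walk0|exact: walk0|lia|lia].
case: (leqP m (w x' y)) => mw.
  case: m {IH} mn mw => [|m] mn mw.
    exists x', 0, (w x' y + k); split; [exact: walk0|exact: walkS|lia|lia].
  exists y, (w x' y), k; split; [exact: walk1|by []|lia|].
  by have := w2 x' y; lia.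
have [|u [a [b [yu uz abk am]]]] := IH (m - w x' y); first lia.
by exists u, (w x' y + a), b; split; [exact: walkS|by []|lia|lia].
Qed.

Definition connected x y : Prop := exists n, `[< walk n x y >].

(** Unconnected points are at distance 0 by convention; the hypotheses [V] below ensure
    connectedness. *)
Definition dist x y : nat :=
  if pselect (connected x y) is left xy then ex_minn xy else 0.

Lemma dist_walk x y n : walk n x y -> walk (dist x y) x y.
Proof.
move=> xy; rewrite /dist; case: pselect => [c|]; last by case; exists n; apply/asboolP.
by case: ex_minnP => m /asboolP.
Qed.

Lemma dist_le x y n : walk n x y -> dist x y <= n.
Proof.
move=> xy; rewrite /dist; case: pselect => [c|//].
by case: ex_minnP => m _; apply; apply/asboolP.
Qed.

Lemma distxx x : dist x x = 0.
Proof. by have := dist_le (walk0 x); case: dist. Qed.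

End Walks.

Definition avoiding (T : Type) (e : T -> T -> Prop) (B : T) (x y : T) : Prop :=
  [/\ e x y, x <> B & y <> B].

(** * Going around a vertex of a hyperbolic graph *)

Section Graph.
Variables (T : eqType) (e : T -> T -> Prop) (w : T -> T -> nat) (V : T -> Prop).
Hypotheses (eC : forall x y, e x y -> e y x) (wC : forall x y, w x y = w y x).
Hypotheses (w_gt0 : forall x y, 0 < w x y) (w_le2 : forall x y, w x y <= 2).
Hypothesis eV : forall x y, e x y -> V x.
Hypothesis V_connected : forall x y, V x -> V y -> exists n, walk e w n x y.

Local Notation d := (dist e w).

Lemma walkV n x y : walk e w n x y -> V x -> V y.
Proof. by elim=> // x' y' z' k /eC/eV Vy _ IH _; exact: IH. Qed.

Lemma geodesic x y : V x -> V y -> walk e w (d x y) x y.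
Proof. by move=> Vx Vy; have [n] := V_connected Vx Vy; exact: dist_walk. Qed.

Lemma distC x y : V x -> V y -> d x y = d y x.
Proof.
by move=> Vx Vy; apply/eqP; rewrite eqn_leq !dist_le //;
  apply: walk_rev => //; exact: geodesic.
Qed.

Lemma dist_triangle x y z : V x -> V y -> V z -> d x z <= d x y + d y z.
Proof.
by move=> Vx Vy Vz; apply: dist_le; apply: walk_cat (geodesic Vx Vy) (geodesic Vy Vz).
Qed.

Lemma dist_eq0 x y : V x -> V y -> d x y = 0 -> x = y.
Proof.
have walk_eq0 n u v : walk e w n u v -> n = 0 -> u = v.
  by case=> // x' y' z' k _ _; have := w_gt0 x' y'; lia.
by move=> Vx Vy; exact: walk_eq0 (geodesic Vx Vy).
Qed.

Lemma dist_gt0 x y : V x -> V y -> x <> y -> 0 < d x y.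
Proof. by move=> Vx Vy xy; rewrite lt0n; apply/eqP => /(dist_eq0 Vx Vy). Qed.

Lemma dist_point x z m : V x -> V z -> m <= d x z ->
  exists y, [/\ V y, d x y + d y z = d x z & m <= d x y <= m.+1].
Proof.
move=> Vx Vz mz; have [y [a [b [xy yz ab am]]]] := walk_split w_le2 (geodesic Vx Vz) mz.
have Vy := walkV xy Vx; exists y.
have := dist_triangle Vx Vy Vz; have := dist_le xy; have := dist_le yz.
split=> //. by lia. by lia.
Qed.

Variable delta : nat.
Hypothesis hyp : forall x y z t, V x -> V y -> V z -> V t ->
  d x y + d z t <= maxn (d x z + d y t) (d x t + d y z) + delta.

Section Avoiding.
Variable B : T.
Hypothesis VB : V B.
Local Notation walk' := (walk (avoiding e B) w).

Lemma walk_avoid n x y : V x -> walk e w n x y -> walk' n x y \/ d x B + d B y <= n.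
Proof.
move=> Vx xy; elim: xy Vx => [x' _|x' y' z' k xy' yz IH Vx]; first by left; exact: walk0.
have Vy : V y' by apply/eV/eC/xy'.
have Vz := walkV yz Vy.
have d1 : d x' y' <= w x' y' by apply/dist_le/walk1.
have d2 := dist_le yz.
case: (pselect (x' = B)) => [xB|xB].
  right; rewrite -xB distxx; have := dist_triangle Vx Vy Vz; lia.
case: (pselect (y' = B)) => [yB|yB].
  right; rewrite -yB; lia.
have [yz'|yBz] := IH Vy; first by left; apply: walkS yz'.
right; have := dist_triangle Vx Vy VB; lia.
Qed.

Lemma geodesic_avoid x y : V x -> V y -> d x y < d x B + d B y -> walk' (d x y) x y.
Proof.
move=> Vx Vy xBy; have [//|] := walk_avoid Vx (geodesic Vx Vy).
by rewrite leqNgt xBy.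
Qed.

Lemma walk_avoid_rev n x y : walk' n x y -> walk' n y x.
Proof. by apply: walk_rev => // u v [/eC]. Qed.

(** Move from [a] back along a geodesic towards [u]. Either the point [p] reached sees [v] without
    passing through [B], or the geodesic from [u] to [v] runs close to [p] and can be joined there,
    at [q]. *)
Lemma detour u v a : V u -> V v -> V a -> u <> B -> a <> B -> d a B = 1 ->
  d u a + 1 = d u B -> d u v < d u B + d B v ->
  exists p n, [/\ V p, p <> B, d p B <= 4 * delta + 8,
    n <= 4 * delta + 8 /\ walk' n a p & d p v < d p B + d B v].
Proof.
move=> Vu Vv Va uB aB aB1 uaB uBv.
have au := distC Va Vu; have vB := distC Vv VB; have uBC := distC Vu VB.
case: (ltnP (d a u) (2 * delta + 2)) => Rau.
  exists u, (d a u); split=> //; first lia.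
  by split; [lia | apply: geodesic_avoid => //; lia].
(* Then [p] is at distance at least [2 * delta + 3] from [B], more than the bound [2 * delta + 1] on
   [d p q] below, so that crossing from [p] to [q] avoids [B]. *)
have [p [Vp apu /andP[Rp pR]]] := dist_point Va Vu Rau.
have pa := distC Vp Va; have pu := distC Vp Vu; have pBC := distC Vp VB.
have pB : d p B = d a p + 1.
  by have := dist_triangle Vp Va VB; have := dist_triangle Vu Vp VB; lia.
have ap : walk' (d a p) a p by apply: geodesic_avoid => //; lia.
have pB' : p <> B by move=> pB0; move: pB; rewrite pB0 distxx; lia.
have pv := hyp Vp Vv Vu VB.
have vu := distC Vv Vu.
have stop : d p v < d p B + d B v ->
    exists p n, [/\ V p, p <> B, d p B <= 4 * delta + 8,
      n <= 4 * delta + 8 /\ walk' n a p & d p v < d p B + d B v].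
  by move=> pBv; exists p, (d a p); split=> //; [lia | split=> //; lia].
case: (ltnP (d p v) (d p B + d B v)) => [//|pvB].
have [q [Vq uqv /andP[Rq qR]]] : exists q, [/\ V q, d u q + d q v = d u v &
    d p u <= d u q <= (d p u).+1] by apply: dist_point => //; lia.
(* In [pv], the alternative with [d p u + d v B] would give [2 * d p B <= delta]. Hence [d p v] is
   at most [d u v - d p u + delta], and the four-point inequality compares [p] with [q]. *)
have pq : d p q <= 2 * delta + 1.
  have := hyp Vp Vq Vu Vv; have := distC Vq Vu; lia.
have qB : d q B + d B v <= d q v -> False.
  by have := dist_triangle Vu Vq VB; lia.
have qpB : d p B <= d p q + d q B by apply: dist_triangle.
have qBp : d q B <= d q p + d p B by apply: dist_triangle.
have qp := distC Vq Vp.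
exists q, (d a p + d p q); split=> //.
- by move=> qB0; move: pq; rewrite qB0; lia.
- lia.
- split; first lia.
  by apply: walk_cat ap _; apply: geodesic_avoid => //; have := distC VB Vq; lia.
- by have [//|/qB] := ltnP (d q v) (d q B + d B v).
Qed.

(** Two detours of length at most [4 * delta + 8] are joined by a geodesic shorter than twice that
    bound; this is the origin of [16 * delta + 32]. *)
Lemma around u v a b : V u -> V v -> V a -> V b -> u <> B -> v <> B ->
  a <> B -> b <> B -> d a B = 1 -> d b B = 1 ->
  d u a + 1 = d u B -> d v b + 1 = d v B -> d u v < d u B + d B v ->
  exists2 n, n <= 16 * delta + 32 & walk' n a b.
Proof.
move=> Vu Vv Va Vb uB vB aB bB aB1 bB1 uaB vbB uBv.
have [p [n [Vp pB pBR [nR ap] pBv]]] := detour Vu Vv Va uB aB aB1 uaB uBv.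
(* The second detour aims at [p] rather than at [u], so that the geodesic from [q] to [p] avoids
   [B]. *)
have [|q [m [Vq qB qBR [mR bq] qBp]]] := detour Vv Vp Vb vB bB bB1 vbB.
  have := distC Vv Vp; have := distC VB Vp; have := distC VB Vv; lia.
have qp : walk' (d q p) q p by apply: geodesic_avoid.
exists (n + (d q p + m)); first by have := distC VB Vp; lia.
apply: walk_cat ap _; apply: walk_avoid_rev.
by rewrite addnC; apply: walk_cat bq qp.
Qed.

End Avoiding.

(** * Angles at cone vertices and the relative Rips graph *)

Section Rips.
Variables (cone : T -> Prop) (angle : T -> T -> nat) (L : nat).
Hypotheses (coneV : forall B, cone B -> V B)
  (cone_w : forall B x, cone B -> e x B -> w x B = 1).
Hypotheses (angleC : forall x y, angle x y = angle y x)
  (angle_triangle : forall B x y z, cone B -> e x B -> e y B -> e z B ->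
     angle x z <= angle x y + angle y z).
Hypothesis fine : forall B a b n, cone B -> e a B -> e b B ->
  n <= 16 * delta + 32 -> walk (avoiding e B) w n a b -> angle a b <= L.
Hypothesis e_irrefl : forall x, ~ e x x.

Definition entrance (B u a : T) : Prop := e a B /\ d u a + 1 = d u B.

(** All geodesics to [B] are considered at once; the entrances of one point differ by at most [L],
    by [angle_le_small] with [u = v]. *)
Definition angle_le (B u v : T) (t : nat) : Prop :=
  forall a b, entrance B u a -> entrance B v b -> angle a b <= t.

Lemma entrance_exists B u : cone B -> V u -> u <> B -> exists a, entrance B u a.
Proof.
move=> cB Vu uB; have VB := coneV cB.
have := geodesic VB Vu; move: (dist e w B u) (distC Vu VB) => n nE h.
case: h nE uB Vu VB cB => // x' y' z' k xy yz nE _ Vz Vx cx.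
exists y'; split; first exact: eC.
have Vy : V y' by apply/eV/eC/xy.
have w1 : w x' y' = 1 by rewrite wC; apply: cone_w => //; exact: eC.
have := dist_le yz; have := distC Vy Vz; have := dist_triangle Vz Vy Vx.
have := dist_le (walk1 w (eC xy)); rewrite wC w1; lia.
Qed.

Lemma angle_le_sym B u v t : angle_le B u v t -> angle_le B v u t.
Proof. by move=> uv a b va ub; rewrite angleC; exact: uv. Qed.

Lemma angle_le_mono B u v s t : s <= t -> angle_le B u v s -> angle_le B u v t.
Proof. by move=> st uv a b ua vb; apply: leq_trans (uv a b ua vb) st. Qed.

Lemma angle_le_trans B u v x s t : cone B -> V v -> v <> B ->
  angle_le B u v s -> angle_le B v x t -> angle_le B u x (s + t).
Proof.
move=> cB Vv vB uv vx a b ua xb; have [c vc] := entrance_exists cB Vv vB.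
have [eaB _] := ua; have [ebB _] := xb; have [ecB _] := vc.
apply: leq_trans (angle_triangle cB eaB ecB ebB) _.
by apply: leq_add; [exact: uv | exact: vx].
Qed.

(** By [around], the entrances are joined by a short walk that avoids [B], to which [fine]
    applies. *)
Lemma angle_le_small B u v : cone B -> V u -> V v -> u <> B -> v <> B ->
  d u v < d u B + d B v -> angle_le B u v L.
Proof.
move=> cB Vu Vv uB vB uBv a b [eaB aE] [ebB bE]; have VB := coneV cB.
have Va := eV eaB; have Vb := eV ebB.
have aB : a <> B by move=> aB; move: eaB; rewrite aB; exact: e_irrefl.
have bB : b <> B by move=> bB; move: ebB; rewrite bB; exact: e_irrefl.
have d1 x : V x -> x <> B -> e x B -> d x B = 1.
  move=> Vx xB xe; have := dist_le (walk1 w xe); rewrite cone_w //.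
  by have := dist_gt0 Vx VB xB; lia.
have [n nN ab] := around VB Vu Vv Va Vb uB vB aB bB (d1 _ Va aB eaB) (d1 _ Vb bB ebB) aE bE uBv.
exact: fine ab.
Qed.

Lemma between_of_angle B u v t : cone B -> V u -> V v -> u <> B -> v <> B ->
  L <= t -> ~ angle_le B u v t -> d u B + d B v = d u v.
Proof.
move=> cB Vu Vv uB vB Lt uv; have VB := coneV cB.
have := dist_triangle Vu VB Vv; case: (ltnP (d u v) (d u B + d B v)) => [lt|]; last lia.
by case: uv; apply: angle_le_mono Lt _; exact: angle_le_small.
Qed.

Lemma entrance_between B u v a : cone B -> V u -> V v ->
  d u v + d v B = d u B -> entrance B v a -> entrance B u a.
Proof.
move=> cB Vu Vv uvB [eaB aE]; split=> //; have Va := eV eaB; have VB := coneV cB.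
have := dist_triangle Vu Vv Va; have := dist_triangle Vu Va VB.
have := dist_le (walk1 w eaB); rewrite cone_w //; lia.
Qed.

Lemma angle_le_between B u v x t : cone B -> V u -> V v ->
  d u v + d v B = d u B -> angle_le B x u t -> angle_le B x v t.
Proof. by move=> cB Vu Vv uvB xu a b xa vb; apply: xu => //; exact: entrance_between uvB vb. Qed.

(** An angle above [L] forces the cone vertex onto a geodesic; [wide] asks for more than [2 * L], so
    that a change by [L] still leaves more than [L]; and [3 * L] is the sum of an angle that is not
    wide and one of at most [L]. The distance [2 * delta + 3] survives a move of length [delta + 1]
    or [delta + 2] towards the base point. *)
Definition rips (u v : T) : Prop :=
  [/\ V u, V v, d u v <= 2 * delta + 3 &
    forall B, cone B -> B <> u -> B <> v -> angle_le B u v (3 * L)].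

Lemma rips_refl u : rips u u <-> V u.
Proof.
split=> [[]//|Vu]; split=> //; first by rewrite distxx; lia.
move=> B cB Bu _; have uB : u <> B by move=> uB; exact: Bu.
apply: (@angle_le_mono _ _ _ L); first lia.
apply: angle_le_small => //; rewrite distxx.
by have := dist_gt0 Vu (coneV cB) uB; lia.
Qed.

Lemma ripsC u v : rips u v -> rips v u.
Proof.
move=> [Vu Vv uv ang]; split=> //; first by rewrite distC.
by move=> B cB Bv Bu; apply/angle_le_sym/ang.
Qed.

Section Dismantle.
Variables (o : T) (F : seq T).
Hypotheses (Vo : V o) (FV : forall x, x \in F -> V x).

Definition wide (C u : T) : Prop :=
  [/\ cone C, C <> o, C <> u & ~ angle_le C u o (2 * L)].

Lemma wide_between C u : V u -> wide C u -> d u C + d C o = d u o.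
Proof.
move=> Vu [cC Co Cu uCo]; apply: between_of_angle uCo => //; last lia.
  by move=> /esym.
by move=> /esym.
Qed.

(** If the angle at [C] between [y] and [u] exceeds [L], then [C] lies between them and inherits
    distance and angles from [u]. Otherwise [C] lies between [y] and [o]: the distance is bounded
    because [v] is farthest, and a large angle at some [E] between [y] and [C] would make [E] wide
    and farther from [o] than [C]. *)
Lemma dominated_by_cone v C u : v \in F -> (forall x, x \in F -> d x o <= d v o) ->
  u \in F -> wide C u -> d v o <= d C o + (2 * delta + 3) ->
  (forall E x, x \in F -> wide E x -> d E o <= d C o) ->
  forall y, y \in F -> rips y u -> rips y C.
Proof.
move=> vF vmax uF Cu vC Cmax y yF [Vy Vu yu ang].
have [cC Co Cu' uCo] := Cu; have VC := coneV cC.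
case: (pselect (y = C)) => [->|yC]; first by apply/rips_refl.
have uC : u <> C by move=> /esym.
have dCu := dist_gt0 VC Vu Cu'; have dyC := dist_gt0 Vy VC yC.
have dCo := dist_gt0 VC Vo Co.
have oC : o <> C by move=> /esym.
case: (pselect (angle_le C y u L)) => yCu; last first.
  have yCuE := between_of_angle cC Vy Vu yC uC (leqnn L) yCu.
  split=> //; first lia.
  move=> E cE Ey EC; have VE := coneV cE.
  have yE : y <> E by move=> /esym. have CE : C <> E by move=> /esym.
  case: (ltnP (d y C) (d y E + d E C)) => [lt|yEC].
    by apply: (@angle_le_mono _ _ _ L); [lia | exact: angle_le_small].
  have Eu : E <> u by move=> Eu; move: yEC; rewrite Eu; have := distC Vu VC; lia.
  apply: (@angle_le_between _ u) => //; last exact: ang.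
  have := dist_triangle Vu VC VE; have := dist_triangle Vy VE Vu.
  have := distC Vu VC; have := distC VE VC; have := distC Vu VE; lia.
have yCo : ~ angle_le C y o L.
  move=> yCo; apply: uCo; apply: (@angle_le_mono _ _ _ (L + L)); first lia.
  by apply: (@angle_le_trans _ _ y) => //; exact: angle_le_sym.
have yCoE := between_of_angle cC Vy Vo yC oC (leqnn L) yCo.
split=> //; first by have := vmax _ yF; lia.
move=> E cE Ey EC; have VE := coneV cE.
have yE : y <> E by move=> /esym. have CE : C <> E by move=> /esym.
case: (ltnP (d y C) (d y E + d E C)) => [lt|yEC].
  by apply: (@angle_le_mono _ _ _ L); [lia | exact: angle_le_small].
have EoE : d E C + d C o = d E o.
  by have := dist_triangle VE VC Vo; have := dist_triangle Vy VE Vo; lia.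
have dEC := dist_gt0 VE VC EC.
have Eo : E <> o by move=> Eo; move: EoE; rewrite Eo distxx; lia.
apply: (@angle_le_between _ o) => //.
  by have := distC VE Vo; have := distC VE VC; have := distC Vo VC; lia.
apply: contrapT => yEo.
have : wide E y.
  by split=> // yEo2; apply: yEo; apply: angle_le_mono yEo2; lia.
by move=> /(Cmax _ _ yF); lia.
Qed.

(** The four-point inequality bounds the distance. For a cone vertex [B] other than [v] and [o], the
    critical angle is estimated through [o] by [2 * L + L] if [B] is not wide for [u]. If it is
    wide, then [B] is far from [v], and the angles of [v] with [u] and with [v'] are at most [L]. *)
Lemma dominated_on_geodesic v v' : v \in F -> (forall x, x \in F -> d x o <= d v o) ->
  2 * delta + 3 < d v o ->
  (forall E x, x \in F -> wide E x -> d E o + (2 * delta + 3) < d v o) ->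
  V v' -> d v v' + d v' o = d v o -> delta < d v v' <= delta.+2 ->
  forall y, y \in F -> rips y v -> rips y v'.
Proof.
move=> vF vmax vo Fwide Vv' vv'o vv' u uF [Vu Vv uv ang].
split=> //.
  by have := hyp Vu Vv' Vv Vo; have := vmax _ uF; have := distC Vv' Vv; lia.
move=> B cB Bu Bv'; have VB := coneV cB.
have uB : u <> B by move=> /esym. have v'B : v' <> B by move=> /esym.
case: (ltnP (d u v') (d u B + d B v')) => [lt|uBv'].
  by apply: (@angle_le_mono _ _ _ L); [lia | exact: angle_le_small].
have v'o : v' <> o by move=> v'o; move: vv'; rewrite v'o; lia.
have vC := distC Vv Vv'.
case: (pselect (B = v)) => [Bv|Bv].
  have ov : o <> B by move=> oB; move: vo; rewrite -Bv oB distxx.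
  apply: (@angle_le_mono _ _ _ (L + L)); first lia.
  apply: (@angle_le_trans _ _ o) => //.
    (* If [v] were between [u] and [o], then [u] would be farther from [o] than [v]. *)
    apply: contrapT => /(between_of_angle cB Vu Vo uB ov (leqnn L)).
    by have := dist_gt0 Vu VB uB; rewrite Bv; have := vmax _ uF; lia.
  apply: angle_le_small => //; rewrite Bv.
  by have := distC Vv Vo; have := distC Vv' Vo; lia.
case: (pselect (B = o)) => [Bo|Bo].
  apply: (@angle_le_between _ v) => //; last exact: ang.
  by rewrite Bo.
have vB : v <> B by move=> /esym. have oB : o <> B by move=> /esym.
case: (pselect (angle_le B v' o L)) => v'Bo; last first.
  (* Here [B] lies beyond [v'] on the way from [v] to [o], so that the entrances of [v'] at [B] are
     entrances of [v]. *)
  have v'BoE := between_of_angle cB Vv' Vo v'B oB (leqnn L) v'Bo.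
  apply: (@angle_le_between _ v) => //; last exact: ang.
  by have := dist_triangle Vv Vv' VB; have := dist_triangle Vv VB Vo; lia.
case: (pselect (angle_le B u o (2 * L))) => uBo.
  apply: (@angle_le_mono _ _ _ (2 * L + L)); first lia.
  by apply: (@angle_le_trans _ _ o) => //; exact: angle_le_sym.
have /(Fwide _ _ uF) Bfar : wide B u by [].
have Bnear := dist_triangle Vv VB Vo.
case: (pselect (angle_le B u v L)) => uBv; last first.
  have := between_of_angle cB Vu Vv uB vB (leqnn L) uBv.
  by have := distC Vv VB; lia.
case: (pselect (angle_le B v v' L)) => vBv'; last first.
  have := between_of_angle cB Vv Vv' vB v'B (leqnn L) vBv'; lia.
apply: (@angle_le_mono _ _ _ (L + L)); first lia.
exact: (@angle_le_trans _ _ v).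
Qed.

(** Wide cone vertices near the level of the farthest vertex [v] come first, and the farthest of
    them is used. Only in their absence does moving [v] along a geodesic keep the angles bounded. *)
Lemma dismantle_step : (forall x, x \in F -> rips x o) \/
  exists u u', [/\ u \in F, d u' o < d u o, V u' &
    forall y, y \in F -> rips y u -> rips y u'].
Proof.
case: (pselect (exists v, v \in F)) => [[v0 v0F]|F0]; last first.
  by left=> x xF; case: F0; exists x.
have [v vF vmax] : exists2 v, v \in F & forall x, x \in F -> d x o <= d v o.
  have : exists n, `[< exists2 v, v \in F & d v o = n >].
    by exists (d v0 o); apply/asboolP; exists v0.
  have bound n : `[< exists2 v, v \in F & d v o = n >] -> n <= \max_(x <- F) d x o.
    by move=> /asboolP[x xF <-]; exact: leq_bigmax_seq.
  move=> ex; case: (ex_maxnP ex bound) => n /asboolP[v vF <-] nmax.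
  by exists v => // x xF; apply: nmax; apply/asboolP; exists x.
have Vv := FV vF.
case: (pselect (exists C u, [/\ u \in F, wide C u & d v o <= d C o + (2 * delta + 3)])).
  move=> [C0 [u0 [u0F C0u0 vC0]]].
  pose P n := `[< exists C u, [/\ u \in F, wide C u & d C o = n] >].
  have exP : exists n, P n by exists (d C0 o); apply/asboolP; exists C0, u0.
  have bound n : P n -> n <= d v o.
    move=> /asboolP[C [u [uF Cu <-]]]; have := wide_between (FV uF) Cu.
    by have := vmax _ uF; lia.
  case: (ex_maxnP exP bound) => n /asboolP[C [u [uF Cu Cn]]] nmax.
  have Cmax E x : x \in F -> wide E x -> d E o <= d C o.
    by move=> xF Ex; rewrite Cn; apply: nmax; apply/asboolP; exists E, x.
  have vC : d v o <= d C o + (2 * delta + 3) by have := Cmax _ _ u0F C0u0; lia.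
  right; exists u, C; have [cC Co Cu' _] := Cu; have VC := coneV cC; split=> //.
    have := wide_between (FV uF) Cu; have uC : u <> C by move=> /esym.
    by have := dist_gt0 (FV uF) VC uC; lia.
  exact: dominated_by_cone vmax uF Cu vC Cmax.
move=> nwide; have {nwide} Fwide E x : x \in F -> wide E x -> d E o + (2 * delta + 3) < d v o.
  by move=> xF Ex; rewrite ltnNge; apply/negP => vE; apply: nwide; exists E, x.
case: (leqP (d v o) (2 * delta + 3)) => vo.
  left=> x xF; have Vx := FV xF; split=> //; first by have := vmax _ xF; lia.
  move=> B cB Bx Bo; apply: (@angle_le_mono _ _ _ (2 * L)); first lia.
  apply: contrapT => xBo; have /(Fwide _ _ xF) : wide B x by [].
  by lia.
have [v' [Vv' vv'o vv']] : exists v', [/\ V v', d v v' + d v' o = d v o &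
    delta.+1 <= d v v' <= delta.+2] by apply: dist_point => //; lia.
right; exists v, v'; split=> //; first lia.
exact: dominated_on_geodesic vmax vo Fwide Vv' vv'o vv'.
Qed.

End Dismantle.
End Rips.
End Graph.

(** * The coned-off Cayley graph *)

Lemma pigeonhole (T : eqType) (f : nat -> T) (r : seq T) :
  (forall n, f n \in r) -> exists i j, i < j /\ f i = f j.
Proof.
move=> fr; have : ~~ uniq [seq f i | i <- iota 0 (size r).+1].
  apply/negP => u; suff : (size r).+1 <= size r by rewrite ltnn.
  rewrite -[X in X <= _](size_iota 0) -(size_map f).
  by apply: uniq_leq_size u _ => _ /mapP[i _ ->].
move=> /(uniqPn (f 0))[i [j [ij]]]; rewrite size_map size_iota => js.
rewrite !(nth_map 0) ?size_iota ?(ltn_trans ij) // !nth_iota ?(ltn_trans ij) // => fij.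
by exists (0 + i), (0 + j).
Qed.

(** * The word metric *)

Section WordMetric.
Variables (G : groupType) (S : seq G).
Hypothesis S_gen : generates S predT.

Local Notation e := (fun g h : G => cayley_adj S g h : Prop).
Local Notation one := (fun _ _ : G => 1).

Definition word_len (g h : G) : nat := dist e one g h.

Lemma cayley_adjC g h : cayley_adj S g h -> cayley_adj S h g.
Proof. by rewrite /cayley_adj eq_sym orbC. Qed.

Lemma cayley_adjJ x g h : cayley_adj S (x * g)%g (x * h)%g = cayley_adj S g h.
Proof.
rewrite /cayley_adj !invgM -!mulgA !mulKg; congr (~~ _ && _).
by apply/eqP/eqP => [/mulgI|->].
Qed.

Lemma word_walkJ x n g h : walk e one n g h -> walk e one n (x * g)%g (x * h)%g.
Proof.
elim=> [y|u v t k uv _ IH]; first exact: walk0.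
by apply: (walkS (w := one)) IH; rewrite cayley_adjJ.
Qed.

Lemma cayley_connected g h : exists n, walk e one n g h.
Proof.
suff conn1 x : exists n, walk e one n 1%g x.
  have [n /(word_walkJ g)] := conn1 (g^-1 * h)%g.
  by rewrite mulg1 mulVKg; exists n.
pose K : {pred G} := fun x => `[< exists n, walk e one n 1%g x >].
suff : x \in K by move=> /asboolP.
apply: S_gen => //; last first.
  move=> s sS; apply/asboolP; case: (eqVneq 1%g s) => [<-|s1]; first by exists 0; exact: walk0.
  by exists 1; apply: (walk1 one); rewrite /cayley_adj s1 invg1 mul1g sS.
split=> [|u v /asboolP[n nu] /asboolP[m mv]]; first by apply/asboolP; exists 0; exact: walk0.
apply/asboolP; have := word_walkJ (u * v^-1)%g mv.
rewrite mulg1 mulgVK => uv; exists (n + m); apply: walk_cat nu _.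
by apply: walk_rev uv => // ? ?; exact: cayley_adjC.
Qed.

Lemma word_geodesic g h : walk e one (word_len g h) g h.
Proof. by have [n] := cayley_connected g h; exact: dist_walk. Qed.

Lemma word_len_adj g h : cayley_adj S g h -> word_len g h <= 1.
Proof. by move=> gh; apply: dist_le; exact: (@walk1 _ e one g h gh). Qed.

Lemma word_lenC g h : word_len g h = word_len h g.
Proof.
have rev n x y : walk e one n x y -> walk e one n y x.
  by apply: walk_rev => // ? ?; exact: cayley_adjC.
by apply/eqP; rewrite eqn_leq !dist_le //; apply: rev; exact: word_geodesic.
Qed.

Lemma word_len_triangle g h k : word_len g k <= word_len g h + word_len h k.
Proof. by apply: dist_le; apply: walk_cat (word_geodesic g h) (word_geodesic h k). Qed.

Fixpoint word_ball (n : nat) : seq G :=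
  if n is m.+1 then
    word_ball m ++ [seq (x * s)%g | x <- word_ball m, s <- S ++ [seq s^-1%g | s <- S]]
  else [:: 1%g].

Lemma word_ball_mono n m : n <= m -> {subset word_ball n <= word_ball m}.
Proof.
move=> /subnK <-; elim: (m - n) => [//|k IH] x /IH xk.
by rewrite addSn /= mem_cat xk.
Qed.

Lemma word_ballP n g h : word_len g h <= n -> (g^-1 * h)%g \in word_ball n.
Proof.
move=> ghn; suff : (g^-1 * h)%g \in word_ball (word_len g h) by exact: word_ball_mono.
have rev : walk e one (word_len g h) h g.
  by apply: walk_rev (word_geodesic g h) => // ? ?; exact: cayley_adjC.
suff ball k x y : walk e one k x y -> (y^-1 * x)%g \in word_ball k by exact: ball.
elim=> {k x y} [x|x y z k xy _ IH]; first by rewrite mulVg mem_head.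
rewrite add1n [word_ball _]/= mem_cat; apply/orP; right.
apply/allpairsP; exists ((z^-1 * y)%g, (y^-1 * x)%g); split=> //=; last first.
  by rewrite -mulgA mulVKg.
rewrite mem_cat; move: xy => /andP[_ /orP[xyS|yxS]]; last by rewrite yxS.
by apply/orP; right; apply/mapP; exists (x^-1 * y)%g => //; rewrite invgM invgK.
Qed.

End WordMetric.

Section ConedGraph.
Variables (G : groupType) (S : seq G) (H : groupClosed G).
Hypothesis S_gen : generates S predT.
Local Notation W := (G + set G)%type.
Local Notation e := (coned_adj S H).

(* Lengths in the coned-off graph are doubled, so as to be integers. *)
Definition coned_wt (u v : W) : nat :=
  match u, v with inl _, inl _ => 2 | _, _ => 1 end.

Definition is_cone (w : W) : Prop := exists g, w = inr (lcoset_set H g).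
Definition is_vertex (w : W) : Prop := (exists g, w = inl g) \/ is_cone w.

Local Notation d := (dist e coned_wt).

Lemma lcoset_set_refl g : lcoset_set H g g.
Proof. by rewrite /lcoset_set /= /in_coset mulVg gpred1. Qed.

Lemma coned_adjC u v : e u v -> e v u.
Proof. by case: u v => [g|A] [h|B] //=; exact: cayley_adjC. Qed.

Lemma coned_adj_irrefl u : ~ e u u.
Proof. by case: u => [g|A] //=; rewrite /cayley_adj eqxx. Qed.

Lemma coned_wtC u v : coned_wt u v = coned_wt v u.
Proof. by case: u v => [g|A] [h|B]. Qed.

Lemma coned_wt_gt0 u v : 0 < coned_wt u v.
Proof. by case: u v => [g|A] [h|B]. Qed.

Lemma coned_wt_le2 u v : coned_wt u v <= 2.
Proof. by case: u v => [g|A] [h|B]. Qed.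

Lemma coned_adj_vertex u v : e u v -> is_vertex u.
Proof.
case: u v => [g|A] [h|B] //=; try by left; exists g.
by move=> ->; right; exists h.
Qed.

Lemma coned_walk_cayley n g h : walk (fun g h => cayley_adj S g h : Prop) (fun _ _ => 1) n g h ->
  walk e coned_wt n.*2 (inl g) (inl h).
Proof.
elim=> [x|x y z k xy _ IH]; first exact: walk0.
by rewrite add1n doubleS; apply: (@walkS _ _ coned_wt (inl x) (inl y)) IH.
Qed.

Lemma coned_connected u v : is_vertex u -> is_vertex v -> exists n, walk e coned_wt n u v.
Proof.
have to_group w : is_vertex w -> exists g n, walk e coned_wt n w (inl g).
  case=> [[g ->]|[g ->]]; exists g; first by exists 0; exact: walk0.
  by exists 1; exact: (@walk1 _ _ coned_wt (inr (lcoset_set H g)) (inl g)).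
move=> /to_group[g [n ug]] /to_group[h [m vh]].
have [k /coned_walk_cayley gh] := cayley_connected S_gen g h.
exists (n + (k.*2 + m)); apply: walk_cat ug _; apply: walk_cat gh _.
by apply: walk_rev vh; [exact: coned_adjC | exact: coned_wtC].
Qed.

Lemma cone_vertex B : is_cone B -> is_vertex B. Proof. by right. Qed.

Lemma cone_wt B x : is_cone B -> e x B -> coned_wt x B = 1.
Proof. by move=> [g ->]; case: x. Qed.

(** Angles are only measured between neighbours of a cone vertex, which are elements of [G]; the
    value 0 is a default. *)
Definition cone_angle (x y : W) : nat :=
  match x, y with inl a, inl b => word_len S a b | _, _ => 0 end.

Lemma cone_angleC x y : cone_angle x y = cone_angle y x.
Proof. by case: x y => [a|A] [b|B] //=; exact: word_lenC. Qed.

Lemma cone_nbr B x : is_cone B -> e x B -> exists2 a, x = inl a & B = inr (lcoset_set H a).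
Proof. by move=> [g ->]; case: x => [a|A] //= ->; exists a. Qed.

Lemma cone_angle_triangle B x y z : is_cone B -> e x B -> e y B -> e z B ->
  cone_angle x z <= cone_angle x y + cone_angle y z.
Proof.
move=> cB /(cone_nbr cB)[a -> _] /(cone_nbr cB)[b -> _] /(cone_nbr cB)[c -> _].
exact: word_len_triangle.
Qed.

Lemma coned_adjJ g u v : e u v -> e (vact g u) (vact g v).
Proof.
case: u v => [x|A] [y|B] //=; first by rewrite cayley_adjJ.
  by move=> ->; rewrite ltrans_lcoset.
by move=> ->; rewrite ltrans_lcoset.
Qed.

Lemma coned_wtJ g u v : coned_wt (vact g u) (vact g v) = coned_wt u v.
Proof. by case: u v => [x|A] [y|B]. Qed.

Lemma coned_walkJ g n u v : walk e coned_wt n u v -> walk e coned_wt n (vact g u) (vact g v).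
Proof.
elim=> [x|x y z k xy _ IH]; first exact: walk0.
by rewrite -(coned_wtJ g); apply: walkS IH; exact: coned_adjJ.
Qed.

Lemma is_coneJ g w : is_cone w -> is_cone (vact g w).
Proof. by move=> [x ->]; exists (g * x)%g; rewrite /= ltrans_lcoset. Qed.

Lemma is_vertexJ g w : is_vertex w -> is_vertex (vact g w).
Proof. by case=> [[x ->]|/(is_coneJ g)]; [left; exists (g * x)%g | right]. Qed.

Lemma vactK (g : G) : cancel (vact g) (vact g^-1%g).
Proof. exact: (actK (@vact1 G) (@vactM G)). Qed.

Lemma vactVK (g : G) : cancel (vact g^-1%g) (vact g).
Proof. exact: (actVK (@vact1 G) (@vactM G)). Qed.

Local Notation geo := (geodesic coned_connected).

Lemma coned_distC (u v : W) : is_vertex u -> is_vertex v -> d u v = d v u.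
Proof. exact: (distC coned_adjC coned_wtC coned_connected). Qed.

Lemma coned_triangle (u v x : W) : is_vertex u -> is_vertex v -> is_vertex x ->
  d u x <= d u v + d v x.
Proof. exact: (dist_triangle coned_connected). Qed.

Lemma coned_dist_adj (u v : W) : e u v -> d u v <= coned_wt u v.
Proof. by move=> uv; apply: dist_le; exact: walk1. Qed.

Lemma coned_distJ g u v : is_vertex u -> is_vertex v -> d (vact g u) (vact g v) = d u v.
Proof.
move=> Vu Vv; apply/eqP; rewrite eqn_leq !dist_le //.
  rewrite -{2}(vactK g u) -{2}(vactK g v); apply: coned_walkJ.
  by apply: geo; exact: is_vertexJ.
by apply: coned_walkJ; exact: geo.
Qed.

Lemma word_lenJ g x y : word_len S (g * x)%g (g * y)%g = word_len S x y.
Proof.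
apply/eqP; rewrite eqn_leq !dist_le //; last by apply: word_walkJ; exact: word_geodesic.
by have := word_walkJ g^-1%g (word_geodesic S_gen (g * x) (g * y)%g); rewrite !mulKg.
Qed.

Lemma cone_angleJ g x y : cone_angle (vact g x) (vact g y) = cone_angle x y.
Proof. by case: x y => [x|A] [y|B] //=; exact: word_lenJ. Qed.

(** * Size and stabilizers of the cliques *)

Variables (delta L : nat).
Hypothesis hyp : forall x y z t, is_vertex x -> is_vertex y -> is_vertex z -> is_vertex t ->
  d x y + d z t <= maxn (d x z + d y t) (d x t + d y z) + delta.
Hypothesis fine : forall B a b n, is_cone B -> e a B -> e b B ->
  n <= 16 * delta + 32 -> walk (avoiding e B) coned_wt n a b -> cone_angle a b <= L.

Local Notation adj := (rips e coned_wt is_vertex delta is_cone cone_angle L).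
Local Notation entr := (entrance e coned_wt).

Lemma entranceJ g B u a : is_cone B -> is_vertex u -> entr B u a ->
  entr (vact g B) (vact g u) (vact g a).
Proof.
move=> cB Vu [aB aE]; have Va := coned_adj_vertex aB.
by split; [exact: coned_adjJ | rewrite !coned_distJ //; exact: cone_vertex].
Qed.

Lemma ripsJ g u v : adj u v -> adj (vact g u) (vact g v).
Proof.
move=> [Vu Vv uv ang]; split; [exact: is_vertexJ|exact: is_vertexJ|by rewrite coned_distJ|].
move=> B cB Bu Bv a b ua vb.
have cB' := is_coneJ g^-1%g cB.
have back w x : is_vertex w -> entr B (vact g w) x -> entr (vact g^-1%g B) w (vact g^-1%g x).
  by move=> Vw h; rewrite -[w](vactK g); apply: entranceJ => //; exact: is_vertexJ.
rewrite -(cone_angleJ g^-1%g); apply: ang cB' _ _ _ _ (back _ _ Vu ua) (back _ _ Vv vb).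
  by move=> Bu'; apply: Bu; rewrite -Bu' vactVK.
by move=> Bv'; apply: Bv; rewrite -Bv' vactVK.
Qed.

Lemma first_step (x v : W) : is_vertex x -> is_vertex v -> x <> v ->
  exists2 y, e x y & coned_wt x y + d y v = d x v.
Proof.
move=> Vx Vv xv; have := geo Vx Vv; move: (d x v) (fun n => @dist_le _ e coned_wt x v n) => n min h.
case: h min xv Vx Vv => // x' y z k xy yz min xz Vx Vz; exists y => //.
have Vy : is_vertex y by exact: coned_adj_vertex (coned_adjC xy).
have := min _ (walkS xy (geo Vy Vz)); have := dist_le yz; move: (d y z) (coned_wt x' y) => p q; lia.
Qed.

Definition spanned_by (v : W) (y : G) : Prop :=
  v = inl y \/ v = inr (lcoset_set H y).

(** A geodesic from [x] to [v] is followed two units at a time. A Cayley edge costs 1 in the word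
    metric; a passage through a cone vertex leads from an entrance of [u] to an entrance of [v], and
    costs at most [3 * L] by adjacency. *)
Lemma rips_reach (u v : W) : adj u v -> forall n x, d (inl x) v <= n ->
  d u (inl x) + d (inl x) v = d u v ->
  exists2 y, spanned_by v y & word_len S x y <= n * (3 * L + 1).
Proof.
move=> uv; have [Vu Vv _ ang] := uv.
have Vl x : is_vertex (inl x) by left; exists x.
elim/ltn_ind=> n IH x xn uxv.
case: (pselect (inl x = v)) => [xv|xv].
  by exists x; [left | rewrite /word_len distxx].
have [y xy yE] := first_step (Vl x) Vv xv.
have Vy : is_vertex y := coned_adj_vertex (coned_adjC xy).
have tri := coned_triangle.
have dC := coned_distC.
case: y xy yE Vy => [z|A] xy /= yE Vy.
  have lt : n - 2 < n by lia.
  have [||z' vz' zz'] := IH _ lt z.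
  - lia.
  - have := tri u (inl z) v Vu Vy Vv; have := tri u (inl x) (inl z) Vu (Vl x) Vy.
    have := coned_dist_adj xy; rewrite /=; lia.
  exists z' => //; have := word_len_triangle S_gen x z z'.
  have := word_len_adj xy.
  have : (n - 2) * (3 * L + 1) + 2 * (3 * L + 1) = n * (3 * L + 1).
    by rewrite -mulnDl; congr (_ * _); lia.
  lia.
have cA : is_cone (inr A) by exists x; rewrite xy.
case: (pselect (inr A = v)) => [Av|Av].
  exists x; first by right; rewrite -Av xy.
  by rewrite /word_len distxx.
have [y Ay yE'] := first_step Vy Vv Av.
have [z zE Az] := cone_nbr cA (coned_adjC Ay).
subst y.
have Vz := Vl z; have d1 := coned_dist_adj Ay.
have d2 := coned_dist_adj (xy : e (inl x) (inr A)).
rewrite /= in yE' d1 d2.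
have t1 := tri u (inl x) (inr A) Vu (Vl x) Vy; have t2 := tri u (inr A) v Vu Vy Vv.
have t3 := tri u (inr A) (inl z) Vu Vy Vz; have t4 := tri u (inl z) v Vu Vz Vv.
have uA : u <> inr A.
  move=> uA; move: uxv; rewrite uA; move: yE.
  by move: (d (inr A) v) (d (inl x) v) (d (inr A) (inl x)); lia.
have lt : n - 2 < n by lia.
have [||z' vz' zz'] := IH _ lt z.
- lia.
- lia.
exists z' => //; have := word_len_triangle S_gen x z z'.
have : word_len S x z <= 3 * L.
  have E1 : d u (inl x) + 1 = d u (inr A) by lia.
  have E2 : d v (inl z) + 1 = d v (inr A).
    by have := dC _ _ Vv Vz; have := dC _ _ Vv Vy; lia.
  have ent1 : entr (inr A) u (inl x) by [].
  have ent2 : entr (inr A) v (inl z).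
    by split=> //; exact: coned_adjC.
  apply: (ang _ cA _ _ _ _ ent1 ent2) => //.
  by move=> /esym.
have : (n - 2) * (3 * L + 1) + 2 * (3 * L + 1) = n * (3 * L + 1).
    by rewrite -mulnDl; congr (_ * _); lia.
lia.
Qed.

Definition reach : nat := (2 * delta + 3) * (3 * L + 1).
(** One vertex of the clique counts for 1; the others are elements of a translated ball or cosets of
    such elements, hence the factor 2. *)
Definition clique_max : nat := (size (word_ball S (3 * L + reach))).*2.+1.

Lemma rips_anchor (u v : W) x : adj u v -> u = inl x \/ (is_cone u /\ entr u v (inl x)) ->
  exists2 y, spanned_by v y & word_len S x y <= reach.
Proof.
move=> uv; have [Vu Vv uvD _] := uv; have Vx : is_vertex (inl x) by left; exists x.
have dC := coned_distC.
case=> [ux|[cu [xu xE]]].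
  by apply: (@rips_reach u v uv (2 * delta + 3) x); rewrite -ux // distxx.
have d1 : d (inl x) u <= 1 by rewrite -(cone_wt cu xu); exact: coned_dist_adj xu.
have t := coned_triangle Vu Vx Vv.
have := dC _ _ Vu Vx; have := dC _ _ Vx Vv; have := dC _ _ Vu Vv => h1 h2 h3.
have {}xE : d v (inl x) + 1 = d v u := xE.
have {}uvD : d u v <= 2 * delta + 3 := uvD.
by apply: (@rips_reach u v uv (2 * delta + 3) x); lia.
Qed.

(** One element [x0] serves for all vertices other than [u]. When [u] is a cone vertex, [x0] is the
    entrance of one of them at [u], and the others enter at most [3 * L] away because they are
    adjacent to that one. *)
Lemma rips_clique_bound k s : clique adj k s -> uniq s -> k <= clique_max.
Proof.
move=> [<- {k}]; case: s => [//|u [|v0 t]] //= sc /andP[us ut].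
rewrite ltnS; set t' := v0 :: t in us *.
have adj_u v : v \in t' -> adj u v.
  by move=> vt; apply: sc; [exact: mem_head | rewrite inE vt orbT].
have Vu : is_vertex u by have [] := adj_u v0 (mem_head _ _).
have [x0 x0P] : exists x0, forall v, v \in t' ->
    exists2 x, u = inl x \/ (is_cone u /\ entr u v (inl x)) & word_len S x0 x <= 3 * L.
  case: (Vu) => [[g ug]|cu].
    by exists g => v _; exists g; [left | rewrite /word_len distxx].
  have out v : v \in t' -> v <> u by move=> vt vu; move: us; rewrite -vu vt.
  have ent v : v \in t' -> exists x, entr u v (inl x).
    move=> vt; have [_ Vv _ _] := adj_u v vt.
    have [a] := entrance_exists coned_adjC coned_wtC coned_adj_vertex
      coned_connected cone_vertex cone_wt cu Vv (out v vt).
    by move=> av; have [x ax _] := cone_nbr cu av.1; exists x; rewrite -ax.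
  have [x0 x0E] := ent v0 (mem_head _ _); exists x0 => v vt.
  have [x xE] := ent v vt; exists x; first by right.
  have [_ _ _ ang] : adj v0 v by apply: sc; rewrite inE ?vt ?mem_head orbT.
  apply: (ang u cu _ _ _ _ x0E xE) => /esym; apply: out => //; exact: mem_head.
set ball := word_ball S (3 * L + reach).
pose cands : seq W := [seq inl (x0 * b)%g | b <- ball] ++
  [seq inr (lcoset_set H (x0 * b)%g) | b <- ball].
have t'c : {subset t' <= cands}.
  move=> v vt; have [x xE x0x] := x0P v vt.
  have [y vy xy] := rips_anchor (adj_u v vt) xE.
  have yb : (x0^-1 * y)%g \in ball.
    apply: word_ballP => //; have := word_len_triangle S_gen x0 x y; lia.
  rewrite mem_cat; apply/orP; case: vy => ->; [left|right]; apply/mapP;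
    by exists (x0^-1 * y)%g; rewrite ?mulVKg.
have := uniq_leq_size _ t'c; rewrite size_cat !size_map addnn; apply.
exact: ut.
Qed.

Hypothesis torsion : torsion_free G.

Lemma finite_order_trivial (g : G) (r : seq G) : (forall n, (g ^+ n)%g \in r) -> g = 1%g.
Proof.
move=> /pigeonhole[i [j [ij gij]]]; apply: (torsion (n := j - i)); first by rewrite subn_gt0.
have : (g ^+ i * g ^+ (j - i) = g ^+ i * 1)%g by rewrite -expgnDr subnKC ?mulg1 // ltnW.
by move=> /mulgI.
Qed.

(** Only the case of a cone vertex [x] has content. The powers of [g] move an entrance of [y] at [x]
    to other such entrances, which are at most [L] apart and so finite in number; hence [g] has
    finite order. *)
Lemma pair_stabilizer (g : G) (x y : W) : is_vertex x -> is_vertex y -> x <> y ->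
  vact g x = x -> vact g y = y -> g = 1%g.
Proof.
move=> Vx Vy xy gx gy.
have fix_inl (a : G) : vact g (inl a) = inl a -> g = 1%g.
  by move=> [ga]; rewrite -[g](mulgK a) ga mulgV.
case: (Vx) gx => [[a ->]|cx gx]; first exact: fix_inl.
have yx : y <> x by move=> /esym.
have [a [ax aE]] := entrance_exists coned_adjC coned_wtC coned_adj_vertex coned_connected
  cone_vertex cone_wt cx Vy yx.
have [a' aa' _] := cone_nbr cx ax; subst a; rename a' into a.
have fixn n w : vact g w = w -> vact (g ^+ n)%g w = w.
  by move=> gw; elim: n => [|n IH]; rewrite ?vact1 // expgS vactM IH.
apply: (@finite_order_trivial g [seq (a * b * a^-1)%g | b <- word_ball S L]) => n.
have ent : entr x y (inl (g ^+ n * a)%g).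
  have := entranceJ (g ^+ n)%g cx Vy (conj ax aE : entr x y (inl a)).
  by rewrite (fixn n x gx) (fixn n y gy).
have small : angle_le e coned_wt cone_angle x y y L.
  apply: (angle_le_small coned_adjC coned_wtC coned_wt_gt0 coned_wt_le2 coned_adj_vertex
    coned_connected hyp cone_vertex cone_wt fine coned_adj_irrefl) => //.
  by rewrite distxx; have := dist_gt0 coned_wt_gt0 coned_connected Vy Vx yx; lia.
have /(word_ballP S_gen) : word_len S a (g ^+ n * a)%g <= L.
  exact: (small (inl a) _ (conj ax aE) ent).
move=> ab; apply/mapP; exists (a^-1 * (g ^+ n * a))%g => //.
by rewrite mulVKg mulgK.
Qed.

(** Some positive power of [g] fixes each vertex of the clique, hence is trivial by
    [pair_stabilizer]; torsion-freeness concludes. *)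
Lemma rips_clique_free (g : G) k (s : seq W) : clique adj k.+2 s -> uniq s ->
  perm_eq [seq vact g x | x <- s] s -> g = 1%g.
Proof.
move=> [sk sc] us gs.
have gsn n : [seq vact (g ^+ n)%g x | x <- s] \in permutations s.
  rewrite mem_permutations; elim: n => [|n IH].
    by rewrite (_ : [seq _ | x <- s] = s) // -[RHS]map_id; apply: eq_map => x; exact: vact1.
  rewrite (_ : [seq _ | x <- s] =
    [seq vact g x | x <- [seq vact (g ^+ n)%g x | x <- s]]); last first.
    by rewrite -map_comp; apply: eq_map => x /=; rewrite expgS vactM.
  by apply: perm_trans gs; exact: perm_map.
have [i [j [ij gij]]] := pigeonhole gsn.
apply: (torsion (n := j - i)); first by rewrite subn_gt0.
have fixs x : x \in s -> vact (g ^+ (j - i))%g x = x.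
  move=> xs; apply: (can_inj (vactK (g ^+ i)%g)); rewrite -vactM -expgnDr subnKC; last exact: ltnW.
  have /eq_in_map h := gij; exact/esym/h.
case: s sk sc us fixs {gs gsn gij} => [//|x [//|y s]] _ sc /= /andP[xys _] fixs.
have [Vx Vy _ _] : adj x y by apply: sc; rewrite !inE eqxx ?orbT.
apply: (@pair_stabilizer _ x y Vx Vy); first by move=> xy; move: xys; rewrite xy mem_head.
  by apply: fixs; rewrite mem_head.
by apply: fixs; rewrite !inE eqxx orbT.
Qed.

Theorem finite_cd_coned : finite_cd (subgroup_type H) -> finite_cd G.
Proof.
have Vo : is_vertex (inl 1%g) by left; exists 1%g.
apply: (@finite_cd_of_complex G H adj _ ripsJ _ (fun w => d w (inl 1%g)) _ clique_max
  rips_clique_bound rips_clique_free).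
- move=> u v; exact: (ripsC coned_adjC coned_wtC coned_connected cone_angleC).
- exact: (rips_refl coned_adjC coned_wtC coned_wt_gt0 coned_wt_le2 coned_adj_vertex
    coned_connected hyp cone_vertex cone_wt fine coned_adj_irrefl).
have refl := (rips_refl coned_adjC coned_wtC coned_wt_gt0 coned_wt_le2 coned_adj_vertex
    coned_connected hyp cone_vertex cone_wt fine coned_adj_irrefl).
move=> F FV; have FV' x : x \in F -> is_vertex x by move=> /FV/refl.
have [Fo|[u [u' [uF u'u Vu' Fu]]]] := dismantle_step coned_adjC coned_wtC coned_wt_gt0
  coned_wt_le2 coned_adj_vertex coned_connected hyp cone_vertex cone_wt cone_angleC
  cone_angle_triangle fine coned_adj_irrefl Vo FV'.
  by left; exists (inl 1%g) => //; apply/refl.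
by right; exists u, u'; split=> //; apply/refl.
Qed.

End ConedGraph.

(** * Geometric realizations *)

Local Open Scope classical_set_scope.
Local Open Scope ring_scope.

Section Realization.
Variables (R : realType) (T : choiceType) (a : T -> T -> Prop) (l : T -> T -> R).
Local Notation X := (MetricGraph a l).
Hypothesis l_ge0 : forall u v, a u v -> 0 <= l u v.

(** The affine extension of [phi] to the realization, in barycentric coordinates. Lipschitz
    functions give lower bounds for [path_dist], while paths only give upper bounds. *)
Definition affine (phi : T -> R) (x : T -> R) : R := fsum (fun v => x v * phi v).

Lemma affine_bary phi u v t :
  affine phi (bary (X := X) u v t) = (1 - t) * phi u + t * phi v.
Proof.
rewrite /affine /bary; case: (eqVneq u v) => [->|uv].
  rewrite (@fsum1 _ _ _ v) => [|w wv]; first by rewrite asboolT //=; ring.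
  by rewrite asboolF ?mulr0 ?addr0 ?mul0r //; exact/eqP.
rewrite (@fsumE _ _ [:: u; v]); first last.
- move=> w; rewrite !inE; case: (eqVneq w u) => //= wu; case: (eqVneq w v) => //= wv.
  by rewrite !asboolF ?mulr0 ?addr0 ?mul0r ?eqxx //; exact/eqP.
- by rewrite /= inE uv.
have vu : v <> u by move=> vu; rewrite vu eqxx in uv.
rewrite !big_cons big_nil !(asboolT (erefl _)) (asboolF vu) asboolF; last exact/eqP.
by rewrite /=; ring.
Qed.

Definition lipschitz (phi : T -> R) : Prop :=
  forall u v, a u v -> `|phi u - phi v| <= l u v.

Lemma joined_affine phi x y c : lipschitz phi -> joined (X := X) x y c ->
  `|affine phi x - affine phi y| <= c.
Proof.
move=> phiL; elim=> {x y c} [x|u v s t y c uv s01 t01 _ IH]; first by rewrite subrr normr0.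
apply: le_trans (ler_distD (affine phi (bary (X := X) u v t)) _ _) _.
apply: lerD => //; rewrite !affine_bary.
have -> : (1 - s) * phi u + s * phi v - ((1 - t) * phi u + t * phi v) =
  (s - t) * (phi v - phi u) by ring.
by rewrite normrM mulrC distrC; apply: ler_wpM2r => //; exact: phiL.
Qed.

Lemma joined_ge0 x y c : joined (X := X) x y c -> 0 <= c.
Proof.
elim=> {x y c} [x|u v s t y c uv _ _ _ IH] //.
by rewrite addr_ge0 // mulr_ge0 //; exact: l_ge0.
Qed.

Lemma path_dist_le x y c : joined (X := X) x y c -> path_dist X x y <= c.
Proof.
by move=> xy; apply: ge_inf => //; exists 0 => z; exact: joined_ge0.
Qed.

(** Some path has to exist, since the infimum of the empty set is 0 by convention. *)
Lemma path_dist_ge x y c c0 : joined (X := X) x y c0 ->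
  (forall c', joined (X := X) x y c' -> c <= c') -> c <= path_dist X x y.
Proof. by move=> xy h; apply: lb_le_inf; [exists c0 | exact: h]. Qed.

Lemma path_dist_affine phi x y c : lipschitz phi -> joined (X := X) x y c ->
  `|affine phi x - affine phi y| <= path_dist X x y.
Proof. by move=> phiL xy; apply: path_dist_ge xy _ => c'; exact: joined_affine. Qed.

Lemma vpointE u v : vpoint X u = bary u v 0.
Proof. by apply/funext => w; rewrite /vpoint /bary; ring. Qed.

Lemma bary1 u v : bary (X := X) u v 1 = vpoint X v.
Proof. by apply/funext => w; rewrite /vpoint /bary; ring. Qed.

Lemma affine_vpoint phi u : affine phi (vpoint X u) = phi u.
Proof. by rewrite /vpoint affine_bary; ring. Qed.

Lemma joined_trans x y z c c' : joined (X := X) x y c -> joined (X := X) y z c' ->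
  joined (X := X) x z (c + c').
Proof.
move=> xy; elim: xy z c' => {x y c} [x|u v s t y c uv s01 t01 _ IH] z c' yz; first by rewrite add0r.
by rewrite -addrA; apply: joined_step => //; exact: IH.
Qed.

Lemma joined_edge u v (s t : R) : a u v -> 0 <= s <= 1 -> 0 <= t <= 1 ->
  joined (X := X) (bary (X := X) u v s) (bary (X := X) u v t) (l u v * `|s - t|).
Proof.
move=> uv s01 t01; rewrite -[_ * _]addr0.
exact: (joined_step (X := X)) uv s01 t01 (joined_refl _).
Qed.

Lemma joined_sym x y c : joined (X := X) x y c -> joined (X := X) y x c.
Proof.
elim=> {x y c} [x|u v s t y c uv s01 t01 _ IH]; first exact: joined_refl.
by rewrite addrC distrC; apply: joined_trans IH _; exact: joined_edge.
Qed.

Section Vertices.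
Variables (w : T -> T -> nat) (k : R).
Hypotheses (lw : forall u v, l u v = k * (w u v)%:R) (k_ge0 : 0 <= k).
Hypotheses (aC : forall u v, a u v -> a v u) (wC : forall u v, w u v = w v u).

Lemma joined_walk n u v : walk a w n u v ->
  joined (X := X) (vpoint X u) (vpoint X v) (k * n%:R).
Proof.
elim=> [x|x y z m xy _ IH]; first by rewrite mulr0; exact: joined_refl.
have := @joined_edge x y 0 1 xy; rewrite bary1 -vpointE sub0r normrN1 mulr1.
rewrite natrD mulrDr -lw => j; apply: joined_trans (j _ _) IH; by rewrite lexx ler01.
Qed.

Lemma dist_lipschitz u0 : lipschitz (fun v => k * (dist a w u0 v)%:R).
Proof.
(* Outside the component of [u0] both distances are 0 by convention. *)
have le1 x y : a x y -> (dist a w u0 y <= dist a w u0 x + w x y)%N.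
  move=> xy; case: (pselect (exists n, walk a w n u0 x)) => [[n u0x]|nx].
    by apply/dist_le/(walk_cat (dist_walk u0x))/walk1.
  case: (pselect (connected a w u0 y)) => [[n /asboolP u0y]|nc].
    by case: nx; exists (n + w y x)%N; apply: walk_cat u0y _; exact/walk1/aC.
  by rewrite {1}/dist; case: pselect.
move=> u v uv; rewrite -mulrBr normrM ger0_norm // lw; apply: ler_wpM2l => //.
have := le1 _ _ uv; have := le1 _ _ (aC uv); rewrite (wC v u).
rewrite -!(ler_nat R) !natrD ler_norml; lra.
Qed.

Lemma path_dist_vertex n u v : walk a w n u v ->
  path_dist X (vpoint X u) (vpoint X v) = k * (dist a w u v)%:R.
Proof.
move=> uv; have j := joined_walk (dist_walk uv); apply/le_anti/andP; split.
  exact: path_dist_le j.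
have := path_dist_affine (dist_lipschitz u) j.
rewrite !affine_vpoint distxx mulr0 sub0r normrN ger0_norm ?mulr_ge0 //.
Qed.

End Vertices.

(** * Paths parametrized by arc length *)

Fixpoint edge_path (u : T) (p : seq T) : Prop :=
  if p is v :: p' then a u v /\ edge_path v p' else True.

Hypothesis l_gt0 : forall u v, a u v -> 0 < l u v.

Lemma arclength_point0 u p : edge_path u p -> arclength_point X u p 0 = vpoint X u.
Proof.
case: p => [//|v p] /= [uv _].
by rewrite l_ge0 // mul0r -vpointE.
Qed.

Lemma arclength_joined u p t t' : edge_path u p -> 0 <= t -> t <= t' ->
  t' <= path_length X u p ->
  joined (X := X) (arclength_point X u p t) (arclength_point X u p t') (t' - t).
Proof.
elim: p u t t' => [|v p IH] u t t' /=.
  move=> _ t0 tt' t'0; have -> : t' = t by lra.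
  by rewrite subrr; exact: joined_refl.
move=> [uv vp] t0 tt' t'l; have l0 := l_gt0 uv.
have frac s : 0 <= s -> s <= l u v -> 0 <= s / l u v <= 1.
  by move=> s0 sl; rewrite divr_ge0 ?(ltW l0) //= ler_pdivrMr // mul1r.
case: (leP t (l u v)) => tl; case: (leP t' (l u v)) => t'l'; last 2 first.
- by lra.
- have := IH v (t - l u v) (t' - l u v) vp; rewrite (_ : _ - _ - _ = t' - t); last by ring.
  by apply; lra.
- rewrite (_ : t' - t = l u v * `|t / l u v - t' / l u v|).
    by apply: joined_edge => //; apply: frac => //; lra.
  rewrite -mulrBl normrM distrC (ger0_norm (x := t' - t)) ?subr_ge0 //.
  by rewrite gtr0_norm ?invr_gt0 // mulrCA divff ?mulr1 // gt_eqF.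
- have -> : t' - t = l u v * `|t / l u v - 1| + (t' - l u v).
    rewrite ler0_norm ?subr_le0; last by have /andP[] := frac t t0 tl.
    rewrite opprB mulrBr mulr1 mulrCA divff ?gt_eqF //; ring.
  apply: joined_trans (joined_edge uv (frac _ t0 tl) _) _; first by rewrite ler01 lexx.
  rewrite bary1 -(arclength_point0 vp).
  have := IH v 0 (t' - l u v) vp; rewrite subr0; apply; lra.
Qed.

Fixpoint position (u : T) (p : seq T) (x : T) : R :=
  if x == u then 0 else if p is v :: p' then l u v + position v p' x else 0.

Lemma position_bounds u p x : edge_path u p -> 0 <= position u p x <= path_length X u p.
Proof.
elim: p u => [|v p IH] u /=; first by case: ifP; rewrite !lexx.
move=> [uv vp]; have l0 := l_gt0 uv; have := IH v vp.
by case: ifP => _ /andP[h1 h2]; apply/andP; split; lra.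
Qed.

Lemma affine_arclength phi u p t c k : edge_path u p -> uniq (u :: p) ->
  {in u :: p, forall x, phi x = c + k * position u p x} ->
  0 <= t <= path_length X u p -> affine phi (arclength_point X u p t) = c + k * t.
Proof.
elim: p u c t => [|v p IH] u c t.
  move=> _ _ phiE /= t0; rewrite affine_vpoint phiE ?mem_head //= eqxx; congr (_ + k * _); lra.
move=> [uv vp]; rewrite cons_uniq => /andP[uvp uvp'] phiE t0.
have l0 := l_gt0 uv.
have phiu : phi u = c by rewrite phiE ?mem_head //= eqxx mulr0 addr0.
have phi_tail : forall x, x \in v :: p -> phi x = c + k * l u v + k * position v p x.
  move=> x xp; rewrite phiE /=; last by rewrite in_cons xp orbT.
  by case: (eqVneq x u) => [xu|_]; [rewrite -xu xp in uvp | ring].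
have phi_v : phi v = c + k * l u v.
  by rewrite (phi_tail v (mem_head _ _)); case: (p) => [|? ?] /=; rewrite eqxx mulr0 addr0.
rewrite /=; case: (leP t (l u v)) => tl.
  rewrite affine_bary phiu phi_v; have := divfK (lt0r_neq0 l0) t.
  move: (t / l u v) => q <-; ring.
rewrite (IH v (c + k * l u v)) //; first by ring.
by move: t0; rewrite /= => /andP[h1 h2]; apply/andP; split; lra.
Qed.

(** Subpaths give the upper bound; the lower one comes from a Lipschitz function that grows linearly
    along the path, which exists because the path is simple. *)
Lemma arclength_bilipschitz u p (N : R) t t' : (forall x y, a x y -> 2^-1 <= l x y) ->
  edge_path u p -> uniq (u :: p) -> 1 <= N -> path_length X u p <= N ->
  0 <= t <= path_length X u p -> 0 <= t' <= path_length X u p ->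
  (2 * N)^-1 * `|t - t'| <=
    path_dist X (arclength_point X u p t) (arclength_point X u p t') <=
  2 * N * `|t - t'|.
Proof.
move=> l2 up uup N1 lN t0 t'0.
have j : joined (X := X) (arclength_point X u p t) (arclength_point X u p t') `|t - t'|.
  move: t0 t'0 => /andP[t0 tl] /andP[t'0 t'l]; case: (leP t t') => tt'.
    by rewrite ler0_norm ?subr_le0 // opprB; exact: arclength_joined.
  by rewrite gtr0_norm ?subr_gt0 //; apply/joined_sym/arclength_joined => //; exact: ltW.
apply/andP; split; last first.
  apply: le_trans (path_dist_le j) _; rewrite ler_peMl //; lra.
pose k : R := (2 * N)^-1.
have k0 : 0 < k by rewrite invr_gt0; lra.
have kN : k * (2 * N) = 1 by rewrite mulVf //; apply: lt0r_neq0; lra.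
(* The values lie in [[0, 1/2]] and all edges have length at least [1/2], so [phi] is Lipschitz even
   across edges that leave the path. *)
pose phi x := if x \in u :: p then k * position u p x else 0.
have phi_bounds x : 0 <= phi x <= 2^-1.
  rewrite /phi; case: ifP => _; last by rewrite lexx; lra.
  have /andP[p0 pl] := position_bounds x up; apply/andP; split; first by rewrite mulr_ge0 // ltW.
  apply: le_trans (_ : k * N <= _); last by lra.
  by apply: ler_wpM2l; [exact: ltW | exact: le_trans lN].
have phiL : lipschitz phi.
  move=> x y xy; apply: le_trans (l2 x y xy); rewrite ler_norml.
  by have := phi_bounds x; have := phi_bounds y; lra.
have phiE s : 0 <= s <= path_length X u p -> affine phi (arclength_point X u p s) = k * s.
  move=> s0; rewrite (@affine_arclength _ _ _ _ 0 k) ?add0r // => x xp.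
  by rewrite /phi xp add0r.
have := path_dist_affine phiL j; rewrite !phiE // -mulrBr normrM (gtr0_norm k0).
by [].
Qed.

End Realization.

(** * From penetration to fineness *)

Section Translation.
Variables (R : realType) (G : groupType) (S : seq G) (H : groupClosed G).
Hypothesis S_gen : generates S predT.
Local Notation W := (G + set G)%type.
Local Notation d := (dist (coned_adj S H) (@coned_wt G)).
Local Notation coned := (coned_graph R S H).

Lemma word_distE g h : word_dist R S g h = (word_len S g h)%:R.
Proof.
rewrite -[RHS]mul1r /word_dist.
apply: (@path_dist_vertex R G (fun g h => cayley_adj S g h) (fun _ _ => 1)
  _ (fun _ _ => 1%N) 1 _ _ _ _ _ _ _ (word_geodesic S_gen g h)) => //.
- by move=> u v; rewrite mul1r.
- by move=> u v; exact: cayley_adjC.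
Qed.

Lemma coned_lenE u v : coned_len R u v = 2^-1 * (@coned_wt G u v)%:R.
Proof. by case: u v => [g|A] [h|B] /=; rewrite ?mulr1 // mulVf // pnatr_eq0. Qed.

Lemma coned_len_ge0 u v : 0 <= @coned_len R G u v.
Proof. by rewrite coned_lenE mulr_ge0 // invr_ge0. Qed.

Lemma coned_path_dist u v : is_vertex H u -> is_vertex H v ->
  path_dist coned (vpoint coned u) (vpoint coned v) = 2^-1 * (d u v)%:R.
Proof.
move=> Vu Vv; have [n uv] := coned_connected S_gen Vu Vv.
apply: (@path_dist_vertex R W (coned_adj S H) (@coned_len R G)
  _ (@coned_wt G) 2^-1 _ _ _ _ _ _ _ uv).
- by move=> x y _; exact: coned_len_ge0.
- exact: coned_lenE.
- by rewrite invr_ge0.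
- exact: coned_adjC.
- exact: coned_wtC.
Qed.

Lemma realization_vertex u : is_vertex H u -> realization coned (vpoint coned u).
Proof.
have sub v : coned_adj S H u v -> realization coned (vpoint coned u).
  move=> uv; exists u, v, 0; split=> //; first by rewrite lexx ler01.
  by apply/funext => w; rewrite /vpoint /bary; ring.
case=> [[g ug]|[g ug]]; subst u.
  by apply: (sub (inr (lcoset_set H g))).
by apply: (sub (inl g)).
Qed.

Lemma four_point : weakly_rel_hyperbolic R S H -> exists delta : nat,
  forall x y z t, is_vertex H x -> is_vertex H y -> is_vertex H z -> is_vertex H t ->
  (d x y + d z t <= maxn (d x z + d y t) (d x t + d y z) + delta)%N.
Proof.
(* Gromov products halve and [d] doubles lengths, hence the factor 4. *)
move=> [delta hyp]; exists (Num.truncn (4 * `|delta|)).+1 => x y z t Vx Vy Vz Vt.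
have dC u v : is_vertex H u -> is_vertex H v -> d u v = d v u := @coned_distC _ _ _ S_gen u v.
have := hyp _ _ _ _ (realization_vertex Vt) (realization_vertex Vx)
  (realization_vertex Vz) (realization_vertex Vy).
rewrite /gromov_product !coned_path_dist //.
have : 4 * `|delta| < ((Num.truncn (4 * `|delta|)).+1)%:R :> R by apply: truncnS_gt.
set m := (Num.truncn (4 * `|delta|)).+1 => mdelta; have := ler_norm delta.
rewrite (dC y z) // -(ler_nat R) natrD natrD natr_max !natrD.
move: (d x z)%:R (d z t)%:R (d x t)%:R (d y t)%:R (d z y)%:R (d x y)%:R m%:R mdelta.
move=> p q r s u v M mdelta delta_le.
rewrite lerBlDr ge_min => /orP[h|h]; rewrite -lerBlDr le_max; apply/orP; [left|right]; lra.
Qed.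

Lemma in_cosetC g h : in_coset H g h = in_coset H h g.
Proof.
by rewrite /in_coset -[RHS]gpredV invgM invgK.
Qed.

Lemma in_coset_refl g : in_coset H g g.
Proof. by rewrite /in_coset mulVg gpred1. Qed.

Lemma in_coset_trans g h k : in_coset H g h -> in_coset H h k -> in_coset H g k.
Proof.
rewrite /in_coset => gh hk; have := gpredM _ _ gh hk.
by rewrite -mulgA mulVKg.
Qed.

Lemma lcoset_in g h : in_coset H g h -> lcoset_set H g = lcoset_set H h.
Proof. by move=> gh; apply/lcoset_setP. Qed.

Lemma in_lcoset g h : lcoset_set H g = lcoset_set H h -> in_coset H g h.
Proof. by move=> /lcoset_setP. Qed.

(* Walks made of edges of the Cayley graph and of jumps inside cosets; [jump_path]
   is the corresponding path of the coned-off graph, where a jump goes through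
   the cone vertex. *)
Definition jump (x y : G) : Prop := x <> y /\ (in_coset H x y \/ cayley_adj S x y).

Fixpoint jump_path (x : G) (q : seq G) : seq W :=
  if q is y :: q' then
    (if in_coset H x y then [:: inr (lcoset_set H y); inl y] else [:: inl y])
      ++ jump_path y q'
  else [::].

(** Keeping the vertices after [y] out of the coset of [x] ensures that no cone vertex is visited
    twice, so that [jump_path] is simple. *)
Fixpoint tight (x : G) (q : seq G) : Prop :=
  if q is y :: q' then
    [/\ jump x y, forall z, z \in q' -> ~~ in_coset H x z & tight y q']
  else True.

Lemma jump_path_inl x q z : inl z \in jump_path x q -> z \in q.
Proof.
elim: q x => [//|y q IH] x /=; rewrite mem_cat inE => /orP[|/IH->]; last by rewrite orbT.
by case: ifP => _; rewrite !inE /= => /eqP[->]; rewrite eqxx.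
Qed.

Lemma jump_path_inr x q A : inr A \in jump_path x q ->
  exists2 z, z \in q & A = lcoset_set H z.
Proof.
elim: q x => [//|y q IH] x /=; rewrite mem_cat => /orP[|/IH[z zq ->]]; last first.
  by exists z => //; rewrite inE zq orbT.
case: ifP => _; rewrite !inE /= ?orbF // => /eqP[->].
by exists y => //; exact: mem_head.
Qed.

Lemma tight_uniq x q : tight x q -> uniq (inl x :: jump_path x q).
Proof.
elim: q x => [//|y q IH] x [[xy xyS] xq yq]; have := IH y yq.
have xq' : x \notin q by apply/negP => /xq; rewrite in_coset_refl.
have h1 : inl x \notin inl y :: jump_path y q.
  rewrite in_cons negb_or; apply/andP; split; first by apply/eqP => -[].
  by apply: contra xq' => /jump_path_inl.
move: h1; rewrite [jump_path x _]/=; case: ifP => xyH h1 h2; last by rewrite /= h1.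
have h3 : inr (lcoset_set H y) \notin inl y :: jump_path y q.
  rewrite in_cons negb_or; apply/andP; split; first by apply/eqP.
  apply/negP => /jump_path_inr[z zq /in_lcoset yz].
  by have := xq z zq; rewrite (in_coset_trans xyH yz).
rewrite -[_ ++ _]/[:: inr (lcoset_set H y), inl y & jump_path y q].
by rewrite !cons_uniq h3 in_cons negb_or h1 -cons_uniq h2 !andbT; apply/eqP.
Qed.

Lemma jump_path_length x q : path_length coned (inl x) (jump_path x q) = (size q)%:R.
Proof.
elim: q x => [//|y q IH] x /=.
case: ifP => _ /=; rewrite IH -[(size q).+1]add1n natrD //.
by rewrite addrA -[2^-1]mul1r -splitr.
Qed.

(** * Lifting jumps to paths of the Cayley graph *)

Hypothesis H_gen : generates [seq s <- S | s \in H] H.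

Lemma coset_path_exists x y : in_coset H x y -> exists r,
  [/\ path (cayley_adj S) x r, last x r = y & all (in_coset H x) r].
Proof.
(* The starting point is arbitrary, so that paths can be concatenated and reversed, which makes [K]
   a subgroup. *)
pose K : {pred G} := fun h => `[< forall x, exists r,
  [/\ path (cayley_adj S) x r, last x r = (x * h)%g & all (in_coset H x) r] >].
suff HK : {subset H <= K}.
  move=> xy; have /asboolP/(_ x)[r] := HK _ xy.
  by rewrite mulVKg; exists r.
have cosetM g h k : in_coset H g (g * h)%g -> in_coset H (g * h)%g k -> in_coset H g k.
  exact: in_coset_trans.
have K_step s : s \in S -> s \in H -> s \in K /\ s^-1%g \in K.
  move=> sS sH; case: (eqVneq s 1%g) => [->|s1].
    by rewrite invg1; split; apply/asboolP => z; exists [::]; rewrite mulg1.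
  split; apply/asboolP => z; [exists [:: z * s]%g | exists [:: z * s^-1]%g].
    split=> //=; last by rewrite /in_coset mulKg sH.
    rewrite andbT /cayley_adj mulKg sS andbT; apply: contra s1 => /eqP zE.
    by apply/eqP; apply: (mulgI z); rewrite mulg1.
  split=> //=; last by rewrite /in_coset mulKg gpredV sH.
  rewrite andbT /cayley_adj invgM invgK mulgVK sS orbT andbT.
  apply: contra s1 => /eqP zE; rewrite -[s]invgK -[X in _ == X]invg1; apply/eqP; congr (_^-1)%g.
  by apply: (mulgI z); rewrite mulg1.
have KH h : h \in K -> h \in H.
  move=> /asboolP/(_ 1%g)[r [_ rl rH]]; move: rl rH; rewrite mul1g.
  case/lastP: r => [/= <- _|r z]; first exact: gpred1.
  by rewrite last_rcons all_rcons => -> /andP[]; rewrite /in_coset invg1 mul1g.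
have KM u v : u \in K -> v \in K -> (u * v)%g \in K.
  move=> uK vK; have uH := KH u uK; have uc z : in_coset H z (z * u)%g by rewrite /in_coset mulKg.
  apply/asboolP => z.
  move: uK vK => /asboolP/(_ z)[r1 [p1 l1 a1]] /asboolP/(_ (z * u)%g)[r2 [p2 l2 a2]].
  exists (r1 ++ r2); split; first by rewrite cat_path p1 l1.
    by rewrite last_cat l1 l2 mulgA.
  rewrite all_cat a1 /=; apply: sub_all a2 => k; exact: cosetM.
have KV u : u \in K -> u^-1%g \in K.
  move=> uK; have uH := KH u uK; apply/asboolP => z.
  have uc : in_coset H z (z * u^-1)%g by rewrite /in_coset mulKg gpredV.
  move: uK => /asboolP/(_ (z * u^-1)%g)[r [p1 l1 a1]]; rewrite mulgVK in l1.
  exists (rev (belast (z * u^-1)%g r)); split.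
  - have := rev_path (cayley_adj S) (z * u^-1)%g r; rewrite l1 => ->.
    by apply: sub_path p1 => i j; exact: cayley_adjC.
  - case: r l1 {p1 a1} => [/= /esym //|k r _].
    by rewrite [belast _ _]/= rev_cons last_rcons.
  - rewrite all_rev; apply/allP => k kr; have : k \in (z * u^-1)%g :: r.
      by rewrite lastI mem_rcons inE kr orbT.
    rewrite inE => /predU1P[->//|kr']; apply: in_coset_trans uc _.
    exact: (allP a1).
have Kgrp : group_closed K.
  split; last by move=> u v uK vK; apply: KM => //; exact: KV.
  by apply/asboolP => z; exists [::]; rewrite mulg1.
apply: H_gen Kgrp _ => s; rewrite mem_filter => /andP[sH sS].
by have [] := K_step s sS sH.
Qed.

Definition coset_path (x y : G) : seq G :=
  if pselect (exists r, [/\ path (cayley_adj S) x r, last x r = y & all (in_coset H x) r])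
    is left h then sval (cid h) else [::].

Lemma coset_pathP x y : in_coset H x y ->
  [/\ path (cayley_adj S) x (coset_path x y), last x (coset_path x y) = y &
      all (in_coset H x) (coset_path x y)].
Proof.
by move=> /coset_path_exists h; rewrite /coset_path; case: pselect => // h'; case: cid.
Qed.

Fixpoint lift (x : G) (q : seq G) : seq G :=
  if q is y :: q' then
    (if in_coset H x y then coset_path x y else [:: y]) ++ lift y q'
  else [::].

Fixpoint jumps (x : G) (q : seq G) : Prop :=
  if q is y :: q' then jump x y /\ jumps y q' else True.

Lemma tight_jumps x q : tight x q -> jumps x q.
Proof. by elim: q x => [//|y q IH] x [xy _ /IH]. Qed.

Lemma jump_edge_path x q : jumps x q ->
  edge_path (coned_adj S H) (inl x) (jump_path x q).
Proof.
elim: q x => [//|y q IH] x [[xy xyS] /IH yq] /=.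
case: ifP => xyH /=; first by split=> //; rewrite (lcoset_in xyH).
by split=> //; case: xyS => // xyH'; rewrite xyH' in xyH.
Qed.

Lemma lift_path x q : jumps x q -> path (cayley_adj S) x (lift x q).
Proof.
elim: q x => [//|y q IH] x [[_ xyS] /IH yq] /=; rewrite cat_path.
case: ifP => xyH; last by case: xyS => [|xy]; rewrite ?xyH //= xy.
by have [-> -> _] := coset_pathP xyH.
Qed.

Lemma lift_last x q : jumps x q -> last x (lift x q) = last x q.
Proof.
elim: q x => [//|y q IH] x [_ /IH yq] /=; rewrite last_cat.
case: ifP => xyH //; by have [_ -> _] := coset_pathP xyH.
Qed.

Lemma lift_coset x q z : z \in lift x q -> exists2 y, y \in q & in_coset H y z.
Proof.
elim: q x => [//|y q IH] x /=; rewrite mem_cat => /orP[|/IH[u uq uz]]; last first.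
  by exists u => //; rewrite inE uq orbT.
case: ifP => xyH.
  have [_ _ /allP xr] := coset_pathP xyH => /xr xz; exists y; first exact: mem_head.
  by apply: in_coset_trans xz; rewrite in_cosetC.
by rewrite inE => /eqP->; exists y; [exact: mem_head | exact: in_coset_refl].
Qed.

(* [b] records that the walk reached [x] by a jump. *)
Fixpoint alternating_jumps (b : bool) (x : G) (q : seq G) : bool :=
  if q is y :: q' then
    if in_coset H x y then ~~ b && alternating_jumps true y q'
    else alternating_jumps false y q'
  else true.

Lemma hat_rec_run x r p : all (in_coset H x) r -> r != [::] ->
  hat_rec H true x (r ++ p) = hat_rec H true (last x r) p.
Proof.
elim: r x => [//|y r IH] x /= /andP[xy xr] _; rewrite xy.
case: r IH xr => [//|z r] IH xr; apply: IH => //.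
apply: sub_all xr => w; apply: in_coset_trans; by rewrite in_cosetC.
Qed.

Lemma hat_rec_run0 x r p : all (in_coset H x) r -> r != [::] ->
  hat_rec H false x (r ++ p) = hat_rec H true (last x r) p.
Proof.
case: r => [//|y r] /= /andP[xy xr] _; rewrite xy.
case: r xr => [//|z r] xr; apply: (@hat_rec_run y (z :: r)) => //.
apply: sub_all xr => w; apply: in_coset_trans; by rewrite in_cosetC.
Qed.

(** Each jump lifts to a run in one coset, which the hat construction collapses to a passage through
    the cone vertex. Two successive jumps in the same coset would merge into one run, hence the
    alternation. *)
Lemma hat_rec_lift (b : bool) x q : jumps x q -> alternating_jumps b x q ->
  hat_rec H b x (lift x q) =
  (if b then [:: inr (lcoset_set H x); inl x] else [::]) ++ jump_path x q.
Proof.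
elim: q b x => [|y q IH] b x; first by rewrite /= cats0.
move=> [[xy xyS] yq] /=; case: ifP => xyH.
  case: b => //= yqb; have [_ xr_last xr] := coset_pathP xyH.
  rewrite hat_rec_run0 ?xr_last ?IH //.
  by apply: contra_notN xy => /eqP r0; rewrite r0 in xr_last.
by move=> yqb; rewrite /= xyH IH.
Qed.

Lemma tight_alternating (b : bool) x q : tight x q ->
  (b -> forall y q', q = y :: q' -> ~~ in_coset H x y) -> alternating_jumps b x q.
Proof.
elim: q b x => [//|y q IH] b x [xy xq yq] bq /=; case: ifP => xyH; last exact: IH.
apply/andP; split; first by apply/negP => /bq/(_ y q erefl); rewrite xyH.
apply: IH => // _ z q' qE; have := xq z; rewrite qE mem_head => /(_ isT).
by apply: contra; exact: in_coset_trans.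
Qed.

Lemma jump_quasi_geodesic (N : R) x q : jumps x q -> alternating_jumps false x q ->
  uniq (inl x :: jump_path x q) ->
  1 <= N -> (size q)%:R <= N -> rel_quasi_geodesic S H (2 * N) x (lift x q).
Proof.
move=> qj qa qu N1 qN t t'; have qe := jump_edge_path qj.
have hatE : hat_path H x (lift x q) = jump_path x q by rewrite /hat_path hat_rec_lift.
rewrite /hat_length /hat_point hatE => t0 t'0.
apply: (arclength_bilipschitz _ _ _ qe qu N1 _ t0 t'0).
- by move=> u v _; exact: coned_len_ge0.
- by move=> u v _; rewrite coned_lenE mulr_gt0 ?invr_gt0 // ltr0n coned_wt_gt0.
- by move=> u v _; rewrite coned_lenE ler_peMr ?invr_ge0 // ler1n coned_wt_gt0.
- by rewrite jump_path_length.
Qed.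

(* A walk in the coned-off graph that avoids the cone vertex of [A], recorded
   by the elements of [G] that it visits. *)
Fixpoint steps (A : set G) (x : G) (q : seq G) : Prop :=
  if q is y :: q' then
    (cayley_adj S x y \/ in_coset H x y /\ ~ A x) /\ steps A y q'
  else True.

Lemma steps_cat A x q1 q2 : steps A x (q1 ++ q2) <->
  steps A x q1 /\ steps A (last x q1) q2.
Proof.
elim: q1 x => [|y q1 IH] x /=; first by split=> [//|[]].
by split=> [[xy /IH[]]|[[xy q1P] q2P]]; [|split=> //; apply/IH].
Qed.

(** While the walk stands at a cone vertex, the recorded element is still the last one visited;
    hence the two possibilities for [u]. *)
Lemma walk_steps A n u v b : walk (avoiding (coned_adj S H) (inr A)) (@coned_wt G) n u v ->
  is_cone H (inr A) -> v = inl b ->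
  forall a, u = inl a \/ u = inr (lcoset_set H a) ->
  exists q, [/\ steps A a q, last a q = b & (size q <= n)%N].
Proof.
move=> uv [c [Ac]]; elim: uv => {n u v} [u ub|u v w n [uv uA vA] vw IH wb] a.
  by case=> ua; exists [::]; move: ua; rewrite ub // => -[->].
have {}IH := IH wb; case=> ua; subst u.
  case: v uv uA vA vw IH => [h|B] uv uA vA vw IH.
    have [q [qs qb qn]] := IH h (or_introl erefl).
    by exists (h :: q); split=> //=; [split=> //; left | lia].
  have [q [qs qb qn]] := IH a (or_intror (congr1 inr uv)).
  by exists q; split=> //=; lia.
case: v uv uA vA vw IH => [h|//] uv uA vA vw IH.
have [q [qs qb qn]] := IH h (or_introl erefl).
exists (h :: q); split=> //=.
split=> //; right; split; first exact: in_lcoset.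
move=> Aa; apply: uA; rewrite Ac; congr inr; apply: lcoset_in.
by rewrite in_cosetC; move: Aa; rewrite Ac.
Qed.

(** If a later vertex lies in the coset of the first one, jump to it directly; this is a legal step
    because the walk stays outside [A]. *)
Lemma tight_exists A x q : steps A x q -> (forall z, z \in x :: q -> ~ A z) ->
  exists q', [/\ tight x q', last x q' = last x q, (size q' <= size q)%N & {subset q' <= q}].
Proof.
have [n] := ubnP (size q); elim: n q x => // n IH q x.
case: q => [_ _|y q]; first by exists [::].
move=> /= qn [xy yq] qA.
have yA z : z \in y :: q -> ~ A z by move=> zq; apply: qA; rewrite inE zq orbT.
case: (eqVneq x y) => [xy'|/eqP xy'].
  subst y; have [|q' [q't q'l q's q'sub]] := IH q x _ yq yA; first by [].
  exists q'; split=> //; first exact: leqW.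
  by move=> w /q'sub; rewrite inE orbC => ->.
case: (pselect (exists2 z, z \in q & in_coset H x z)) => [[z zq xz]|nz].
  case/splitPr: zq qn yq qA yA => q1 q2 qn /steps_cat[_ /= [_ zq2]] qA yA.
  have [|||q' [q't q'l q's q'sub]] := IH (z :: q2) x.
  - by move: qn; rewrite size_cat /=; lia.
  - split=> //; right; split=> //; apply: qA; exact: mem_head.
  - by move=> w wq; apply: qA; move: wq; rewrite !inE mem_cat inE => /or3P[]->; rewrite ?orbT.
  exists q'; split=> //; first by rewrite q'l /= last_cat.
    by move: q's; rewrite size_cat /=; lia.
  by move=> w /q'sub wq; rewrite inE mem_cat wq !orbT.
have [|q' [q't q'l q's q'sub]] := IH q y _ yq yA; first by [].
exists (y :: q'); split=> //; last first.
  by move=> w; rewrite !inE => /predU1P[->|/q'sub->]; rewrite ?eqxx ?orbT.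
split=> //; first by split=> //; case: xy => [xyS|[]]; [right|left].
by move=> z /q'sub zq; apply/negP => xz; apply: nz; exists z.
Qed.

(** * Consequences of penetration *)

Hypothesis bcp : bounded_coset_penetration R S H.

(* By penetration, the path [x, a, c, y] through a long jump in the coset [A]
   would force the tight walk from [x] to [y] to meet [A]. *)
Lemma excursion (N : nat) : exists r : nat, forall A a c x y q,
  is_cone H (inr A) -> A a -> A c -> cayley_adj S a x -> cayley_adj S y c ->
  steps A x q -> last x q = y -> (size q <= N)%N -> (forall z, z \in x :: q -> ~ A z) ->
  (word_len S a c <= r)%N.
Proof.
(* Both paths have at most [N + 3] jumps: 3 for the one through [A], at most [N] for the tight
   one. *)
have [|r0 r0P] := bcp (T := 2 * (N + 3)%:R); first by rewrite mulr_gt0 // ltr0n addn_gt0 orbT.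
exists (maxn 2 (Num.truncn `|r0|).+1) => A a c x y q [g [AE]] Aa Ac ax yc qs qy qN qA.
subst A; rewrite leq_max; have Ax : ~ lcoset_set H g x by apply: qA; exact: mem_head.
have Ay : ~ lcoset_set H g y by apply: qA; rewrite -qy mem_last.
have ga : in_coset H g a by [].
have ac : in_coset H a c by apply: in_coset_trans (_ : in_coset H g c) => //; rewrite in_cosetC.
have xa : in_coset H x a = false.
  by apply/negP => xa; apply: Ax; apply: in_coset_trans ga _; rewrite in_cosetC.
have cy : in_coset H c y = false.
  by apply/negP => cy; apply: Ay; apply: in_coset_trans ga _; exact: in_coset_trans cy.
case: (eqVneq a c) => [->|/eqP ac']; first by rewrite /word_len distxx.
(* If [x = y], the path through [A] is closed and not simple, but [a] and [c] are both adjacent to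
   [x]; this accounts for the 2 in the bound. *)
case: (eqVneq x y) => [xy|/eqP xy].
  apply/orP; left; apply: leq_trans (word_len_triangle S_gen a x c) _.
  have h1 := word_len_adj ax; have h2 := word_len_adj yc; rewrite -xy in h2; lia.
apply/orP; right; have [q' [q't q'l q's q'sub]] := tight_exists qs qA.
pose p1 := lift x [:: a; c; y]; pose p2 := lift x q'.
have neq_coset u v : ~ lcoset_set H g u -> lcoset_set H g v -> u <> v.
  by move=> nu gv uv; rewrite uv in nu.
have jp1 : jumps x [:: a; c; y].
  split; first by split; [exact: neq_coset | right; exact: cayley_adjC].
  split; first by split=> //; left.
  by split=> //; split; [move=> /esym; exact: neq_coset | right; exact: cayley_adjC].
have jp2 := tight_jumps q't.
have N1 : 1 <= (N + 3)%:R :> R by rewrite ler1n addn_gt0 orbT.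
have qg1 : rel_quasi_geodesic S H (2 * (N + 3)%:R : R) x p1.
  apply: (@jump_quasi_geodesic (N + 3)%:R x [:: a; c; y]) => //;
    [by rewrite /= xa ac cy | | by rewrite ler_nat [size _]/= leq_addl].
  have -> : jump_path x [:: a; c; y] = [:: inl a; inr (lcoset_set H c); inl c; inl y : W].
    by rewrite /= xa ac cy.
  have hx : inl x \notin [:: inl a; inr (lcoset_set H c); inl c; inl y : W].
    rewrite !inE !negb_or; apply/and4P; split; apply/eqP => // -[] //; exact: neq_coset.
  have ha : inl a \notin [:: inr (lcoset_set H c); inl c; inl y : W].
    rewrite !inE !negb_or; apply/and3P; split; apply/eqP => // -[] // /esym; exact: neq_coset.
  have hc : inl c \notin [:: inl y : W].
    by rewrite inE; apply/eqP => -[/esym]; exact: neq_coset.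
  have hA : inr (lcoset_set H c) \notin [:: inl c; inl y : W].
    by rewrite !inE !negb_or; apply/andP; split; apply/eqP.
  by rewrite !cons_uniq hx ha hA hc.
have qg2 : rel_quasi_geodesic S H (2 * (N + 3)%:R : R) x p2.
  apply: (@jump_quasi_geodesic (N + 3)%:R x q') => //; first exact: tight_alternating.
    exact: tight_uniq.
  by rewrite ler_nat; lia.
have [|travel _] := r0P x p1 p2 (lift_path jp1) (lift_path jp2) _ qg1 qg2.
  by rewrite !lift_last // q'l qy.
(* The points of [p2] lie in cosets of vertices of [q], none of which is [A]. *)
have nenter : ~ enters H x p2 a.
  move=> /hasP[z]; rewrite inE => /predU1P[->|/lift_coset[u uq uz]] az.
    by apply: Ax; exact: in_coset_trans az.
  apply: (qA u); first by rewrite inE q'sub ?orbT.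
  by apply: in_coset_trans ga _; apply: in_coset_trans az _; rewrite in_cosetC.
have [cp cl ca] := coset_pathP ac.
have : ~ travels S H r0 x p1 a by move=> /travel.
move=> ntravel; have : word_dist R S a c < r0.
  rewrite ltNge; apply/negP => r0ac; apply: ntravel.
  have p1E : p1 = a :: coset_path a c ++ [:: y] by rewrite /p1 /= xa ac cy.
  have nthE k : (k <= size (coset_path a c))%N ->
      nth x (x :: p1) k.+1 = nth x (a :: coset_path a c) k.
    by move=> kn; rewrite p1E /= -cat_cons nth_cat /= ltnS kn.
  exists 1%N, (size (coset_path a c)).+1; split.
  - by rewrite p1E /= size_cat /=; lia.
  - case=> [//|k] /andP[_ kn]; rewrite nthE //.
    have : nth x (a :: coset_path a c) k \in a :: coset_path a c by apply: mem_nth.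
    by rewrite inE => /predU1P[->|/(allP ca)//]; exact: in_coset_refl.
  - by rewrite (nthE _ (leqnn _)) (nthE 0%N) // -(last_nth x) cl.
rewrite word_distE => acr; apply: ltnW; rewrite -(ltr_nat R).
apply: lt_trans acr _; apply: le_lt_trans (ler_norm r0) _.
exact: truncnS_gt.
Qed.

Lemma first_return (A : set G) x q : ~ A x -> A (last x q) -> exists q1 c q2,
  [/\ q = q1 ++ c :: q2, forall z, z \in x :: q1 -> ~ A z & A c].
Proof.
elim: q x => [//|y q IH] x nx /=; case: (pselect (A y)) => [Ay _|ny /(IH y ny)].
  by exists [::], y, q; split=> // z; rewrite inE => /eqP->.
move=> [q1 [c [q2 [-> q1A Ac]]]]; exists (y :: q1), c, q2; split=> // z.
by rewrite inE => /predU1P[->|/q1A].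
Qed.

(** The walk is cut at its visits to [A]. Jumps do not start in [A], so it leaves and re-enters [A]
    by Cayley edges and the hypothesis bounds each excursion; an edge inside [A] costs 1, at most
    [r]. *)
Lemma steps_bound (N r : nat) : (0 < r)%N ->
  (forall A a c x y q,
    is_cone H (inr A) -> A a -> A c -> cayley_adj S a x -> cayley_adj S y c ->
    steps A x q -> last x q = y -> (size q <= N)%N -> (forall z, z \in x :: q -> ~ A z) ->
    (word_len S a c <= r)%N) ->
  forall A a q, is_cone H (inr A) -> (size q <= N)%N -> A a -> steps A a q ->
  A (last a q) -> (word_len S a (last a q) <= size q * r)%N.
Proof.
move=> r0 rP A a q cA; have [n] := ubnP (size q); elim: n q a => // n IH q a.
case: q => [_ _ _ _ _|x q]; first by rewrite /word_len distxx.
move=> /= qn qN Aa [ax xq] Al.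
have {}ax : cayley_adj S a x by case: ax => // -[].
have tri := word_len_triangle S_gen.
case: (pselect (A x)) => [Ax|nx].
  have := IH q x qn (ltnW qN) Ax xq Al; have := tri a x (last x q).
  have := word_len_adj ax; rewrite mulSn; lia.
have [q1 [c [q2 [qE q1A Ac]]]] := first_return nx Al.
move: xq; rewrite qE => /steps_cat[xq1 /= [yc cq2]].
have {}yc : cayley_adj S (last x q1) c.
  (* A jump to [c] would start in the coset of [c], which is [A]. *)
  case: yc => // -[yc _]; case: (q1A _ (mem_last x q1)).
  have [g [AE]] := cA; rewrite AE in Ac *.
  by apply: in_coset_trans (Ac : in_coset H g c) _; rewrite in_cosetC.
have sz : size q = (size q1 + (size q2).+1)%N by rewrite qE size_cat.
have h1 := rP A a c x _ q1 cA Aa Ac ax yc xq1 erefl.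
have {}h1 : (word_len S a c <= r)%N by apply: h1 => //; lia.
have h2 : (word_len S c (last c q2) <= size q2 * r)%N.
  by apply: IH => //; [lia | lia | move: Al; rewrite qE last_cat].
rewrite last_cat /= size_cat /=; have := tri a c (last c q2).
have : ((size q2).+1 * r <= (size q1 + (size q2).+1).+1 * r)%N.
  by rewrite leq_mul2r; apply/orP; right; lia.
rewrite !mulSn; lia.
Qed.

Lemma fineness (N : nat) : exists L : nat, forall B a b n, is_cone H B ->
  coned_adj S H a B -> coned_adj S H b B -> (n <= N)%N ->
  walk (avoiding (coned_adj S H) B) (@coned_wt G) n a b -> (cone_angle S a b <= L)%N.
Proof.
(* [r.+1] replaces [r] because [steps_bound] asks for a positive bound. *)
have [r rP] := excursion N; exists (N * r.+1)%N => B a b n cB aB bB nN ab.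
have [a' aE Ba] := cone_nbr cB aB; have [b' bE Bb] := cone_nbr cB bB; subst a b.
case: B cB aB bB ab Ba Bb => [? [? //]|A] cA aA bA ab [Aa] [Ab].
have Aa' : A a' by rewrite Aa; exact: lcoset_set_refl.
have Ab' : A b' by rewrite Ab; exact: lcoset_set_refl.
have [q [qs qb qn]] := walk_steps ab cA erefl (or_introl erefl).
have rP' A0 a0 c x y q0 : is_cone H (inr A0) -> A0 a0 -> A0 c -> cayley_adj S a0 x ->
    cayley_adj S y c -> steps A0 x q0 -> last x q0 = y -> (size q0 <= N)%N ->
    (forall z, z \in x :: q0 -> ~ A0 z) -> (word_len S a0 c <= r.+1)%N.
  by move=> *; apply/leqW/(rP A0 a0 c x y q0).
rewrite /= -qb.
apply: leq_trans (steps_bound (ltn0Sn r) rP' cA (leq_trans qn nN) Aa' qs _) _.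
  by rewrite qb.
by rewrite leq_mul2r; apply/orP; right; exact: leq_trans nN.
Qed.

End Translation.

Theorem corollary1p4 (R : realType) (G : groupType) (H : groupClosed G) :
  torsion_free G -> rel_hyperbolic R H ->
  (finite_cd G <-> finite_cd (subgroup_type H)).
Proof.
move=> torsion [S [S_gen H_gen weak bcp]]; split=> [[n cdG]|].
  by exists n; exact: cd_le_sub.
have [delta hyp] := four_point S_gen weak.
have [L fine] := fineness S_gen H_gen bcp (16 * delta + 32).
exact: (finite_cd_coned S_gen hyp fine torsion).
Qed.
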